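(* Let $K_7^{=}$ denote the graph obtained from the complete graph $K_7$ by deleting two independent (i.e. vertex-disjoint) edges. Let $G$ be a graph with $n\ge 3$ vertices. If $G$ is $4$-bilight and has at least $4n-7$ edges, then $G$ contains $K_7^{=}$ as a minor.
   Context: Graphs are finite and simple. A graph $H$ is a minor of a graph $G$ if a graph isomorphic to $H$ can be obtained from a subgraph of $G$ by repeatedly contracting edges (discarding loops and parallel edges). A fragment of a graph $G$ is a non-empty set $Y\subseteq V(G)$. For a fragment $Y$, let $\partial_G Y$ be the set of vertices in $V(G)\setminus Y$ that have a neighbor in $Y$, let $\rho(G,Y)$ be the number of edges of $G$ with at least one end in $Y$, and let $\rho_4(G,Y)=\rho(G,Y)-4|Y|$. A bifragment in $G$ is a pair $(S,T)$ of disjoint fragments such that $G$ has no edge with one end in $S$ and the other end in $T$. It is a $(\le 4)$-bifragment if $|\partial_G S|\le 4$ and $|\partial_G T|\le 4$, and it is dense if $\rho_4(G,S)>0$ and $\rho_4(G,T)>0$. The graph $G$ is $4$-bilight if it has no dense $(\le 4)$-bifragment. *)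

(* Defs.v *)
From mathcomp Require Import all_boot all_order all_algebra.

Set Implicit Arguments.
Unset Strict Implicit.
Unset Printing Implicit Defensive.

Record sgraph := SGraph {
  vertex :> finType;
  adj : rel vertex;
  adj_sym : symmetric adj;
  adj_irrefl : irreflexive adj }.

Definition edges (G : sgraph) : {set {set G}} :=
  [set [set p.1; p.2] | p : G * G & adj p.1 p.2].

Definition iso (G H : sgraph) : Prop :=
  exists2 f : G -> H, bijective f & forall x y, adj (f x) (f y) = adj x y.

(* Members of D that are not edges of G are ignored. *)
Section DelEdges.
Variables (G : sgraph) (D : {set {set G}}).
Definition del_edges_adj : rel G :=
  fun x y => adj x y && ([set x; y] \notin D).
Fact del_edges_sym : symmetric del_edges_adj.
Proof. by move=> x y; rewrite /del_edges_adj adj_sym setUC. Qed.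
Fact del_edges_irrefl : irreflexive del_edges_adj.
Proof. by move=> x; rewrite /del_edges_adj adj_irrefl. Qed.
Definition del_edges := SGraph del_edges_sym del_edges_irrefl.
End DelEdges.

Section Induced.
Variables (G : sgraph) (A : {set G}).
Definition induced_adj : rel {x : G | x \in A} :=
  fun u v => adj (val u) (val v).
Fact induced_sym : symmetric induced_adj.
Proof. by move=> u v; rewrite /induced_adj adj_sym. Qed.
Fact induced_irrefl : irreflexive induced_adj.
Proof. by move=> u; rewrite /induced_adj adj_irrefl. Qed.
Definition induced := SGraph induced_sym induced_irrefl.
End Induced.

(* Every subgraph of G arises by deleting a set D of edges and keeping a set
   A of vertices. *)
Definition subgraph (G : sgraph) (D : {set {set G}}) (A : {set G}) : sgraph :=
  @induced (del_edges D) A.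

(* Contraction of xy: y is identified with x, so that the vertices are those
   of G other than y, and each edge ab of G becomes r(a)r(b), where r sends y
   to x and fixes the other vertices.  Meaningful only when x and y are
   adjacent. *)
Section Contract.
Variables (G : sgraph) (x y : G).
Definition merge_vertex (z : G) : G := if z == y then x else z.
Definition contract_adj : rel {z : G | z != y} := fun u v =>
  (u != v) && [exists a, exists b,
    [&& merge_vertex a == val u, merge_vertex b == val v & adj a b]].
Fact contract_sym : symmetric contract_adj.
Proof.
suff H u v : contract_adj u v -> contract_adj v u.
  by move=> u v; apply/idP/idP; apply: H.
case/andP=> uv /existsP[a /existsP[b /and3P[au bv ab]]].
rewrite /contract_adj eq_sym uv; apply/existsP; exists b; apply/existsP; exists a.
by rewrite au bv adj_sym.
Qed.
Fact contract_irrefl : irreflexive contract_adj.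
Proof. by move=> u; rewrite /contract_adj eqxx. Qed.
Definition contract := SGraph contract_sym contract_irrefl.
End Contract.

Inductive contracts_to : sgraph -> sgraph -> Prop :=
| contracts_refl G : contracts_to G G
| contracts_step (G H : sgraph) (x y : G) :
    adj x y -> contracts_to (contract x y) H -> contracts_to G H.

Definition is_minor (H G : sgraph) : Prop :=
  exists (D : {set {set G}}) (A : {set G}) (K : sgraph),
    contracts_to (subgraph D A) K /\ iso K H.

Section Complete.
Variable n : nat.
Definition complete_adj : rel 'I_n := fun i j => i != j.
Fact complete_sym : symmetric complete_adj.
Proof. by move=> i j; rewrite /complete_adj eq_sym. Qed.
Fact complete_irrefl : irreflexive complete_adj.
Proof. by move=> i; rewrite /complete_adj eqxx. Qed.
Definition complete := SGraph complete_sym complete_irrefl.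
End Complete.

Definition K7eq : sgraph :=
  @del_edges (complete 7)
    [set [set inord 0; inord 1]; [set inord 2; inord 3]].

Section Fragments.
Variable G : sgraph.
Implicit Types S T Y : {set G}.

Definition fragment Y : Prop := Y != set0.

Definition boundary Y : {set G} :=
  [set v in ~: Y | [exists y in Y, adj v y]].

Definition rho Y : nat := #|[set e in edges G | e :&: Y != set0]|.

Definition rho4 Y : int := ((rho Y)%:Z - 4%:Z * #|Y|%:Z)%R.

Definition bifragment S T : Prop :=
  [/\ fragment S, fragment T, [disjoint S & T] &
      forall s t, s \in S -> t \in T -> ~~ adj s t].

Definition le4_bifragment S T : Prop :=
  [/\ bifragment S T, #|boundary S| <= 4 & #|boundary T| <= 4].

Definition dense S T : Prop := (0 < rho4 S)%R /\ (0 < rho4 T)%R.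
End Fragments.

Definition bilight4 (G : sgraph) : Prop :=
  ~ exists S T : {set G}, le4_bifragment S T /\ dense S T.

(* Main.v *)
Require Import Defs.
From mathcomp Require Import all_boot all_order all_algebra.
From Stdlib Require Import Classical.
From mathcomp Require Import zify.

Set Implicit Arguments.
Unset Strict Implicit.
Unset Printing Implicit Defensive.

(* Let D be K_8 minus the edges of a 4-cycle a1 b1 a2 b2; thus D consists of two
   edges a1 a2 and b1 b2 and of a K_4 on z_1, ..., z_4 completely joined to them.

   (1) A graph with n >= 3 vertices and at least 4n - 8 edges has a K7eq or a D
   minor.  In a minimal counterexample with exactly 4n - 8 edges, every edge lies
   in at least four triangles, and a cut Y whose two sides can both be contracted
   onto Y so as to make Y complete has exactly four vertices, pairwise adjacent.
   Some vertex v has degree 5, 6 or 7, so the complement of its neighbourhood has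
   maximum degree at most 2; a finite check leaves only a few such complements,
   and in each of them the components of G - N[v] supply the missing adjacency, a
   D, or a forbidden cut.

   (2) If G has a D minor but no K7eq minor, then some set S with at most four
   boundary vertices contains both a-branch sets while the b-branch sets lie
   outside S and its boundary.  Otherwise one may assume that the a- and b-branch
   sets are single vertices and that both ends of every edge inside a z-branch set
   lie on the boundary of a set S of the same kind with five boundary vertices.
   By submodularity such sets form a chain, each obtained from the previous one by
   adding one vertex of the unique pair of boundary vertices in a common branch
   set.  Following this chain gives five disjoint paths between the a's and the
   b's; a finite automaton shows that as long as no K7eq arises from them, the
   z-branch sets met so far are not pairwise adjacent.

   (3) Call K light if rho4 K <= 0.  Take U minimal such that every component of
   G - U is light and has at most four boundary vertices.  Then G[U] has at least
   4|U| - 7 edges, so (1) gives a D in G[U] and (2) gives S; its boundary is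
   contained in U, since it meets all four z-branch sets.  As G is 4-bilight, all
   components of S, or all components of the rest, are light; removing that side
   from U contradicts minimality. *)

(** * Connected sets *)

(** The graph D is the obstacle in (1). It has 24 = 4 * 8 - 8 edges but no K7eq minor: a minor of D
    on seven vertices always misses two edges with a common end, whereas K7eq misses two disjoint
    ones. In D the pairs {a1, a2} and {b1, b2} each meet 9 > 4 * 2 edges and have the four z's as
    boundary, so they form a dense bifragment. This is the picture that bilightness forbids, and (2)
    recovers a trace of it in any graph with a D minor. The number five in (2) is one more than the
    number of z-branch sets. A set between the a's and the b's has a boundary vertex in each of the
    four, so a boundary with five vertices repeats exactly one label. This single repeated label
    leaves so little freedom along the chain that a finite automaton can follow it: it records which
    paths are known to be adjacent, which label each path has reached, and which labels can be
    adjacent. *)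

Section Connected.
Variable V : finType.
Implicit Types (e : rel V) (A B C K U : {set V}).

Definition touch e A B := [exists x in A, exists y in B, e x y].

(* Connectivity is stated with cuts rather than with paths. *)
Definition conn e K := (K != set0) &&
  [forall B : {set V}, [&& B \subset K, B != set0 & B != K] ==> touch e B (K :\: B)].

Lemma touchP e A B :
  reflect (exists x y, [/\ x \in A, y \in B & e x y]) (touch e A B).
Proof.
apply: (iffP exists_inP) => [[x xA /exists_inP[y yB exy]]|[x [y [xA yB exy]]]].
  by exists x, y.
by exists x => //; apply/exists_inP; exists y.
Qed.

Lemma touchS e A A' B B' : A \subset A' -> B \subset B' -> touch e A B -> touch e A' B'.
Proof.
move=> /subsetP sA /subsetP sB /touchP[x [y [xA yB exy]]].
by apply/touchP; exists x, y; split; [apply: sA | apply: sB |].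
Qed.

Lemma touch_sym e A B : symmetric e -> touch e A B = touch e B A.
Proof.
by move=> se; apply/touchP/touchP => -[x [y [xA yB exy]]]; exists y, x; split=> //; rewrite se.
Qed.

Lemma connP e K : reflect (K != set0 /\ forall B, B \subset K -> B != set0 -> B != K ->
   exists x y, [/\ x \in B, y \in K, y \notin B & e x y]) (conn e K).
Proof.
apply: (iffP andP) => -[K0 H]; split=> //.
  move=> B BK B0 BnK; move/forallP/(_ B): H; rewrite BK B0 BnK /= => /touchP[x [y [xB]]].
  by rewrite inE => /andP[yB yK] exy; exists x, y.
apply/forallP => B; apply/implyP => /and3P[BK B0 BnK].
have [x [y [xB yK yB exy]]] := H B BK B0 BnK.
by apply/touchP; exists x, y; rewrite !inE yK yB.
Qed.

Lemma conn0 e K : conn e K -> K != set0.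
Proof. by case/andP. Qed.

Lemma conn1 e x : conn e [set x].
Proof.
apply/connP; split; first by apply/set0Pn; exists x; rewrite inE.
by move=> B; rewrite subset1 => /orP[/eqP->|/eqP->]; rewrite eqxx.
Qed.

Lemma conn_mono e e' K : (forall x y, x \in K -> y \in K -> e x y -> e' x y) ->
  conn e K -> conn e' K.
Proof.
move=> ee' /connP[K0 H]; apply/connP; split=> // B BK B0 BnK.
have [x [y [xB yK yB exy]]] := H B BK B0 BnK; exists x, y; split=> //.
by apply: ee' => //; apply: (subsetP BK).
Qed.

Lemma connU e A B : symmetric e -> conn e A -> conn e B ->
  (touch e A B \/ ~~ [disjoint A & B]) -> conn e (A :|: B).
Proof.
move=> se /connP[A0 HA] /connP[B0 HB] AB; apply/connP; split.
  by have /set0Pn[x xA] := A0; apply/set0Pn; exists x; rewrite inE xA.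
move=> C CAB C0 CnAB.
have [CA|CnA] := boolP ((C :&: A != set0) && (C :&: A != A)).
  case/andP: CA => CA0 CAA.
  have [x [y [xC yA yC exy]]] := HA _ (subsetIr C A) CA0 CAA.
  by exists x, y; move: xC yC; rewrite !inE yA andbT => /andP[-> _] ->.
have [CB|CnB] := boolP ((C :&: B != set0) && (C :&: B != B)).
  case/andP: CB => CB0 CBB.
  have [x [y [xC yA yC exy]]] := HB _ (subsetIr C B) CB0 CBB.
  by exists x, y; move: xC yC; rewrite !inE yA orbT andbT => /andP[-> _] ->.
move: CnA CnB; rewrite !negb_and !negbK => CnA CnB.
have CE : C = (C :&: A) :|: (C :&: B) by rewrite -setIUr; apply/esym/setIidPl.
case/orP: CnA => /eqP CA; case/orP: CnB => /eqP CB; move: (CE); rewrite CA CB.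
- by rewrite setU0 => Ce; rewrite Ce eqxx in C0.
- rewrite set0U => Ce; case: AB => [/touchP[x [y [xA yB exy]]]|].
    exists y, x; rewrite Ce yB inE xA se exy; split=> //.
    apply/negP => xB; suff: x \in C :&: A by rewrite CA inE.
    by rewrite inE xA Ce xB.
  rewrite -setI_eq0 => /set0Pn[x]; rewrite inE => /andP[xA xB].
  suff: x \in C :&: A by rewrite CA inE.
  by rewrite inE xA Ce xB.
- rewrite setU0 => Ce; case: AB => [/touchP[x [y [xA yB exy]]]|].
    exists x, y; rewrite Ce xA inE yB orbT exy; split=> //.
    apply/negP => yA; suff: y \in C :&: B by rewrite CB inE.
    by rewrite inE yB Ce yA.
  rewrite -setI_eq0 => /set0Pn[x]; rewrite inE => /andP[xA xB].
  suff: x \in C :&: B by rewrite CB inE.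
  by rewrite inE xB Ce xA.
- by move=> Ce; rewrite Ce eqxx in CnAB.
Qed.

Lemma connU1 e A x y : symmetric e -> conn e A -> x \in A -> e x y -> conn e (y |: A).
Proof.
move=> se cA xA exy; apply: connU => //; first exact: conn1.
by left; apply/touchP; exists y, x; rewrite inE eqxx se.
Qed.

Lemma conn2 e x y : symmetric e -> e x y -> conn e [set x; y].
Proof. by move=> se exy; rewrite setUC; apply: (connU1 se (conn1 e x) (set11 x)). Qed.

Lemma conn_edge e K x : conn e K -> x \in K -> K != [set x] ->
  exists2 y, y \in K & (y != x) && e x y.
Proof.
move=> /connP[K0 H] xK Kx; have [|||z [y [zx yK yx ezy]]] := H [set x].
- by rewrite sub1set.
- by apply/set0Pn; exists x; rewrite inE.
- by rewrite eq_sym.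
by exists y => //; move: zx yx; rewrite !inE => /eqP <- ->.
Qed.

(** A connected subset of [U] through [x] of maximal size is closed under neighbours in [U], for
    [connU1] would enlarge it. *)
Lemma component e U x : symmetric e -> x \in U -> exists C, [/\ x \in C, C \subset U, conn e C &
  forall y z, y \in C -> z \in U -> e y z -> z \in C].
Proof.
move=> se xU; pose P (C : {set V}) := [&& x \in C, C \subset U & conn e C].
have P1 : P [set x] by rewrite /P set11 sub1set xU conn1.
case: (@arg_maxnP _ [set x] P (fun C => #|C|) P1) => C /and3P[xC CU cC] max.
exists C; split=> // y z yC zU eyz; apply/negPn/negP => zC.
have: P (z |: C).
  rewrite /P inE xC orbT subUset sub1set zU CU /=.
  exact: (connU1 se cC yC eyz).
by move/max; rewrite cardsU1 zC /=; lia.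
Qed.

Lemma conn_sub e K U C x : conn e K -> K \subset U -> x \in K -> x \in C ->
  (forall y z, y \in C -> z \in U -> e y z -> z \in C) -> K \subset C.
Proof.
move=> /connP[K0 H] KU xK xC cl.
have [/eqP/setIidPl -> //|KC] := boolP (K :&: C == K).
have [|y [z [yK zK zC eyz]]] := H _ (subsetIl K C) _ KC.
  by apply/set0Pn; exists x; rewrite inE xK.
move: yK zC; rewrite !inE zK /= => /andP[yK yC] /negP[].
by apply: (cl y) => //; apply: (subsetP KU).
Qed.

(* From a point of A walk inside K until B is met for the first time. *)
Lemma conn_trim e K A B : symmetric e -> conn e K -> ~~ [disjoint K & A] -> ~~ [disjoint K & B] ->
  exists K' b, [/\ K' \subset K, conn e K', ~~ [disjoint K' & A], K' :&: B = [set b] &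
     K' = [set b] \/ (conn e (K' :\ b) /\ ~~ [disjoint (K' :\ b) & A])].
Proof.
move=> se cK; rewrite -!setI_eq0 => /set0Pn[a]; rewrite inE => /andP[aK aA] /set0Pn[b].
rewrite inE => /andP[bK bB].
have [aB|aB] := boolP (a \in B).
  exists [set a], a; split=> //; rewrite ?sub1set ?conn1 //; last by left.
    by rewrite -setI_eq0; apply/set0Pn; exists a; rewrite !inE eqxx.
  by apply/setP => z; rewrite !inE; case: eqP => // ->.
have aU : a \in K :\: B by rewrite inE aB.
have [C [aC CU cC cl]] := component se aU.
have CK : C \subset K by apply: (subset_trans CU); apply: subsetDl.
have CnK : C != K.
  by apply/eqP => CK'; move: (subsetP CU b); rewrite CK' inE bK bB => /(_ isT).
have /connP[_ /(_ C CK (conn0 cC) CnK)[x [y [xC yK yC exy]]]] := cK.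
have yB : y \in B by apply/negPn/negP => yB; case/negP: yC; apply: (cl x) => //; rewrite inE yB.
have yCE : (y |: C) :\ y = C.
  apply/setP => z; rewrite !inE; case: eqP => //= ->; exact/esym/negbTE.
have CA : ~~ [disjoint C & A].
  by rewrite -setI_eq0; apply/set0Pn; exists a; rewrite inE aC.
exists (y |: C), y; split.
- by rewrite subUset sub1set yK.
- exact: (connU1 se cC xC exy).
- by rewrite -setI_eq0; apply/set0Pn; exists a; rewrite !inE aC aA orbT.
- apply/setP => z; rewrite !inE; case: eqP => [->|_] //=.
  by apply/negP => /andP[/(subsetP CU)]; rewrite inE => /andP[/negP].
- by right; rewrite yCE.
Qed.

End Connected.

(** * Minors as branch sets *)

Section Minor.
Implicit Types G H K : sgraph.

Definition fiber G H (phi : G -> option H) (h : H) : {set G} := [set x | phi x == Some h].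

(** Branch sets are the fibers of a partial map, which makes them disjoint by construction; [None]
    marks the deleted vertices. *)
Definition minor_map H G (phi : G -> option H) : Prop :=
  (forall h, conn (@adj G) (fiber phi h)) /\
  (forall h h', adj h h' -> touch (@adj G) (fiber phi h) (fiber phi h')).

Definition mm H G : Prop := exists phi : G -> option H, minor_map phi.

Lemma asym G : symmetric (@adj G). Proof. exact: adj_sym. Qed.

Definition preim G H (phi : G -> option H) (C : {set H}) : {set G} :=
  [set x | if phi x is Some h then h \in C else false].

(** If [B] splits some fiber, the connectivity of that fiber gives the edge. Otherwise [B] is a
    union of fibers, and an edge of [H] leaving the corresponding subset of [C] lifts to [G]. *)
Lemma conn_preim H G (phi : G -> option H) (C : {set H}) :
  minor_map phi -> conn (@adj H) C -> conn (@adj G) (preim phi C).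
Proof.
move=> [cf ef] /connP[C0 HC]; apply/connP; split.
  have /set0Pn[h hC] := C0; have /conn0/set0Pn[x] := cf h.
  by rewrite inE => /eqP xh; apply/set0Pn; exists x; rewrite inE xh.
move=> B BC B0 BnC.
have [/existsP[h /and3P[hC Bh0 Bh]]|/existsPn no] := boolP [exists h, [&& h \in C,
   B :&: fiber phi h != set0 & B :&: fiber phi h != fiber phi h]].
  have /connP[_ /(_ _ (subsetIr B _) Bh0 Bh)[x [y [xB yh yB exy]]]] := cf h.
  exists x, y; move: xB yB; rewrite !inE; move: yh; rewrite inE => /eqP ->.
  by rewrite eqxx andbT hC => /andP[-> _] ->.
pose B' := [set h in C | B :&: fiber phi h == fiber phi h].
have BB' x : x \in B -> exists2 h, phi x = Some h & h \in B'.
  move=> xB; have := subsetP BC x xB; rewrite inE; case E: (phi x) => [h|] // hC.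
  exists h => //; rewrite inE hC /=; move: (no h); rewrite hC /= negb_and !negbK.
  by case/orP => // /eqP; move/setP/(_ x); rewrite !inE xB E eqxx.
have B'C : B' \subset C by apply/subsetP => h; rewrite inE => /andP[].
have [||h [h' [hB' h'C h'B' ehh']]] := HC B' B'C.
- by have /set0Pn[x /BB'[h _ hB']] := B0; apply/set0Pn; exists h.
- apply: contra BnC => /eqP B'E; rewrite eqEsubset BC /=; apply/subsetP => x.
  rewrite inE; case E: (phi x) => [h|] //; rewrite -B'E inE => /andP[_ /eqP/setP/(_ x)].
  by rewrite !inE E eqxx andbT.
have /touchP[x [y [xh yh exy]]] := ef _ _ ehh'.
move: xh yh; rewrite !inE => /eqP xh /eqP yh.
exists x, y; split=> //.
- move: hB'; rewrite inE => /andP[_ /eqP/setP/(_ x)]; rewrite !inE xh eqxx andbT => -> //.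
- by rewrite inE yh.
- by apply/negP => /BB'[g]; rewrite yh => -[<-]; rewrite (negbTE h'B').
Qed.

Lemma mm_trans K H G : mm K H -> mm H G -> mm K G.
Proof.
move=> [psi [cp ep]] [phi mphi]; have [cf ef] := mphi.
have fE k : fiber (fun x => obind psi (phi x)) k = preim phi (fiber psi k).
  by apply/setP => x; rewrite !inE; case: (phi x) => //= h; rewrite inE.
exists (fun x => obind psi (phi x)); split => [k|k k' /ep/touchP[h [h' [hk hk' ehh']]]].
  by rewrite fE; apply: conn_preim.
have /touchP[x [y [xh yh exy]]] := ef _ _ ehh'.
move: xh yh; rewrite !inE => /eqP xh /eqP yh.
by apply/touchP; exists x, y; rewrite !fE !inE xh yh.
Qed.

Lemma mm_sets H G (W : H -> {set G}) : (forall h, conn (@adj G) (W h)) ->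
  (forall h h' x, x \in W h -> x \in W h' -> h = h') ->
  (forall h h', adj h h' -> touch (@adj G) (W h) (W h')) -> mm H G.
Proof.
move=> cW dW eW; exists (fun x => [pick h | x \in W h]).
have fE h : fiber (fun x => [pick h | x \in W h]) h = W h.
  apply/setP => x; rewrite inE; case: pickP => [h' xh'|no].
    apply/eqP/idP => [[<-] //|xh]; congr Some; exact: dW xh' xh.
  by rewrite no.
by split=> [h|h h']; rewrite !fE //; apply: eW.
Qed.

Lemma conn_val G (A : {set G}) (C : {set {x | x \in A}}) :
  conn (@adj (induced A)) C -> conn (@adj G) (val @: C).
Proof.
move=> /connP[C0 HC]; apply/connP; split.
  by have /set0Pn[x xC] := C0; apply/set0Pn; exists (val x); apply: imset_f.
move=> B BC B0 BnC.
have [|||x [y [xB yC yB exy]]] := HC (val @^-1: B).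
- apply/subsetP => x; rewrite inE => /(subsetP BC)/imsetP[y yC /val_inj -> //].
- have /set0Pn[x xB] := B0; have /imsetP[y yC xy] := subsetP BC x xB.
  by apply/set0Pn; exists y; rewrite inE -xy.
- apply: contra BnC => /eqP <-; rewrite eqEsubset; apply/andP; split.
    apply/subsetP => x xB; have /imsetP[y yC xy] := subsetP BC x xB.
    by apply/imsetP; exists y; rewrite ?inE -?xy.
  by apply/subsetP => x /imsetP[y]; rewrite inE => yB ->.
exists (val x), (val y); move: xB yB; rewrite !inE => -> ->; split=> //; exact: imset_f.
Qed.

Lemma fiber_conn_edge G H (f : G -> option H) h x : conn (@adj G) (fiber f h) ->
  f x = Some h -> fiber f h != [set x] -> exists y, [/\ f y = Some h, y != x & adj x y].
Proof.
move=> cf fx fx1; have xf : x \in fiber f h by rewrite inE fx.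
have [y] := conn_edge cf xf fx1.
by rewrite inE => /eqP fy /andP[yx exy]; exists y.
Qed.

End Minor.

(** * From branch sets to deletions and contractions *)

Section Realize.
Implicit Types G H K : sgraph.

Lemma conn_lift (V : finType) (e : rel V) (A C : {set V}) :
  conn e C -> C \subset A ->
  conn (fun u v : {x | x \in A} => e (val u) (val v)) [set u | val u \in C].
Proof.
move=> /connP[C0 HC] CA; apply/connP; split.
  have /set0Pn[x xC] := C0; apply/set0Pn; exists (exist _ x (subsetP CA x xC)).
  by rewrite inE.
move=> B BC B0 BnC.
have valB u : (val u \in val @: B) = (u \in B) by rewrite mem_imset //; apply: val_inj.
have [|||x [y [/imsetP[u uB ->] yC yB exy]]] := HC (val @: B).
- by apply/subsetP => x /imsetP[u /(subsetP BC)]; rewrite inE => uC ->.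
- have /set0Pn[u uB] := B0; apply/set0Pn; exists (val u); exact: imset_f.
- apply: contra BnC => /eqP BE; apply/eqP/setP => u.
  by rewrite inE -BE valB.
exists u, (exist _ y (subsetP CA y yC)); split=> //; first by rewrite inE.
by rewrite -valB.
Qed.

Lemma conn_contract G (x y : G) (C : {set G}) : x != y -> (x \in C) = (y \in C) ->
  conn (@adj G) C -> conn (@adj (contract x y)) [set u | val u \in C].
Proof.
move=> xy xyC /connP[C0 HC]; apply/connP; split.
  have /set0Pn[z zC] := C0.
  have [zy|zy] := eqVneq z y.
    by apply/set0Pn; exists (exist _ x xy); rewrite inE /= xyC -zy.
  by apply/set0Pn; exists (exist _ z zy); rewrite inE.
move=> B BC B0 BnC.
have mC z : (merge_vertex x y z \in C) = (z \in C).
  by rewrite /merge_vertex; case: eqP => // ->.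
have mV z : merge_vertex x y z != y.
  by rewrite /merge_vertex; case: (eqVneq z y).
pose m z : contract x y := exist _ (merge_vertex x y z) (mV z).
have mval (u : contract x y) : m (val u) = u.
  by apply: val_inj; rewrite /= /merge_vertex (negbTE (valP u)).
have [|||a [b [aB bC bB ab]]] := HC [set z | m z \in B].
- by apply/subsetP => z; rewrite inE => /(subsetP BC); rewrite inE /= mC.
- by have /set0Pn[u uB] := B0; apply/set0Pn; exists (val u); rewrite inE mval.
- apply: contra BnC => /eqP BE; apply/eqP/setP => u.
  by rewrite inE -BE inE mval.
rewrite !inE in aB bB; exists (m a), (m b); split=> //; first by rewrite inE mC.
rewrite /adj /= /contract_adj; apply/andP; split; first by apply: contraNneq bB => <-.
by apply/existsP; exists a; apply/existsP; exists b; rewrite /= !eqxx.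
Qed.

(** An injective [f] is an isomorphism. Otherwise some connected fiber has two vertices, hence an
    edge, and contracting it preserves the connected fibers and the adjacencies between them. *)
Lemma contract_fibers H n : forall G (f : G -> H), #|G| <= n ->
  (forall h, conn (@adj G) [set x | f x == h]) ->
  (forall h h', adj h h' = (h != h') && touch (@adj G) [set x | f x == h] [set x | f x == h']) ->
  exists K, contracts_to G K /\ iso K H.
Proof.
elim: n => [|n IHn] G f Gn cf ef.
all: have [/injectiveP fi|/injectivePn[x [z xz fxz]]] := boolP (injectiveb f).
1,3: exists G; split; first exact: contracts_refl.
1,2: have fs h : exists x, f x = h by have /conn0/set0Pn[x] := cf h; rewrite inE => /eqP; exists x.
1,2: exists f; first by apply: inj_card_bij => //; rewrite -(card_imset _ fi);
       apply: subset_leq_card; apply/subsetP => h _; have [x <-] := fs h; apply: imset_f.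
1,2: move=> x y; rewrite ef; apply/andP/idP => [[_ /touchP[a [b []]]]|xy].
1,3: by rewrite !inE => /eqP/fi -> /eqP/fi ->.
1,2: split; first by rewrite (inj_eq fi); apply: contraTneq xy => ->; rewrite adj_irrefl.
1,2: by apply/touchP; exists x, y; rewrite !inE !eqxx.
  by move: Gn; rewrite leqn0 => /eqP/card0_eq/(_ x).
have xf : x \in [set w | f w == f x] by rewrite inE.
have [|y] := conn_edge (cf (f x)) xf.
  by apply/eqP => /setP/(_ z); rewrite !inE fxz eqxx eq_sym (negbTE xz).
rewrite inE => /eqP fyx /andP[yx xy]; have xy' : x != y by rewrite eq_sym.
pose f' (u : contract x y) := f (val u).
have f'E h : [set u | f' u == h] = [set u : contract x y | val u \in [set w | f w == h]].
  by apply/setP => u; rewrite !inE.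
have fm a : f (merge_vertex x y a) = f a.
  by rewrite /merge_vertex; case: eqP => // ->.
have mV z' : merge_vertex x y z' != y.
  by rewrite /merge_vertex; case: (eqVneq z' y).
pose m w : contract x y := exist _ (merge_vertex x y w) (mV w).
have [|h|h h'|K [cK iK]] := IHn (contract x y) f'.
- by rewrite card_sig -ltnS (leq_trans _ Gn) // (cardD1 y G) inE ltnS;
    apply: subset_leq_card; apply/subsetP => u; rewrite !inE andbT.
- rewrite f'E; apply: conn_contract => //; by rewrite !inE fyx.
- rewrite ef; case: (eqVneq h h') => //= hh'; apply/touchP/touchP.
    move=> [a [b [ah bh ab]]]; exists (m a), (m b).
    rewrite !inE /f' /= !fm in ah bh *; split=> //.
    rewrite /contract_adj; apply/andP; split.
      apply: contraNneq hh' => E; rewrite -(eqP ah) -(eqP bh) -fm -[f b]fm.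
      by move/(congr1 val): E => /= ->.
    by apply/existsP; exists a; apply/existsP; exists b; rewrite /= !eqxx.
  move=> [u [v []]]; rewrite !inE /f' => uh vh /andP[_ /existsP[a /existsP[b /and3P[/eqP ma /eqP mb ab]]]].
  by exists a, b; rewrite !inE -fm ma uh -[f b]fm mb vh.
by exists K; split=> //; apply: contracts_step cK.
Qed.

(** Dropping the unlabelled vertices and every edge between branch sets of distinct non-adjacent
    vertices of [H] makes the contraction of the fibers equal to [H], not merely a graph containing
    it. Since [f] must be total, [h0] is its default value. *)
Lemma mm_is_minor H G (h0 : H) : mm H G -> is_minor H G.
Proof.
move=> [phi [cf ef]].
pose A := [set x | phi x != None].
pose bad x y := if (phi x, phi y) is (Some h, Some h') then (h != h') && ~~ adj h h' else false.
pose D : {set {set G}} := [set [set p.1; p.2] | p : G * G & bad p.1 p.2].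
pose f (u : subgraph D A) := odflt h0 (phi (val u)).
have fE u h : (f u == h) = (phi (val u) == Some h).
  rewrite /f; have := valP u; rewrite inE; by case: (phi _).
have badE x y h h' : phi x = Some h -> phi y = Some h' -> ([set x; y] \in D) = (h != h') && ~~ adj h h'.
  move=> px py; apply/imsetP/idP => [[[a b]]|hh'].
    rewrite inE /bad /=; case Ea: (phi a) => [k|] //; case Eb: (phi b) => [k'|] //.
    move=> kk' E.
    have := set21 a b; have := set22 a b; rewrite -E !inE.
    move=> /orP[]/eqP eb /orP[]/eqP ea; move: kk' Ea Eb; rewrite eb ea ?px ?py.
    - by move=> /andP[kk' _] [ek] [ek']; rewrite -ek -ek' eqxx in kk'.
    - by move=> kk' [ek] [ek']; rewrite -ek -ek' eq_sym adj_sym in kk'.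
    - by move=> kk' [ek] [ek']; rewrite -ek -ek' in kk'.
    - by move=> /andP[kk' _] [ek] [ek']; rewrite -ek -ek' eqxx in kk'.
  by exists (x, y); rewrite // inE /bad /= px py.
have fibE h : [set u | f u == h] = [set u : subgraph D A | val u \in fiber phi h].
  by apply/setP => u; rewrite !inE fE.
have fibA h : fiber phi h \subset A by apply/subsetP => x; rewrite !inE => /eqP ->.
have [//|h|h h'|K [cK iK]] := @contract_fibers H #|subgraph D A| (subgraph D A) f.
- rewrite fibE; apply: (@conn_lift _ (@adj (del_edges D)) A _ _ (fibA h)).
  apply: conn_mono (cf h) => x y; rewrite !inE => /eqP px /eqP py xy.
  by rewrite /adj /= /del_edges_adj xy (badE _ _ _ _ px py) eqxx.
- apply/idP/andP => [hh'|[hh' /touchP[u [v []]]]].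
    split; first by apply: contraTneq hh' => ->; rewrite adj_irrefl.
    have /touchP[x [y [xh yh xy]]] := ef _ _ hh'.
    have xA := subsetP (fibA h) x xh; have yA := subsetP (fibA h') y yh.
    apply/touchP; exists (exist _ x xA), (exist _ y yA); rewrite !fibE !inE /=.
    rewrite !inE in xh yh; rewrite xh yh; split=> //.
    rewrite /induced_adj /= /del_edges_adj xy /= (badE _ _ _ _ (eqP xh) (eqP yh)).
    by rewrite hh' andbF.
  rewrite !inE !fE => /eqP pu /eqP pv; rewrite /adj /= /induced_adj /adj /= /del_edges_adj.
  by rewrite (badE _ _ _ _ pu pv) hh' /= negbK => /andP[].
by exists D, A, K.
Qed.

End Realize.

(** * Minors carried by a set of representatives *)

Section Quotient.
Variables (G : sgraph) (A : {set G}) (W : G -> {set G}).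

(** The vertices of this minor are the representatives in [A], and [W x] is the branch set of [x];
    deleting a vertex and contracting an edge are both of this form. *)
Definition qg_adj : rel {x | x \in A} :=
  fun u v => (val u != val v) && touch (@adj G) (W (val u)) (W (val v)).
Fact qg_sym : symmetric qg_adj.
Proof. by move=> u v; rewrite /qg_adj eq_sym touch_sym //; apply: adj_sym. Qed.
Fact qg_irrefl : irreflexive qg_adj.
Proof. by move=> u; rewrite /qg_adj eqxx. Qed.
Definition qg := SGraph qg_sym qg_irrefl.

Definition model_on := (forall x, x \in A -> conn (@adj G) (W x)) /\
  (forall x y z, x \in A -> y \in A -> z \in W x -> z \in W y -> x = y).

Lemma qg_mm : model_on -> mm qg G.
Proof.
move=> [cW dW]; apply: (@mm_sets qg G (fun u => W (val u))).
- by move=> u; apply: cW; apply: valP.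
- by move=> u v x xu xv; apply: val_inj; apply: dW xu xv; apply: valP.
- by move=> u v /andP[].
Qed.

Lemma card_qg : #|qg| = #|A|.
Proof. by rewrite card_sig; apply: eq_card => x; rewrite inE. Qed.

End Quotient.

(** * Edges counted as ordered pairs *)

Section Darts.
Implicit Types G : sgraph.

Definition nb G (x : G) : {set G} := [set y | adj x y].
(** Two for each edge; hence the doubled constants below, such as 16 and 18 in place of 8 and 9. *)
Definition darts G : {set G * G} := [set p | adj p.1 p.2].

Lemma nbE G (x y : G) : (y \in nb x) = adj x y. Proof. by rewrite inE. Qed.

Lemma nb_irr G (x : G) : x \notin nb x. Proof. by rewrite nbE adj_irrefl. Qed.

Lemma qg_darts G (A : {set G}) W (R : {set G * G}) :
  (forall p, p \in R -> [&& p.1 \in A, p.2 \in A, p.1 != p.2 & touch (@adj G) (W p.1) (W p.2)]) ->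
  #|R| <= #|darts (qg A W)|.
Proof.
move=> RP; pose f (p : qg A W * qg A W) := (val p.1, val p.2).
have fi : injective f by move=> [a b] [c d] [] /val_inj -> /val_inj ->.
rewrite -(card_imset _ fi); apply: subset_leq_card; apply/subsetP => -[x y] /RP /= /and4P[xA yA xy t].
apply/imsetP; exists (exist _ x xA, exist _ y yA) => //.
by rewrite inE /= /qg_adj /= xy.
Qed.

Lemma darts_edges G (P : pred {set G}) :
  #|[set p : G * G | adj p.1 p.2 && P [set p.1; p.2]]| = 2 * #|[set e in edges G | P e]|.
Proof.
set A := [set p : G * G | _]; pose h (p : G * G) := [set p.1; p.2].
have hA : h @: A = [set e in edges G | P e].
  apply/setP => e; rewrite inE; apply/imsetP/andP => [[p]|[/imsetP[p]]].
    by rewrite inE => /andP[pa pP] ->; split=> //; apply: imset_f; rewrite inE.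
  by rewrite inE => pa -> pP; exists p; rewrite // inE pa.
rewrite -sum1_card (partition_big_imset h) /= hA.
rewrite (eq_bigr (fun=> 2)); first by rewrite sum_nat_const mulnC.
move=> e; rewrite -hA => /imsetP[[x y]]; rewrite inE /= => /andP[xy pxy] ->.
have xny : x != y by apply: contraTneq xy => ->; rewrite adj_irrefl.
rewrite sum1dep_card (_ : [set _ | _] = [set (x, y); (y, x)]).
  by rewrite cards2 xpair_eqE negb_and xny.
apply/setP => -[a b]; rewrite !inE /= !xpair_eqE /h /=.
apply/andP/idP => [[_ /eqP E]|].
  have := set21 a b; have := set22 a b; have := set21 x y; have := set22 x y.
  rewrite -{1 2}E {3 4}E !inE => /orP[]/eqP ey /orP[]/eqP ex /orP[]/eqP eb /orP[]/eqP ea;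
  move: xny; rewrite ?ea ?eb ?ex ?ey ?eqxx ?orbT //; subst; rewrite ?eqxx ?orbT //.
case/orP => /andP[/eqP-> /eqP->]; rewrite ?xy ?pxy //.
by rewrite adj_sym xy setUC pxy.
Qed.

Lemma darts_edge G : #|darts G| = 2 * #|edges G|.
Proof.
rewrite -(_ : [set e in edges G | predT e] = edges G); last by apply/setP => e; rewrite inE andbT.
by rewrite -darts_edges; apply: eq_card => p; rewrite !inE andbT.
Qed.

Lemma darts_sum G (A B : {set G}) :
  #|[set p : G * G | [&& p.1 \in A, p.2 \in B & adj p.1 p.2]]| = \sum_(x in A) #|nb x :&: B|.
Proof.
rewrite -sum1_card (partition_big (fun p : G * G => p.1) (mem A)) /=; last first.
  by move=> p; rewrite inE => /andP[].
apply: eq_bigr => x xA; rewrite sum1dep_card.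
have pi : injective (fun y : G => (x, y)) by move=> y z [].
rewrite -(card_imset _ pi); apply: eq_card => -[a b]; rewrite !inE /=.
apply/andP/imsetP => [[/and3P[_ bB ab] /eqP ax]|[y]].
  by exists b; rewrite ?inE -?ax ?ab.
by rewrite !inE => /andP[xy yB] [-> ->]; rewrite xA yB xy.
Qed.

End Darts.

(** * Certified search for small minors *)

Section Matrix.
Variables (m : nat) (M : nat -> nat -> bool).

Definition msym i j := M i j || M j i.
Definition mg_adj : rel 'I_m := fun i j => (i != j) && msym i j.
Fact mg_sym : symmetric mg_adj.
Proof. by move=> i j; rewrite /mg_adj /msym eq_sym orbC. Qed.
Fact mg_irrefl : irreflexive mg_adj.
Proof. by move=> i; rewrite /mg_adj eqxx. Qed.
Definition mg := SGraph mg_sym mg_irrefl.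

Definition class (g : seq nat) h := [seq i <- iota 0 m | nth 7 g i == h].

(** A test for connectivity by one pass over the list, each vertex attaching to a later one. It is
    only sufficient and depends on the order of the vertices. *)
Fixpoint grows (c : seq nat) := if c is i :: c' then
  (if c' is [::] then true else has (msym i) c' && grows c') else false.

(* [g] maps each vertex to a vertex of K7eq, and unused vertices to 7. *)
Definition check7 (g : seq nat) :=
  all (fun h => grows (class g h)) (iota 0 7) &&
  all (fun h => all (fun h' => if [|| h' <= h, (h, h') == (0, 1) | (h, h') == (2, 3)] then true else
     has (fun i => has (msym i) (class g h')) (class g h)) (iota 0 7)) (iota 0 7).

Definition cls (g : seq nat) h : {set 'I_m} := [set i : 'I_m | nth 7 g i == h].

Lemma mem_class g h i : (i \in class g h) = (i < m) && (nth 7 g i == h).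
Proof. by rewrite mem_filter mem_iota add0n andbC. Qed.

Lemma conn_grows c : uniq c -> grows c -> {in c, forall i, i < m} ->
  conn (@adj mg) [set i : 'I_m | (i : nat) \in c].
Proof.
elim: c => // i [|j c] IHc.
  move=> _ _ im; rewrite (_ : [set _ | _] = [set Ordinal (im i (mem_head _ _))]) ?conn1 //.
  by apply/setP => k; rewrite !inE -val_eqE.
move=> /andP[ic uc] /andP[/hasP[k kc ik] gc] im.
have im' : i < m by apply: im; rewrite mem_head.
have km : k < m by apply: im; rewrite inE kc orbT.
rewrite (_ : [set _ | _] = Ordinal im' |: [set l : 'I_m | (l : nat) \in j :: c]); last first.
  by apply/setP => l; rewrite !inE -val_eqE.
apply: (@connU1 _ _ _ (Ordinal km)).
- exact: (@adj_sym mg).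
- by apply: IHc => // l lc; apply: im; rewrite inE lc orbT.
- by rewrite inE.
have ki : msym k i by move: ik; rewrite /msym orbC.
rewrite /adj /= /mg_adj -val_eqE /= ki andbT.
by apply: contraNneq ic => <-.
Qed.

Lemma check7_mm g : check7 g -> mm K7eq mg.
Proof.
move=> /andP[/allP gr /allP ad].
have h7 (h : K7eq) : (h : nat) \in iota 0 7 by rewrite mem_iota /= ltn_ord.
apply: (@mm_sets K7eq mg (fun h => cls g h)).
- move=> h; have := gr h (h7 h); set c := class g h => gc.
  rewrite (_ : cls g h = [set i : 'I_m | (i : nat) \in c]).
    by apply: conn_grows; rewrite ?filter_uniq ?iota_uniq // => i; rewrite mem_class => /andP[].
  by apply/setP => i; rewrite !inE mem_class ltn_ord.
- by move=> h h' i; rewrite !inE => /eqP -> /eqP E; apply: val_inj.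
have aux (h h' : K7eq) : adj h h' -> h < h' -> touch (@adj mg) (cls g h) (cls g h').
  rewrite /adj /= /del_edges_adj => /andP[_ hD] hh'.
  have := allP (ad h (h7 h)) h' (h7 h'); rewrite leqNgt hh' /=.
  have e01 : ((h : nat), (h' : nat)) == (0, 1) = false.
    apply/negP; rewrite xpair_eqE => /andP[/eqP h0 /eqP h1]; case/negP: hD.
    rewrite !inE; apply/orP; left; apply/eqP; congr [set _; _]; apply: val_inj; by rewrite /= inordK.
  have e23 : ((h : nat), (h' : nat)) == (2, 3) = false.
    apply/negP; rewrite xpair_eqE => /andP[/eqP h0 /eqP h1]; case/negP: hD.
    rewrite !inE; apply/orP; right; apply/eqP; congr [set _; _]; apply: val_inj; by rewrite /= inordK.
  rewrite e01 e23 /= => /hasP[i]; rewrite mem_class => /andP[im ig] /hasP[j].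
  rewrite mem_class => /andP[jm jg] ij.
  apply/touchP; exists (Ordinal im), (Ordinal jm); rewrite !inE; split=> //.
  rewrite /adj /= /mg_adj ij andbT -val_eqE /=; apply: contraTneq hh' => E.
  by rewrite -(eqP ig) -(eqP jg) E ltnn.
move=> h h' hh'; case: (ltngtP h h') => [lt|gt|E]; first exact: aux.
  by rewrite touch_sym; [apply: aux; rewrite // adj_sym | apply: adj_sym].
by move: hh'; rewrite (val_inj E) adj_irrefl.
Qed.

(** [M] is a lower bound for the adjacencies: sets may also touch where [M] is false. One
    orientation of each pair suffices, since [msym] symmetrizes. *)
Definition family (G : sgraph) (W : nat -> {set G}) :=
  [/\ forall i, i < m -> conn (@adj G) (W i),
      forall i j x, i < m -> j < m -> x \in W i -> x \in W j -> i = j &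
      forall i j, i < m -> j < m -> i <> j -> M i j -> touch (@adj G) (W i) (W j)].

Lemma family_mm G W : @family G W -> mm mg G.
Proof.
move=> [cW dW eW]; apply: (@mm_sets mg G (fun i : 'I_m => W i)).
- by move=> i; apply: cW.
- by move=> i j x xi xj; apply: val_inj; apply: dW xi xj.
move=> i j /andP[ij]; have ij' : (i : nat) <> j by move/val_inj/eqP; apply/negP.
rewrite /msym => /orP[Mij|Mji]; first exact: eW.
rewrite touch_sym; last exact: adj_sym.
by apply: eW => // E; case: ij'.
Qed.

Lemma family_points (G : sgraph) (x0 : G) (l : seq G) : size l = m -> uniq l ->
  (forall i j, i < m -> j < m -> i <> j -> M i j -> adj (nth x0 l i) (nth x0 l j)) ->
  @family G (fun i => [set nth x0 l i]).
Proof.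
move=> sl ul al; split=> [i _|i j x im jm|i j im jm ij Mij]; first exact: conn1.
  by rewrite !inE => /eqP -> /eqP/eqP; rewrite nth_uniq ?sl // => /eqP.
by apply/touchP; exists (nth x0 l i), (nth x0 l j); rewrite !inE; split=> //; apply: al.
Qed.

Lemma family_K7 G W g : @family G W -> check7 g -> mm K7eq G.
Proof. by move=> /family_mm mG /check7_mm /mm_trans; apply. Qed.

End Matrix.

(* K_8 minus a 4-cycle: the vertices 0,1 miss the vertices 2,3. *)
Definition dmat i j := (i < j) && ~~ ((i < 2) && (2 <= j < 4)).
Definition Dg := mg 8 dmat.

(** * Menger's theorem *)

Section Menger.
Variable V : finType.
Implicit Types (e : rel V) (A B K S Y : {set V}) (c : V -> {set V}).

Definition meets K A := ~~ [disjoint K & A].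

Lemma meetsP K A : reflect (exists2 x, x \in K & x \in A) (meets K A).
Proof.
rewrite /meets -setI_eq0; apply: (iffP (set0Pn _)) => [[x]|[x xK xA]].
  by rewrite inE => /andP[]; exists x.
by exists x; rewrite inE xK.
Qed.

Lemma meetsS K K' A : K \subset K' -> meets K A -> meets K' A.
Proof. by move=> /subsetP s /meetsP[x /s]; move=> *; apply/meetsP; exists x. Qed.

Lemma meetsC K A : meets K A = meets A K.
Proof. by rewrite /meets disjoint_sym. Qed.

Definition separates e A B Y := forall K, conn e K -> meets K A -> meets K B -> meets K Y.

Definition disj_on Y c := forall y z x, y \in Y -> z \in Y -> x \in c y -> x \in c z -> y = z.

(** Connected sets stand for paths. Indexing them by [Y], each containing its index, expresses that
    there are as many disjoint sets as vertices in the separator. *)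
Definition linkage e A B Y c :=
  (forall y, y \in Y -> [/\ conn e (c y), y \in c y, meets (c y) A & meets (c y) B]) /\
  disj_on Y c.

Lemma hit_card Y S c : (forall y, y \in Y -> meets (c y) S) -> disj_on Y c ->
  #|Y| <= #|S| /\ (#|S| <= #|Y| -> forall s, s \in S -> exists2 y, y \in Y & s \in c y).
Proof.
move=> mS dc; pose f y := odflt y [pick s in c y :&: S].
have fP y : y \in Y -> f y \in c y /\ f y \in S.
  move=> /mS/meetsP[s sc sS]; rewrite /f; case: pickP => [z|/(_ s)]; rewrite !inE.
    by case/andP.
  by rewrite sc sS.
have fi : {in Y &, injective f}.
  by move=> y z yY zY E; apply: (dc y z (f y)) => //; [case: (fP y)|rewrite E; case: (fP z)].
have sub : f @: Y \subset S by apply/subsetP => _ /imsetP[y /fP[_ fS] ->].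
rewrite -(card_in_imset fi); split; first exact: subset_leq_card.
move=> le s; have /eqP <- : f @: Y == S by rewrite eqEcard sub.
by case/imsetP => y yY ->; exists y => //; case: (fP y yY).
Qed.

(** If one member contained two points of [S], dropping one of them would leave a set that still
    meets every member but is too small for that. *)
Lemma hit_uniq Y S c : (forall y, y \in Y -> meets (c y) S) -> disj_on Y c -> #|S| <= #|Y| ->
  forall u s t, u \in Y -> s \in S -> t \in S -> s \in c u -> t \in c u -> s = t.
Proof.
move=> mS dc le u s t uY sS tS su tu; apply/eqP/negPn/negP => st.
have [|+ _] := @hit_card Y (S :\ t) c _ dc; last by move: le; rewrite (cardsD1 t S) tS; lia.
move=> v vY; have /meetsP[r rv rS] := mS v vY; apply/meetsP.
have [rt|rt] := eqVneq r t; last by exists r; rewrite // !inE rt.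
exists s; last by rewrite !inE st.
by rewrite rt in rv; rewrite (dc _ _ _ vY uY rv tu).
Qed.

(* Goring's argument: delete an edge xy; a separator S of the rest that fails
   for the whole graph becomes one after adding x or y, and the linkages from A
   to S + x and from S + y to B glue together along S and xy. *)
Theorem menger e A B : symmetric e -> exists Y c, separates e A B Y /\ linkage e A B Y c.
Proof.
have [n] := ubnP #|[set p : V * V | e p.1 p.2]|.
elim: n e A B => // n IHn e A B /ltnSE en se.
have [/existsP[[x y] /andP[exy xy]]|/existsPn no] := boolP [exists p : V * V, e p.1 p.2 && (p.1 != p.2)];
  last first.
  exists (A :&: B), set1; split.
    move=> K /connP[_ HK] /meetsP[a aK aA] /meetsP[b bK bB].
    have [ab|ab] := eqVneq a b; first by apply/meetsP; exists a; rewrite // inE aA ab.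
    have [|||u [v [ua vK va euv]]] := HK [set a].
    - by rewrite sub1set.
    - by apply/set0Pn; exists a; rewrite inE.
    - by apply: contraNneq ab => /setP/(_ b); rewrite !inE bK eq_sym => ->.
    have := no (u, v); rewrite /= euv /= negbK => /eqP uv.
    by move: va; rewrite -uv ua.
  split=> [y|y z u _ _]; last by rewrite !inE => /eqP -> /eqP.
  rewrite in_setI => /andP[yA yB]; split; rewrite ?conn1 ?set11 //.
    by apply/meetsP; exists y; rewrite ?set11.
  by apply/meetsP; exists y; rewrite ?set11.
rewrite /= in exy xy.
pose e' : rel V := fun u v => e u v && ~~ ((u == x) && (v == y) || (u == y) && (v == x)).
have se' : symmetric e' by move=> u v; rewrite /e' se; congr (_ && ~~ _); rewrite orbC andbC [(u == x) && _]andbC.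
have e'e u v : e' u v -> e u v by case/andP.
have ee' u v : e u v -> [\/ e' u v, u = x /\ v = y | u = y /\ v = x].
  move=> euv; have [/andP[/eqP ux /eqP vy]|n1] := boolP ((u == x) && (v == y)); first exact: Or32.
  have [/andP[/eqP uy /eqP vx]|n2] := boolP ((u == y) && (v == x)); first exact: Or33.
  by apply: Or31; rewrite /e' euv (negbTE n1) (negbTE n2).
have ce' K : conn e' K -> conn e K by apply: conn_mono => u v _ _; apply: e'e.
have cex K : x \notin K -> conn e K -> conn e' K.
  move=> xK; apply: conn_mono => u v uK vK /ee'[//|[ux _]|[_ vx]].
    by rewrite -ux uK in xK.
  by rewrite -vx vK in xK.
have e'n : #|[set p : V * V | e' p.1 p.2]| < n.
  apply: leq_trans en; apply: proper_card; apply/properP; split.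
    by apply/subsetP => p; rewrite !inE; apply: e'e.
  by exists (x, y); rewrite !inE //= /e' !eqxx andbF.
have [Y0 [c0 [s0 l0]]] := IHn _ A B e'n se'.
(* [R C] is what can be reached from [C] off [Y0] once [xy] is deleted; [R A] and [R B] are disjoint
   because [Y0] separates. *)
pose R C := [set z | [exists K : {set V}, [&& conn e' K, z \in K, meets K C & [disjoint K & Y0]]]].
have RP C z : reflect (exists K : {set V}, [/\ conn e' K, z \in K, meets K C & [disjoint K & Y0]]) (z \in R C).
  rewrite inE; apply: (iffP existsP) => -[K].
    by case/and4P; exists K.
  by case=> *; exists K; apply/and4P.
have Rdisj z : z \in R A -> z \in R B -> False.
  move=> /RP[K [cK zK KA KY]] /RP[K' [cK' zK' KB KY']].
  have : meets (K :|: K') Y0.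
    apply: s0; first by apply: connU => //; right; apply/meetsP; exists z.
      by apply: meetsS KA; apply: subsetUl.
    by apply: meetsS KB; apply: subsetUr.
  case/meetsP => w; rewrite inE => /orP[wK wY|wK wY].
    by move/disjointFr/(_ wK): KY; rewrite wY.
  by move/disjointFr/(_ wK): KY'; rewrite wY.
have RY C z : z \in R C -> z \notin Y0.
  by move=> /RP[K [_ zK _ KY]]; rewrite (disjointFr KY zK).
have Rstep C u v : u \in R C -> v \notin Y0 -> e' u v -> v \in R C.
  move=> /RP[K [cK uK KC KY]] vY euv; apply/RP; exists (v |: K); split.
  - exact: (connU1 se' cK uK euv).
  - by rewrite setU11.
  - by apply: meetsS KC; apply: subsetUr.
  - by rewrite -setI_eq0 setIUl setU_eq0 !setI_eq0 disjoints1 vY.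
have R1 (C : {set V}) z : z \in C -> z \notin Y0 -> z \in R C.
  move=> zC zY; apply/RP; exists [set z]; split; rewrite ?conn1 ?set11 ?disjoints1 //.
  by apply/meetsP; exists z; rewrite ?set11.
have [sep0|/existsP[K /and4P[cK KA KB KY]]] :
    separates e A B Y0 \/ [exists K : {set V}, [&& conn e K, meets K A, meets K B & [disjoint K & Y0]]].
  have [ex|/existsPn no] := boolP [exists K : {set V}, [&& conn e K, meets K A, meets K B & [disjoint K & Y0]]].
    by right.
  left=> K cK KA KB; have [//|KY] := boolP (meets K Y0); move: (no K); rewrite cK KA KB /= => nd.
  by case/negP: KY; exact: nd.
  exists Y0, c0; split=> //; case: l0 => l0 d0; split=> // z /l0[ck zk za zb].
  by split=> //; apply: ce'.
(* A connected set avoiding [Y0] can leave [R C] only along the deleted edge. *)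
have cross C D : meets K C -> meets K D -> (forall z, z \in R C -> z \in R D -> False) ->
    (x \in R C /\ y \notin R C) \/ (y \in R C /\ x \notin R C).
  move=> /meetsP[a aK aC] /meetsP[b bK bD] dCD.
  have nY z : z \in K -> z \notin Y0 by move=> zK; rewrite (disjointFr KY zK).
  case/connP: cK => _ /(_ (K :&: R C) (subsetIl _ _))[||u [v []]].
  - by apply/set0Pn; exists a; rewrite in_setI aK R1 // nY.
  - apply/negP => /eqP/setP/(_ b); rewrite in_setI bK /= => bR.
    by apply: (dCD b) => //; rewrite R1 // nY.
  rewrite in_setI => /andP[uK uR] vK; rewrite in_setI vK /= => vR.
  case/ee' => [e'uv|[ux vy]|[uy vx]].
  - by case/negP: vR; apply: Rstep e'uv; rewrite ?nY.
  - by left; rewrite -ux -vy.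
  - by right; rewrite -uy -vx.
have key x' y' : e x' y' -> x' != y' -> (forall u v, e u v -> [\/ e' u v, u = x' /\ v = y' | u = y' /\ v = x']) ->
    (forall K, x' \notin K -> conn e K -> conn e' K) ->
    x' \in R A -> y' \in R B -> exists Y c, separates e A B Y /\ linkage e A B Y c.
  move=> exy' xy' ee2 cex' xA yB.
  have xB : x' \notin R B by apply/negP; apply: Rdisj.
  have yA : y' \notin R A by apply/negP => yA; apply: (Rdisj y').
  have [Y1 [c1 [s1 l1]]] := IHn _ A (x' |: Y0) e'n se'.
  have [Y2 [c2 [s2 l2]]] := IHn _ (y' |: Y0) B e'n se'.
  (* A connected set from [A] to [B] reaches [x' |: Y0] without using the deleted edge, so [Y1]
     separates [A] from [B] in the whole graph. *)
  have S1 : separates e A B Y1.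
    move=> L cL LA LB; have /meetsP[a aL aA] := LA.
    have [aY|aY] := boolP (a \in x' |: Y0).
      have : meets [set a] Y1 by apply: s1; rewrite ?conn1 //; apply/meetsP; exists a; rewrite ?set11.
      by apply: meetsS; rewrite sub1set.
    have aU : a \in L :\: (x' |: Y0) by rewrite inE aY.
    have [C [aC CU cC cl]] := component se' aU.
    have CL : C \subset L by apply: (subset_trans CU); apply: subsetDl.
    have CA : meets C A by apply/meetsP; exists a.
    have CY : [disjoint C & Y0].
      rewrite disjoint_sym disjoints_subset; apply/subsetP => w wY; rewrite inE.
      by apply/negP => /(subsetP CU); rewrite !inE wY orbT.
    have CnL : C != L.
      apply/eqP => CE; have := s0 C cC CA; rewrite CE => /(_ LB).
      by rewrite -CE /meets CY.
    have /connP[_ /(_ C CL (conn0 cC) CnL)[p [q [pC qL qC epq]]]] := cL.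
    have fin : e' p q -> q \in x' |: Y0 -> meets L Y1.
      move=> e'pq qY; have : meets (q |: C) Y1.
        apply: s1; first exact: (connU1 se' cC pC e'pq).
          by apply: meetsS CA; apply: subsetUr.
        by apply/meetsP; exists q; rewrite ?setU11.
      by apply: meetsS; rewrite subUset sub1set qL.
    case/ee2: (epq) => [e'pq|[px qy]|[py qx]].
    - apply: fin => //; apply/negPn/negP => qY; case/negP: qC.
      by apply: (cl p) => //; rewrite inE qY.
    - by move: (subsetP CU p pC); rewrite px !inE eqxx.
    - case/negP: yA; apply/RP; exists C; split=> //; by rewrite -py.
  have S2 : separates e A B Y2.
    move=> L cL LA LB; have /meetsP[b bL bB] := LB.
    have [bY|bY] := boolP (b \in y' |: Y0).
      have : meets [set b] Y2 by apply: s2; rewrite ?conn1 //; apply/meetsP; exists b; rewrite ?set11.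
      by apply: meetsS; rewrite sub1set.
    have bU : b \in L :\: (y' |: Y0) by rewrite inE bY.
    have [C [bC CU cC cl]] := component se' bU.
    have CL : C \subset L by apply: (subset_trans CU); apply: subsetDl.
    have CB : meets C B by apply/meetsP; exists b.
    have CY : [disjoint C & Y0].
      rewrite disjoint_sym disjoints_subset; apply/subsetP => w wY; rewrite inE.
      by apply/negP => /(subsetP CU); rewrite !inE wY orbT.
    have CnL : C != L.
      apply/eqP => CE; have := s0 C cC; rewrite CE => /(_ LA LB).
      by rewrite -CE /meets CY.
    have /connP[_ /(_ C CL (conn0 cC) CnL)[p [q [pC qL qC epq]]]] := cL.
    have fin : e' p q -> q \in y' |: Y0 -> meets L Y2.
      move=> e'pq qY; have : meets (q |: C) Y2.
        apply: s2; first exact: (connU1 se' cC pC e'pq).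
          by apply/meetsP; exists q; rewrite ?setU11.
        by apply: meetsS CB; apply: subsetUr.
      by apply: meetsS; rewrite subUset sub1set qL.
    case/ee2: (epq) => [e'pq|[px qy]|[py qx]].
    - apply: fin => //; apply/negPn/negP => qY; case/negP: qC.
      by apply: (cl p) => //; rewrite inE qY.
    - case/negP: xB; apply/RP; exists C; split=> //; by rewrite -px.
    - by move: (subsetP CU p pC); rewrite py !inE eqxx.
  case: l0 => l0 d0.
  (* The members of [c0] meet such a [Y] in exactly one vertex each and cover it, so they can be
     reindexed by [Y]. *)
  have small Y : separates e A B Y -> #|Y| <= #|Y0| -> exists Y c, separates e A B Y /\ linkage e A B Y c.
    move=> sY leY.
    have [|_ /(_ leY) hY] := @hit_card Y0 Y c0 _ d0.
      by move=> z /l0[ck zk za zb]; apply: sY => //; apply: ce'.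
    pose c z := odflt [set z] [pick L in [set c0 u | u in Y0] | z \in L].
    have cP z : z \in Y -> exists u, [/\ u \in Y0, z \in c0 u & c z = c0 u].
      move=> /hY[u uY zu]; rewrite /c; case: pickP => [L|/(_ (c0 u))].
        by case/andP => /imsetP[v vY ->] zv; exists v.
      by rewrite zu imset_f.
    exists Y, c; split=> //; split.
      by move=> z /cP[u [uY zu ->]]; have [ck uk ua ub] := l0 u uY; split=> //; apply: ce'.
    move=> z w t zY wY; have [u [uY zu ->]] := cP z zY; have [v [vY wv ->]] := cP w wY.
    move=> tu tv; have uv := d0 _ _ _ uY vY tu tv; rewrite -uv in wv.
    have m0 q : q \in Y0 -> meets (c0 q) Y.
      by move=> /l0[ck qk qa qb]; apply: sY => //; apply: ce'.
    exact: (hit_uniq m0 d0 leY uY zY wY zu wv).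
  have [//|gt1] := leqP #|Y1| #|Y0|; first exact: small.
  have [//|gt2] := leqP #|Y2| #|Y0|; first exact: small.
  have xY : x' \notin Y0 by apply: RY xA.
  have yY : y' \notin Y0 by apply: RY yB.
  case: l1 => l1 d1; case: l2 => l2 d2.
  have m1 z : z \in Y1 -> meets (c1 z) (x' |: Y0) by move=> /l1[].
  have m2 z : z \in Y2 -> meets (c2 z) (y' |: Y0) by move=> /l2[].
  have e1 : #|x' |: Y0| <= #|Y1| by rewrite cardsU1 xY.
  have e2 : #|y' |: Y0| <= #|Y2| by rewrite cardsU1 yY.
  have [_ /(_ e1) h1] := hit_card m1 d1.
  have [_ /(_ e2) h2] := hit_card m2 d2.
  (* Each member is cut off at its first vertex of [z |: Y0]. What precedes lies in [R C], so sets
     coming from the two sides can only meet at their ends. *)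
  have T (Y' : {set V}) c' z (C : {set V}) : z \in R C -> disj_on Y' c' ->
      (forall u, u \in Y' -> [/\ conn e' (c' u), meets (c' u) C & meets (c' u) (z |: Y0)]) ->
      (forall s, s \in z |: Y0 -> exists2 u, u \in Y' & s \in c' u) ->
      (forall u s t, u \in Y' -> s \in z |: Y0 -> t \in z |: Y0 -> s \in c' u -> t \in c' u -> s = t) ->
      exists k, forall s, s \in z |: Y0 -> [/\ conn e' (k s), s \in k s, meets (k s) C,
         k s \subset s |: R C & forall t w, t \in z |: Y0 -> w \in k s -> w \in k t -> s = t].
    move=> zR dc' l' h' u'.
    pose Q s (L : {set V}) := [exists u in Y', [&& s \in c' u, L \subset c' u, conn e' L, s \in L, meets L C & L \subset s |: R C]].
    exists (fun s => odflt set0 [pick L | Q s L]) => s sS.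
    have ex t : t \in z |: Y0 -> Q t (odflt set0 [pick L | Q t L]).
      move=> tS; case: pickP => [//|/= no]; have [u uY tu] := h' t tS.
      have [ck uA uS] := l' u uY.
      have [L [b [Ku cL LA Kb Kc]]] := conn_trim se' ck uA uS.
      have /setIP[bK bS] : b \in L :&: (z |: Y0) by rewrite Kb set11.
      have bt : b = t by apply: (u' u) => //; apply: (subsetP Ku).
      suff : Q t L by rewrite no.
      apply/exists_inP; exists u => //; rewrite tu Ku cL -bt bK /meets LA /=.
      case: Kc => [->|[cLb KbA]]; first by rewrite sub1set setU11.
      rewrite -subDset; apply/subsetP => w wK; apply/RP; exists (L :\ b); split=> //.
      rewrite disjoint_sym disjoints_subset; apply/subsetP => v vY; rewrite !inE.
      apply/negP => /andP[vb vK]; have: v \in L :&: (z |: Y0) by rewrite !inE vK vY orbT.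
      by rewrite Kb inE (negbTE vb).
    have /exists_inP[u uY /andP[su /and5P[Ks cL sK LA LR]]] := ex s sS; split=> // t w tS ws wt.
    have /exists_inP[v vY /andP[tv /andP[Kt _]]] := ex t tS.
    have uv : u = v by apply: (dc' u v w) => //; [apply: (subsetP Ks) | apply: (subsetP Kt)].
    by apply: (u' u) => //; rewrite uv.
  have [u z1|k1 k1P] := T Y1 c1 x' A xA d1 _ h1 (hit_uniq m1 d1 e1); first by case: (l1 _ z1).
  have [u z2|k2 k2P] := T Y2 c2 y' B yB d2 _ h2 (hit_uniq m2 d2 e2); first by case: (l2 _ z2).
  (* At [x'] the two linkages are joined by the deleted edge, elsewhere at a common vertex of
     [Y0]. *)
  exists (x' |: Y0), (fun s => k1 s :|: k2 (if s == x' then y' else s)); split.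
    move=> L cL LA LB; have [//|LY] := boolP (meets L _).
    have xL : x' \notin L.
      by apply: contra LY => xL; apply/meetsP; exists x'; rewrite ?setU11.
    have /meetsP[w wL wY] := s0 L (cex' L xL cL) LA LB.
    by case/negP: LY; apply/meetsP; exists w; rewrite // !inE wY orbT.
  have gS s : s \in x' |: Y0 -> (if s == x' then y' else s) \in y' |: Y0.
    by rewrite !inE; case: (s == x') => /=; rewrite ?eqxx // => ->; rewrite orbT.
  split=> [s sS|s t w sS tS].
    have [ck1 sk1 k1A _ _] := k1P s sS; have [ck2 sk2 k2B _ _] := k2P _ (gS s sS).
    split; last 1 first.
    - by apply: meetsS k2B; apply: subsetUr.
    - apply: connU; [exact: se|exact: ce'|exact: ce'|].
      have [sx|sx] := eqVneq s x'.
        left; apply/touchP; exists x', y'; rewrite -{1}sx sk1; split=> //.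
        by move: sk2; rewrite sx eqxx.
      by right; apply/meetsP; exists s => //; move: sk2; rewrite (negbTE sx).
    - by rewrite inE sk1.
    - by apply: meetsS k1A; apply: subsetUl.
  have [_ _ _ k1R k1D] := k1P s sS; have [_ _ _ k2R k2D] := k2P _ (gS s sS).
  have [_ _ _ k1R' _] := k1P t tS; have [_ _ _ k2R' _] := k2P _ (gS t tS).
  have mix a b : a \in x' |: Y0 -> b \in x' |: Y0 -> w \in a |: R A -> w \in (if b == x' then y' else b) |: R B -> a = b.
    move=> aS bS; rewrite in_setU1 [w \in _ |: R B]in_setU1; move=> /orP[/eqP wa|wA] /orP[/eqP wb|wB].
    - move: wb; case: eqP => [-> wy|_ <- //]; rewrite wa in wy; move: aS; rewrite wy !inE (negbTE yY) orbF.
      by rewrite eq_sym (negbTE xy').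
    - move: aS; rewrite -wa !inE => /orP[/eqP wx|wY]; first by case/negP: xB; rewrite -wx.
      by case/negP: (RY _ _ wB).
    - move: wb bS; case: eqP => [_ wy|bx wb bS]; first by case/negP: yA; rewrite -wy.
      move: bS; rewrite -wb !inE => /orP[/eqP wx|wY]; last by case/negP: (RY _ _ wA).
      by case: bx; rewrite -wb.
    - by case: (Rdisj w).
  rewrite !in_setU => /orP[w1|w2] /orP[w3|w4].
  - exact: k1D tS w1 w3.
  - by apply: mix => //; [apply: (subsetP k1R) | apply: (subsetP k2R')].
  - by apply/esym; apply: mix => //; [apply: (subsetP k1R') | apply: (subsetP k2R)].
  - have := k2D _ _ (gS t tS) w2 w4; case: (eqVneq s x') => [->|sx]; case: (eqVneq t x') => [->|tx] //.
      by move=> yt; move: tS; rewrite -yt !inE eq_sym (negbTE xy') (negbTE yY).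
    by move=> yt; move: sS; rewrite yt !inE eq_sym (negbTE xy') (negbTE yY).
have Rdisj' z : z \in R B -> z \in R A -> False by move=> zB zA; apply: Rdisj zA zB.
case: (cross _ _ KA KB Rdisj) => [[xA yA]|[yA xA]];
  case: (cross _ _ KB KA Rdisj') => [[xB yB]|[yB xB]].
- by case: (Rdisj x).
- exact: key exy xy ee' cex xA yB.
- have ee2 u v : e u v -> [\/ e' u v, u = y /\ v = x | u = x /\ v = y].
    by case/ee'; [exact: Or31 | exact: Or33 | exact: Or32].
  apply: (key y x) => //; first by rewrite se.
    by rewrite eq_sym.
  move=> L yL; apply: conn_mono => u v uL vL /ee'[//|[_ vy]|[uy _]].
    by rewrite -vy vL in yL.
  by rewrite -uy uL in yL.
- by case: (Rdisj y).
Qed.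

End Menger.

(** * The neighbourhood of a vertex of small degree *)

(* F lists the non-adjacent pairs among d neighbours 0, ..., d-1 of a vertex;
   in the matrix [cone F] that vertex has index 0 and neighbour i index i+1. *)
Definition pairs d := [seq (i, j) | i <- iota 0 d, j <- iota i.+1 (d - i.+1)].
Definition has_pair (F : seq (nat * nat)) i j := ((i, j) \in F) || ((j, i) \in F).
Definition cone F i j := if i is i'.+1 then (if j is j'.+1 then ~~ has_pair F i' j' else true) else true.
Definition drop_pair F i j := [seq p <- F | (p != (i, j)) && (p != (j, i))] : seq (nat * nat).

(* Contract j into i; the remaining non-adjacent pairs are placed first so that
   they become the two missing edges of K7eq. *)
Definition assign d (r : nat -> nat) (ms : seq (nat * nat)) : seq nat :=
  let L0 := flatten [seq [:: p.1; p.2] | p <- ms] in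
  let L := L0 ++ [seq x <- iota 0 d | (r x == x) && (x \notin L0)] in
  6 :: [seq index (r x) L | x <- iota 0 d].

(* Unlike [has] and [&&], which [vm_compute] evaluates in full, [some] stops early. *)
Fixpoint some (T : Type) (f : T -> bool) (s : seq T) :=
  if s is x :: s' then (if f x then true else some f s') else false.

Lemma someE T (f : T -> bool) s : some f s = has f s.
Proof. by elim: s => //= x s ->; case: (f x). Qed.

Definition direct6 F := (size F <= 2) && check7 7 (cone F) (assign 6 id F).

(** Together with the centre these are eight vertices, one too many, so an adjacent pair [i], [j] is
    contracted. A vertex misses the merged one when it misses both ends. *)
Definition direct7 F := some (fun ij : nat * nat => let: (i, j) := ij in
  if has_pair F i j then false else
  let rest := [seq x <- iota 0 7 | (x != i) && (x != j)] in
  let ms := [seq p <- F | (p.1 \in rest) && (p.2 \in rest)] ++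
            [seq (x, i) | x <- rest & has_pair F x i && has_pair F x j] in
  if (2 < size ms) || ~~ uniq (flatten [seq [:: p.1; p.2] | p <- ms]) then false
  else check7 8 (cone F) (assign 7 (fun x : nat => if x == j then i else x) ms)) (pairs 7).

Fixpoint subs (T : Type) k (s : seq T) : seq (seq T) := match k, s with
  | 0, _ => [:: [::]]
  | _, [::] => [::]
  | k'.+1, x :: s' => [seq x :: t | t <- subs k' s'] ++ subs k s'
  end.

Lemma mem_subs (T : eqType) (t s : seq T) : subseq t s -> t \in subs (size t) s.
Proof.
elim: s t => [|x s IH] [|y t] //=; rewrite mem_cat; case: eqP => [->|_] ts; apply/orP.
  by left; apply: map_f; apply: IH.
by right; apply: (IH (y :: t)).
Qed.

Definition fours d := subs 4 (iota 0 d).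
(** A set of four carries three 4-cycles up to rotation and reversal. *)
Definition quads d := flatten [seq (if q is [:: a; b; c; e] then
  [:: q; [:: a; b; e; c]; [:: a; c; b; e]] else [::]) | q <- fours d].
Definition cyc (q : seq nat) := zip q (rot 1 q).

Definition drops direct F (L : seq (nat * nat)) := all (fun p => direct (drop_pair F p.1 p.2)) L : bool.

(** The 4-cycle [q] is a whole component of the graph of non-adjacent pairs. *)
Definition good_cycle F q := [&& uniq q, all (fun p => has_pair F p.1 p.2) (cyc q) &
  all (fun p => has_pair (cyc q) p.1 p.2 || (p.1 \notin q) && (p.2 \notin q)) F].

Definition filled F q := [&& 4 < size F, drops direct7 F (cyc q) &
  has (fun p => (p.1 \notin q) && (p.2 \notin q)) F].

(** Independence refers to the graph [F] of non-adjacent pairs, so four pairwise adjacent neighbours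
    are excluded. *)
Definition no_indep4 d F := all (fun q => has (fun p => (p.1 \in q) && (p.2 \in q)) F) (fours d).

(** In the last alternative the bound on [size F] yields a vertex outside the closed neighbourhood:
    a graph on eight vertices with 24 edges has only four non-adjacent pairs. In [classify6] the
    numbers are seven, 20 and one. *)
Definition classify7 F := if direct7 F then true else
  (if some (fun q => if good_cycle F q then (if all (fun p => has_pair (cyc q) p.1 p.2) F then true else filled F q) else false) (quads 7) then true else
  [&& 4 < size F, drops direct7 F F & no_indep4 7 F]).

Definition classify6 F := direct6 F || [&& 1 < size F, drops direct6 F F & no_indep4 6 F].

Definition deg (F : seq (nat * nat)) i := count (fun p => (p.1 == i) || (p.2 == i)) F.

Fixpoint en D (ok : seq (nat * nat) -> bool) ps acc := if ps is p :: ps' then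
  (if (deg acc p.1 < D) && (deg acc p.2 < D) then en D ok ps' (p :: acc) else true) && en D ok ps' acc
  else ok acc.

Lemma deg_catrev F acc i : deg acc i <= deg (catrev F acc) i.
Proof. by rewrite catrevE /deg count_cat leq_addl. Qed.

(** Degrees only grow along the search, so a branch cut by the degree bound contains no admissible
    set of pairs. *)
Lemma en_correct D ok ps acc (f : pred (nat * nat)) : en D ok ps acc ->
  (forall i, deg (catrev (filter f ps) acc) i <= D) -> ok (catrev (filter f ps) acc).
Proof.
elim: ps acc => [|p ps IH] acc //= /andP[H1 H2]; case: (f p) => /= dD; last exact: IH.
apply: IH => //; move: H1; case: ifP => // /negP[]; apply/andP.
have dA i : (p.1 == i) || (p.2 == i) -> deg acc i < D.
  move=> pi; apply: leq_trans (dD i); apply: leq_trans (deg_catrev _ _ _).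
  by rewrite /deg /= pi.
by split; apply: dA; rewrite eqxx ?orbT.
Qed.

Lemma en7 : en 2 classify7 (pairs 7) [::].
Proof. vm_cast_no_check (erefl true). Qed.

Lemma en6 : en 1 classify6 (pairs 6) [::].
Proof. by vm_compute. Qed.

Lemma mem_pairs n i j : ((i, j) \in pairs n) = (i < j < n).
Proof.
apply/allpairsPdep/idP => [[x [y [+ + [-> ->]]]]|/andP[ij jn]].
  by rewrite !mem_iota; lia.
by exists i, j; rewrite !mem_iota; split=> //; lia.
Qed.

Lemma has_pair_drop F i j k l : has_pair (drop_pair F i j) k l =
  has_pair F k l && ~~ ((k == i) && (l == j) || (k == j) && (l == i)).
Proof.
rewrite /has_pair !mem_filter !xpair_eqE; case: (_ \in F); case: (_ \in F);
by case: (k == i); case: (l == j); case: (k == j); case: (l == i).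
Qed.

Section Neighbourhood.
Variables (G : sgraph) (v : G).

Let d := size (enum (nb v)).
Definition nth_nb i := nth v (enum (nb v)) i.
Local Notation s_ := nth_nb.
(** In this form the list is literally the accumulator of [en] at its leaf. *)
Definition non_adj := catrev [seq p <- pairs d | ~~ adj (s_ p.1) (s_ p.2)] [::].
Local Notation F := non_adj.

Lemma nth_nb_in i : i < d -> s_ i \in nb v.
Proof. by move=> id; rewrite -mem_enum mem_nth. Qed.

Lemma nth_nb_adj i : i < d -> adj v (s_ i).
Proof. by rewrite -nbE; apply: nth_nb_in. Qed.

Lemma nth_nb_inj i j : i < d -> j < d -> s_ i = s_ j -> i = j.
Proof. by move=> id jd /eqP; rewrite nth_uniq ?enum_uniq // => /eqP. Qed.

Lemma nb_nth x : x \in nb v -> exists2 i, i < d & x = s_ i.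
Proof.
rewrite -mem_enum => xs; exists (index x (enum (nb v))); first by rewrite index_mem.
by rewrite /s_ nth_index.
Qed.

Lemma nth_nb_v i : i < d -> s_ i != v.
Proof. by move/nth_nb_in; apply: contraTneq => ->; apply: nb_irr. Qed.

Lemma mem_F i j : ((i, j) \in F) = (i < j < d) && ~~ adj (s_ i) (s_ j).
Proof. by rewrite mem_rev mem_filter mem_pairs andbC. Qed.

Lemma has_pairF i j : has_pair F i j = [&& i != j, i < d, j < d & ~~ adj (s_ i) (s_ j)].
Proof. by rewrite /has_pair !mem_F (adj_sym (s_ j)); case: (adj _ _); rewrite ?andbF ?andbT //=; lia. Qed.

Lemma uniq_F : uniq F.
Proof.
rewrite rev_uniq filter_uniq // allpairs_uniq_dep ?iota_uniq // => [i _|[i j] [k l] _ _ /= [-> ->] //].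
exact: iota_uniq.
Qed.

Lemma deg_F D : (forall i, i < d -> #|nb v :\: (s_ i |: nb (s_ i))| <= D) -> forall i, deg F i <= D.
Proof.
move=> H i; have [id|di] := ltnP i d; last first.
  rewrite /deg -(@eq_in_count _ pred0) ?count_pred0 // => -[k l]; rewrite mem_F /= => /andP[/andP[kl ld] _].
  by apply/esym; apply/negbTE; rewrite negb_or; apply/andP; split; apply/eqP; lia.
apply: leq_trans (H i id); rewrite /deg -size_filter.
pose o (p : nat * nat) := if p.1 == i then p.2 else p.1.
rewrite -(size_map (fun p => s_ (o p))).
have FP p : p \in [seq p <- F | (p.1 == i) || (p.2 == i)] ->
   [/\ o p < d, o p != i, ~~ adj (s_ i) (s_ (o p)) & p = (minn i (o p), maxn i (o p))].
  rewrite mem_filter; case: p => k l; rewrite mem_F /o /= => /andP[/orP[]/eqP-> /andP[/andP[a b] c]].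
    by rewrite eqxx; split=> //; [lia|congr pair; lia].
  case: eqP => [ki|_]; first by lia.
  by split; rewrite ?(adj_sym (s_ i)) //; [lia|lia|congr pair; lia].
have us : uniq [seq s_ (o p) | p <- [seq p <- F | (p.1 == i) || (p.2 == i)]].
  rewrite map_inj_in_uniq ?filter_uniq ?uniq_F // => p q /FP[a _ _ Ep] /FP[b _ _ Eq] E.
  by rewrite Ep Eq (nth_nb_inj a b E).
rewrite cardE; apply: uniq_leq_size => // x /mapP[p /FP[a b c _] ->].
rewrite mem_enum in_setD in_setU1 nbE negb_or nth_nb_in // andbT c andbT.
by apply: contra b => /eqP /nth_nb_inj ->.
Qed.

(** Both orientations of the pairs in [F] join distinct non-adjacent vertices. This bounds [size F]
    when no vertex lies outside the closed neighbourhood. *)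
Lemma size_F (n := #|G|) : 2 * size F + #|darts G| <= n * n.-1.
Proof.
pose L := [seq (s_ p.1, s_ p.2) | p <- F] ++ [seq (s_ p.2, s_ p.1) | p <- F].
have FP p : p \in F -> [/\ p.1 < d, p.2 < d, p.1 < p.2 & ~~ adj (s_ p.1) (s_ p.2)].
  by case: p => i j; rewrite mem_F => /andP[/andP[ij jd] a]; split=> //=; lia.
have i1 : {in F &, injective (fun p => (s_ p.1, s_ p.2))}.
  move=> [i j] [k l] /FP[/= a b _ _] /FP[/= a' b' _ _] [/nth_nb_inj E1 /nth_nb_inj E2].
  by rewrite (E1 a a') (E2 b b').
have i2 : {in F &, injective (fun p => (s_ p.2, s_ p.1))}.
  move=> [i j] [k l] /FP[/= a b _ _] /FP[/= a' b' _ _] [/nth_nb_inj E1 /nth_nb_inj E2].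
  by rewrite (E1 b b') (E2 a a').
have uL : uniq L.
  rewrite cat_uniq !map_inj_in_uniq ?uniq_F // andbT /=; apply/hasPn => _ /mapP[p /FP[a b c _] ->].
  apply/mapP => -[q /FP[a' b' c' _] [/nth_nb_inj E1 /nth_nb_inj E2]].
  by move: c c'; rewrite (E1 b a') (E2 a b') => h /(ltn_trans h); rewrite ltnn.
pose D := [set p : G * G | p.1 != p.2].
have cD : #|D| = n * n.-1.
  rewrite -sum1_card (partition_big (fun p : G * G => p.1) predT) //=.
  rewrite /n -sum_nat_const; apply: eq_big => [x|x _]; rewrite ?inE // sum1dep_card -(cardsC1 x).
  have pi : injective (fun y : G => (x, y)) by move=> y z [].
  rewrite -(card_imset _ pi); apply: eq_card => -[a b]; rewrite !inE /=.
  apply/andP/imsetP => [[ab /eqP ax]|[y]].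
    by exists b; rewrite ?inE -?ax 1?eq_sym ?ab.
  by rewrite !inE => xy [-> ->]; rewrite eq_sym xy.
rewrite -cD; have -> : 2 * size F = #|L|.
  by rewrite (card_uniqP uL) size_cat !size_map; lia.
have sL : [set p in L] \subset D :\: darts G.
  apply/subsetP => p; rewrite !inE mem_cat => /orP[]/mapP[q /FP[a b c e] ->] /=; rewrite 1?(adj_sym (s_ q.2)) e /=.
    by apply/negP => /eqP /nth_nb_inj E; move: c; rewrite (E a b) ltnn.
  by apply/negP => /eqP /nth_nb_inj E; move: c; rewrite (E b a) ltnn.
have sD : darts G \subset D.
  by apply/subsetP => p; rewrite !inE; apply: contraTneq => ->; rewrite adj_irrefl.
have H : #|L| <= #|D| - #|darts G|.
  by have := subset_leq_card sL; rewrite cardsE cardsD (setIidPr sD).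
by rewrite -(subnK (subset_leq_card sD)) leq_add2r.
Qed.

Definition nbW k : {set G} := if k is i.+1 then [set s_ i] else [set v].
Definition fillW K i0 k : {set G} :=
  if k is i.+1 then (if i == i0 then s_ i |: K else [set s_ i]) else [set v].

Lemma nbW_family : @family d.+1 (cone F) G nbW.
Proof.
split=> [[|i] _|[|i] [|j] x|[|i] [|j]] //=; rewrite ?ltnS; try exact: conn1.
- by move=> _ jd; rewrite !inE => /eqP -> /eqP E; have := nth_nb_v jd; rewrite -E eqxx.
- by move=> jd _; rewrite !inE => /eqP -> /eqP E; have := nth_nb_v jd; rewrite -E eqxx.
- by move=> id jd; rewrite !inE => /eqP -> /eqP /nth_nb_inj ->.
- by move=> _ jd _ _; apply/touchP; exists v, (s_ j); rewrite !inE nth_nb_adj.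
- by move=> jd _ _ _; apply/touchP; exists (s_ i), v; rewrite !inE adj_sym nth_nb_adj.
move=> id jd ij; rewrite has_pairF id jd /= => H; apply/touchP; exists (s_ i), (s_ j); rewrite !inE; split=> //.
apply/negPn/negP => E; case/negP: H; rewrite E andbT; apply/eqP => E'; by rewrite E' in ij.
Qed.

(** Absorbing [K] into neighbour [i] makes it touch neighbour [j] and so removes this pair from
    [F]. *)
Lemma fill_family K i j : i < d -> j < d -> i != j -> conn (@adj G) K -> [disjoint K & v |: nb v] ->
  touch (@adj G) [set s_ i] K -> touch (@adj G) [set s_ j] K ->
  @family d.+1 (cone (drop_pair F i j)) G (fillW K i).
Proof.
move=> id jd ij cK dK ti tj.
have Kv x : x \in K -> x != v /\ forall k, k < d -> x != s_ k.
  move=> xK; have /pred0P/(_ x) := dK; rewrite /= xK !inE /= => /negbT; rewrite negb_or => /andP[-> n]; split=> // k kd.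
  by apply: contraNneq n => ->; rewrite nth_nb_adj.
have sub k : nbW k \subset fillW K i k.
  by case: k => [|k] //=; case: eqP => _ //; apply: subsetUl.
have [c1 c2 c3] := nbW_family.
split.
- move=> [|k] kd /=; first exact: conn1.
  case: eqP => [->|_]; last exact: conn1.
  by apply: connU => //; [apply: asym | apply: conn1 | left].
- have aux k x : k < d.+1 -> x \in fillW K i k -> x \in nbW k \/ x \in K /\ k = i.+1.
    case: k => [|k] kd /=; first by left.
    by case: eqP => [->|_]; [rewrite in_setU => /orP[]; [left|right] | left].
  have nK k x : k < d.+1 -> x \in nbW k -> x \notin K.
    move=> kd xk; apply/negP => /Kv[xv xs]; case: k kd xk => [_|k kd] /=; rewrite inE; first exact/negP.
    exact/negP/xs.
  move=> k l x kd ld /(aux _ _ kd) [xk|[xK ->]] /(aux _ _ ld) [xl|[xK' ->]] //.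
  + exact: c2 xk xl.
  + by have := nK _ _ kd xk; rewrite xK'.
  + by have := nK _ _ ld xl; rewrite xK.
move=> k l kd ld kl Ckl; have [C|nC] := boolP (cone F k l).
  exact: touchS (sub k) (sub l) (c3 k l kd ld kl C).
case: k l kd ld kl Ckl nC => [|k] [|l] kd ld kl //= nk /negPn hk.
have [E|E] : (k = i /\ l = j) \/ (k = j /\ l = i).
  by move: nk; rewrite has_pair_drop hk negbK; lia.
- by case: E => -> ->; rewrite eqxx eq_sym (negbTE ij); rewrite touch_sym; [apply: touchS tj; rewrite ?subsetUr|apply: asym].
- by case: E => -> ->; rewrite eqxx eq_sym (negbTE ij); apply: touchS tj; rewrite ?subsetUr.
Qed.
End Neighbourhood.

Lemma direct7P F : direct7 F -> exists g, check7 8 (cone F) g.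
Proof.
rewrite /direct7 someE => /hasP[[i j] _]; case: ifP => // _; case: ifP => // _.
by eexists; eassumption.
Qed.

Lemma direct6P F : direct6 F -> exists g, check7 7 (cone F) g.
Proof. by case/andP => _; eexists; eassumption. Qed.

(** * Counting edges *)

Section Ein.
Variable G : sgraph.
Implicit Types (A B S T Y : {set G}) (x y v : G).

(** An edge inside both sets counts twice, so [ein A A] is twice the number of edges in [A]. *)
Definition ein A B := #|[set p : G * G | [&& p.1 \in A, p.2 \in B & adj p.1 p.2]]|.

Lemma einE A B : ein A B = \sum_(x in A) #|nb x :&: B|.
Proof. exact: darts_sum. Qed.

Lemma einC A B : ein A B = ein B A.
Proof.
pose f (p : G * G) := (p.2, p.1); have fi : injective f by move=> [a b] [c d] [-> ->].
rewrite /ein -(card_imset _ fi); apply: eq_card => -[a b]; rewrite inE /=.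
apply/imsetP/and3P => [[[c d]]|[aA bB ab]].
  by rewrite inE /= => /and3P[cA dB cd] [-> ->]; rewrite adj_sym.
by exists (b, a); rewrite // inE /= aA bB adj_sym.
Qed.

Lemma einUl A A' B : [disjoint A & A'] -> ein (A :|: A') B = ein A B + ein A' B.
Proof.
move=> dA; rewrite !einE -bigU //; apply: eq_bigl => x; rewrite !inE //.
Qed.

Lemma einUr A B B' : [disjoint B & B'] -> ein A (B :|: B') = ein A B + ein A B'.
Proof. by move=> dB; rewrite einC einUl // einC (einC B'). Qed.

Lemma einT : ein setT setT = #|darts G|.
Proof. by apply: eq_card => p; rewrite !inE. Qed.

Lemma ein1 x B : ein [set x] B = #|nb x :&: B|.
Proof. by rewrite einE big_set1. Qed.

Lemma ein11 x : ein [set x] [set x] = 0.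
Proof.
by rewrite ein1; apply: eq_card0 => y; rewrite !inE; apply/negP => /andP[xy /eqP E]; rewrite E adj_irrefl in xy.
Qed.

Lemma ein_out A B : (forall x y, x \in A -> y \in B -> ~~ adj x y) -> ein A B = 0.
Proof.
move=> H; apply: eq_card0 => p; rewrite inE; apply/negP => /and3P[pA pB].
exact/negP/H.
Qed.

Lemma ein_clique A : (forall x y, x \in A -> y \in A -> x != y -> adj x y) ->
  ein A A = #|A| * #|A|.-1.
Proof.
move=> H; rewrite einE -sum_nat_const; apply: eq_bigr => x xA.
rewrite (_ : nb x :&: A = A :\ x); first by have := cardsD1 x A; rewrite xA => ->.
apply/setP => y; rewrite !inE; have [->|yx] := eqVneq y x; first by rewrite adj_irrefl.
by have [yA|] := boolP (y \in A); rewrite ?andbF // H // eq_sym.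
Qed.

Lemma ein_le A : ein A A <= #|A| * #|A|.-1.
Proof.
rewrite einE -sum_nat_const; apply: leq_sum => x xA.
have -> : #|A|.-1 = #|A :\ x| by have := cardsD1 x A; rewrite xA => ->.
apply: subset_leq_card; apply/subsetP => y; rewrite !inE => /andP[xy ->].
by rewrite andbT; apply: contraTneq xy => ->; rewrite adj_irrefl.
Qed.

Lemma ein_lt A x y : x \in A -> y \in A -> x != y -> ~~ adj x y -> ein A A < #|A| * #|A|.-1.
Proof.
move=> xA yA xy nxy; rewrite einE -sum_nat_const !(big_setD1 x xA) /= -addSn; apply: leq_add.
  have := cardsD1 x A; have := cardsD1 y (A :\ x); rewrite xA in_setD1 eq_sym xy yA => E2 E1.
  apply: (@leq_trans #|A :\ x :\ y|.+1); last by move: E1 E2; clear; lia.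
  rewrite ltnS; apply: subset_leq_card; apply/subsetP => z; rewrite !inE => /andP[xz ->].
  rewrite andbT; apply/andP; split; last by apply: contraTneq xz => ->; rewrite adj_irrefl.
  by apply: contraNneq nxy => <-.
apply: leq_sum => z; rewrite in_setD1 => /andP[_ zA].
have -> : #|A|.-1 = #|A :\ z| by have := cardsD1 z A; rewrite zA => ->.
apply: subset_leq_card; apply/subsetP => w; rewrite !inE => /andP[zw ->].
by rewrite andbT; apply: contraTneq zw => ->; rewrite adj_irrefl.
Qed.

Lemma einT_split A : ein setT setT = ein A A + 2 * ein A (~: A) + ein (~: A) (~: A).
Proof.
have dA : [disjoint A & ~: A] by rewrite -setI_eq0 setICr.
rewrite -(setUCr A) !(einUl, einUr) // (einC (~: A) A); lia.
Qed.

(** Parts of [S] can be contracted onto [Y] so as to make [Y] complete; the sets [c y] say how. *)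
Definition cliquable Y (c : G -> {set G}) S :=
  [/\ forall y, y \in Y -> [/\ conn (@adj G) (c y), y \in c y & c y \subset y |: S],
      disj_on Y c &
      forall y z, y \in Y -> z \in Y -> y != z -> touch (@adj G) (c y) (c z)].

Lemma cliquable1 Y S : (forall x y, x \in Y -> y \in Y -> x != y -> adj x y) ->
  cliquable Y (fun y => [set y]) S.
Proof.
move=> H; split=> [y yY|y z x yY zY|y z yY zY yz].
- by rewrite inE eqxx sub1set setU11; split=> //; apply: conn1.
- by rewrite !inE => /eqP -> /eqP.
by apply/touchP; exists y, z; rewrite !inE H.
Qed.
End Ein.

(** * A minimal graph with 4n - 8 edges *)

Section Critical.
Variable G : sgraph.
Implicit Types (A B S T Y K : {set G}) (x y v : G).
Hypothesis n3 : 3 <= #|G|.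
Hypothesis hd : #|darts G| + 16 = 8 * #|G|.
Hypothesis noK : ~ mm K7eq G.
Hypothesis noD : ~ mm Dg G.
(** Minimality: a smaller minor with k >= 3 vertices has at most 4k - 9 edges, here counted
    twice. *)
Hypothesis bd : forall (A : {set G}) W (R : {set G * G}), model_on A W -> 3 <= #|A| < #|G| ->
  (forall p, p \in R -> [&& p.1 \in A, p.2 \in A, p.1 != p.2 & touch (@adj G) (W p.1) (W p.2)]) ->
  #|R| + 18 <= 8 * #|A|.

(** The inequality 8n <= n(n - 1) + 16 fails for n = 3, ..., 6. *)
Lemma card_ge7 : 7 <= #|G|.
Proof.
have := ein_le [set: G]; rewrite einT cardsT => H.
have : 8 * #|G| <= #|G| * #|G|.-1 + 16 by lia.
rewrite leqNgt; case: (#|G|) n3 => [|[|[|[|[|[|[|n]]]]]]] //; lia.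
Qed.

Lemma induced_bd A : 3 <= #|A| < #|G| -> ein A A + 18 <= 8 * #|A|.
Proof.
move=> hA; apply: (bd (W := fun x => [set x])) => //.
  split=> [x _|x y z _ _]; first exact: conn1.
  by rewrite !inE => /eqP -> /eqP.
move=> p; rewrite inE => /and3P[-> -> pa] /=; apply/andP; split.
  by apply: contraTneq pa => ->; rewrite adj_irrefl.
by apply/touchP; exists p.1, p.2; rewrite !inE.
Qed.

Lemma cardC1' x : #|~: [set x]| = #|G|.-1.
Proof. by rewrite cardsC1. Qed.

Lemma nbC1 x : nb x :&: ~: [set x] = nb x.
Proof.
by apply/setIidPl/subsetP => y yx; rewrite !inE; apply: contraTneq yx => ->; apply: nb_irr.
Qed.

(** Deleting [x] must bring the number of edges from 4n - 8 down to at most 4(n - 1) - 9. *)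
Lemma mindeg x : 5 <= #|nb x|.
Proof.
have := card_ge7; have := induced_bd (A := ~: [set x]); rewrite cardC1'.
have := einT_split [set x]; rewrite einT ein11 ein1 nbC1.
lia.
Qed.

(* Contracting xy destroys one edge more than there are triangles on xy. *)
Lemma codeg x y : adj x y -> 4 <= #|nb x :&: nb y|.
Proof.
move=> xy; have xny : x != y by apply: contraTneq xy => ->; rewrite adj_irrefl.
pose A := ~: [set y]; pose W z := if z == x then [set x; y] else [set z].
(* [Z] consists of the neighbours of [y] that are new to [x]; [R2] and [R3] are the two orientations
   of the edges they contribute. *)
pose Z := nb y :\: (x |: nb x).
pose R1 := [set p : G * G | [&& p.1 \in A, p.2 \in A & adj p.1 p.2]].
pose R2 := [set (x, z) | z in Z]; pose R3 := [set (z, x) | z in Z].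
have cR2 : #|R2| = #|Z| by rewrite card_imset // => a b [].
have cR3 : #|R3| = #|Z| by rewrite card_imset // => a b [].
have cR : #|R1 :|: R2 :|: R3| = #|R1| + #|Z| + #|Z|.
  rewrite cardsU (_ : _ :&: R3 = set0); last first.
    apply/setP => -[a b]; rewrite in_set0 in_setI; apply/negP => /andP[ab /imsetP[z]].
    rewrite in_setD in_setU1 negb_or => /andP[/andP[zx xz] _] [ea eb]; subst a b.
    move: ab; rewrite in_setU => /orP[|/imsetP[z' _ [zz _]]]; last by case/eqP: zx.
    by rewrite nbE in xz; rewrite inE /= => /and3P[_ _]; rewrite adj_sym (negbTE xz).
  rewrite cards0 subn0 cardsU (_ : _ :&: R2 = set0) ?cards0 ?subn0 ?cR2 ?cR3 //.
  apply/setP => -[a b]; rewrite in_set0 in_setI; apply/negP => /andP[ab /imsetP[z]].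
  rewrite in_setD in_setU1 negb_or => /andP[/andP[zx xz] _] [ea eb]; subst a b.
  by rewrite nbE in xz; move: ab; rewrite inE /= (negbTE xz) !andbF.
have Wself z : z \in W z by rewrite /W; case: eqP => [->|_]; rewrite !inE eqxx.
have bdR : #|R1 :|: R2 :|: R3| + 18 <= 8 * #|A|.
  apply: (bd (W := W)).
  - split=> [z _|z z' t]; first by rewrite /W; case: eqP => _; [apply: conn2 => //; apply: asym | apply: conn1].
    rewrite !inE /W => zy z'y; case: eqP => [->|_]; case: eqP => [->|_] //; rewrite !inE.
    + by move=> /orP[/eqP ->|/eqP ->] /eqP // E; rewrite E eqxx in z'y.
    + by move=> /eqP -> /orP[/eqP ->|/eqP E] //; rewrite E eqxx in zy.
    + by move=> /eqP -> /eqP.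
  - by rewrite cardC1'; have := card_ge7; lia.
  have RZ z : z \in Z -> [&& z \in A, z != x & touch (@adj G) (W x) (W z)].
    rewrite in_setD in_setU1 negb_or => /andP[/andP[zx xz] yz]; rewrite zx !inE.
    have -> : z != y by apply: contraTneq yz => ->; apply: nb_irr.
    apply/touchP; exists y, z; rewrite Wself /W eqxx !inE eqxx orbT; split=> //.
    by rewrite -nbE.
  move=> p; rewrite !in_setU => /orP[/orP[|/imsetP[z zZ ->]]|/imsetP[z zZ ->]] /=.
  - rewrite inE => /and3P[-> -> pa] /=; apply/andP; split.
      by apply: contraTneq pa => ->; rewrite adj_irrefl.
    by apply/touchP; exists p.1, p.2; rewrite !Wself.
  - by have /and3P[-> zx ->] := RZ z zZ; rewrite eq_sym zx !inE xny.
  - have /and3P[-> zx t] := RZ z zZ; rewrite zx !inE xny touch_sym //=; exact: asym.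
have cZ : #|nb y| = #|Z| + 1 + #|nb x :&: nb y|.
  rewrite -(cardsID (x |: nb x) (nb y)) -/Z.
  rewrite (_ : nb y :&: (x |: nb x) = x |: (nb x :&: nb y)).
    by rewrite cardsU1 in_setI (negbTE (nb_irr x)); lia.
  apply/setP => z; rewrite !inE; have [->|_] := eqVneq z x; first by rewrite adj_sym xy.
  by rewrite andbC.
have := einT_split [set y]; rewrite einT ein11 ein1 nbC1 => E.
have E1 : #|R1| = ein A A by [].
move: bdR; rewrite cR E1 cardC1'; have := card_ge7; move: E; rewrite /A; lia.
Qed.

(* The minor obtained by contracting the side S onto Y. *)
Lemma half_cut S Y T c : [disjoint S & T] -> [disjoint S & Y] -> [disjoint Y & T] ->
  S :|: Y :|: T = setT -> S != set0 -> T != set0 -> cliquable Y c S ->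
  (forall x y, x \in S -> y \in T -> ~~ adj x y) ->
  ein T T + 2 * ein T Y + #|Y| * #|Y|.-1 + 18 <= 8 * (#|Y| + #|T|).
Proof.
move=> dST dSY dYT U /set0Pn[s sS] /set0Pn[t tT] [c1 c2 c3] nST.
have cYT : #|Y :|: T| = #|Y| + #|T|.
  by rewrite cardsU; move: dYT; rewrite -setI_eq0 => /eqP ->; rewrite cards0 subn0.
pose W z := if z \in Y then c z else [set z].
have nTS x : x \in T -> x \notin S by move=> xT; apply/negP => xS; move/pred0P/(_ x): dST; rewrite /= xS xT.
have nTY x : x \in T -> x \notin Y by move=> xT; apply/negP => xS; move/pred0P/(_ x): dYT; rewrite /= xS xT.
have nYS x : x \in Y -> x \notin S by move=> xT; apply/negP => xS; move/pred0P/(_ x): dSY; rewrite /= xS xT.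
have Wself z : z \in W z by rewrite /W; case: ifP => [/c1[]|_] //; rewrite inE.
have cs x z : x \in Y -> z \in c x -> z != x -> z \in S.
  by move=> xY zx zxn; have [_ _ /subsetP/(_ z zx)] := c1 x xY; rewrite !inE (negbTE zxn).
rewrite -cYT.
pose R := [set p : G * G | [&& p.1 \in Y :|: T, p.2 \in Y :|: T, p.1 != p.2 & touch (@adj G) (W p.1) (W p.2)]].
have : #|R| + 18 <= 8 * #|Y :|: T|.
  apply: (bd (W := W)).
  - split=> [x _|x y z]; first by rewrite /W; case: ifP => [/c1[]|_] //; apply: conn1.
    rewrite !inE /W; case: ifP => xY; case: ifP => yY //= xT yT.
    + exact: c2.
    + rewrite inE => zx /eqP zy; subst z; apply/eqP; apply/negPn/negP => E.
      by have := nTS y yT; rewrite (cs x y) // eq_sym.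
    + rewrite inE => /eqP zy zx; subst z; apply/eqP; apply/negPn/negP => E.
      by have := nTS x xT; rewrite (cs y x).
    + by rewrite !inE => /eqP -> /eqP.
  - apply/andP; split.
      apply: (@leq_trans 6) => //.
      have := subset_leq_card (_ : t |: nb t \subset Y :|: T).
      rewrite cardsU1 nb_irr add1n; have := mindeg t => m H; apply: leq_trans (H _); first by [].
      apply/subsetP => z; rewrite in_setU1 => /orP[/eqP ->|]; first by rewrite inE tT orbT.
      rewrite nbE => tz; have := in_setT z; rewrite -U -setUA inE => /orP[zS|//].
      by have := nST z t zS tT; rewrite adj_sym tz.
    apply: leq_trans (_ : #|~: [set s]| < _); last by rewrite cardC1'; have := card_ge7; lia.
    rewrite ltnS; apply: subset_leq_card; apply/subsetP => z; rewrite !inE => /orP zYT.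
    by apply/eqP => E; subst z; case: zYT => [/nYS|/nTS]; rewrite sS.
  - by move=> p; rewrite inE.
move=> H; apply: leq_trans H; rewrite leq_add2r.
pose R1 := [set p : G * G | [&& p.1 \in T, p.2 \in T & adj p.1 p.2]].
pose R2 := [set p : G * G | [&& p.1 \in T, p.2 \in Y & adj p.1 p.2]].
pose R3 := [set p : G * G | [&& p.1 \in Y, p.2 \in T & adj p.1 p.2]].
pose R4 := [set p : G * G | [&& p.1 \in Y, p.2 \in Y & p.1 != p.2]].
have c4 : #|R4| = #|Y| * #|Y|.-1.
  rewrite -sum_nat_const -sum1_card (partition_big (fun p : G * G => p.1) (mem Y)) /=; last first.
    by move=> p; rewrite inE => /andP[].
  apply: eq_bigr => x xA; rewrite sum1dep_card.
  have -> : #|Y|.-1 = #|Y :\ x| by have := cardsD1 x Y; rewrite xA => ->.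
  have pi : injective (fun y : G => (x, y)) by move=> y z [].
  rewrite -(card_imset _ pi); apply: eq_card => -[a b]; rewrite !inE /=.
  apply/andP/imsetP => [[/and3P[_ bB ab] /eqP ax]|[y]].
    by exists b; rewrite ?inE -?ax 1?eq_sym ?ab.
  by rewrite !inE => /andP[xy yB] [-> ->]; rewrite xA yB eq_sym xy.
have -> : ein T T + 2 * ein T Y + #|Y| * #|Y|.-1 = #|R1| + #|R2| + #|R3| + #|R4|.
  by rewrite c4; have := einC T Y; rewrite /ein -/R1 -/R2 -/R3; lia.
have dj (P Q : {set G * G}) : (forall p, p \in P -> p \in Q -> False) -> #|P :|: Q| = #|P| + #|Q|.
  move=> H; rewrite cardsU (_ : _ :&: _ = set0) ?cards0 ?subn0 //.
  by apply/setP => p; rewrite in_set0 in_setI; apply/negP => /andP[/H].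
have pt p : adj p.1 p.2 -> (p.1 != p.2) && touch (@adj G) (W p.1) (W p.2).
  move=> pa; apply/andP; split.
    by apply: contraTneq pa => ->; rewrite adj_irrefl.
  by apply/touchP; exists p.1, p.2; rewrite !Wself.
have YT x : x \in T -> x \in Y = false by move/nTY/negbTE.
have E : R1 :|: R2 :|: R3 :|: R4 \subset R.
  apply/subsetP => p.
  rewrite in_setU => /orP[|].
    rewrite !in_setU => /orP[/orP[]|]; rewrite !inE => /and3P[p1 p2 pa];
    by rewrite p1 p2 ?orbT /= pt.
  by rewrite !inE => /and3P[p1 p2 pa]; rewrite p1 p2 pa /= /W p1 p2 c3.
apply: leq_trans (subset_leq_card E); rewrite !dj // => p.
- by rewrite !inE => /and3P[a b _] /and3P[_ c' _]; rewrite (YT _ b) in c'.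
- rewrite in_setU => /orP[]; rewrite !inE => /and3P[a _ _] /and3P[c' _ _]; by rewrite (YT _ a) in c'.
- rewrite !in_setU => /orP[/orP[]|]; rewrite !inE => /and3P[a b _] /and3P[c' d _];
  by rewrite ?(YT _ a) ?(YT _ b) in c' d.
Qed.

(* Add the two bounds of [half_cut]: together they count the edges outside Y once,
   and a complete graph on Y twice. *)
Lemma cut S Y T c1 c2 : [disjoint S & T] -> [disjoint S & Y] -> [disjoint Y & T] ->
  S :|: Y :|: T = setT -> S != set0 -> T != set0 ->
  (forall x y, x \in S -> y \in T -> ~~ adj x y) ->
  cliquable Y c1 S -> cliquable Y c2 T -> #|Y| <= 4 -> (#|Y| = 4 -> ein Y Y < 12) -> False.
Proof.
move=> dST dSY dYT U S0 T0 nST q1 q2 k4 e4.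
have U' : T :|: Y :|: S = setT by rewrite -U setUC (setUC T) setUA.
have h1 := half_cut dST dSY dYT U S0 T0 q1 nST.
have h2 : ein S S + 2 * ein S Y + #|Y| * #|Y|.-1 + 18 <= 8 * (#|Y| + #|S|).
  apply: (half_cut (S := T) (Y := Y) (T := S) (c := c2)) => //; rewrite 1?disjoint_sym // => x y xT yS; rewrite adj_sym; exact: nST.
have dSYT : [disjoint S :|: Y & T] by rewrite -setI_eq0 setIUl setU_eq0 !setI_eq0 dST.
have := einT G; rewrite -U !(einUl _ dSYT) !(einUr _ dSYT) !(einUl _ dSY) !(einUr _ dSY).
rewrite (einC Y S) (einC Y T) (einC T S) (ein_out nST).
have cU : #|G| = #|S| + #|Y| + #|T|.
  by rewrite -cardsT -U !cardsU; move: dSYT dSY; rewrite -!setI_eq0 => /eqP -> /eqP ->; rewrite !cards0 !subn0.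
(* With k = [#|Y|], the bound k(k - 1) for [ein Y Y] turns this into (k - 4)(k - 5) <= 0. So k <= 3
   is impossible, and k = 4 forces [Y] to be complete. *)
move=> E; have : 2 * (#|Y| * #|Y|.-1) + 20 <= 8 * #|Y| + ein Y Y by move: E hd h1 h2; lia.
move: (ein_le Y) k4 e4; case: #|Y| => [|[|[|[|[|k]]]]] //; lia.
Qed.

Definition far v : {set G} := ~: (v |: nb v).
Definition att v K : {set G} := [set x in nb v | touch (@adj G) [set x] K].

Lemma farP v x : (x \in far v) = (x != v) && ~~ adj v x.
Proof. by rewrite !inE negb_or. Qed.

Lemma far_disj v K : K \subset far v -> [disjoint K & v |: nb v].
Proof. by rewrite -disjoints_subset. Qed.

Lemma attP v K x : reflect (adj v x /\ exists2 y, y \in K & adj x y) (x \in att v K).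
Proof.
rewrite inE nbE; apply: (iffP andP) => -[vx]; first last.
  by case=> y yK xy; split=> //; apply/touchP; exists x, y; rewrite inE.
by case/touchP => z [y [/set1P -> yK xy]]; split=> //; exists y.
Qed.

(** By [codeg] at least four common neighbours of [u] and [v] are removed, besides [u] itself. *)
Lemma few_nonnb v u : adj v u -> #|nb v :\: (u |: nb u)| <= #|nb v| - 5.
Proof.
move=> vu; rewrite cardsD; apply: leq_sub2l.
have -> : nb v :&: (u |: nb u) = u |: (nb v :&: nb u).
  by apply/setP => z; rewrite !inE; case: eqVneq => [->|_] //=; rewrite vu.
by rewrite cardsU1 inE (negbTE (nb_irr u)) andbF; have := codeg vu; lia.
Qed.

Lemma comp_far v x : x \in far v -> exists K, [/\ conn (@adj G) K, K \subset far v, x \in K &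
  forall y z, y \in K -> z \in far v -> adj y z -> z \in K].
Proof. by move=> xO; have [K [? ? ? ?]] := component (@asym G) xO; exists K. Qed.

(** The attached set is already complete, so singletons serve on both sides of [cut]. *)
Lemma clique_cut v K : K != set0 -> K \subset far v ->
  (forall y z, y \in K -> z \in far v -> adj y z -> z \in K) ->
  (forall x y, x \in att v K -> y \in att v K -> x != y -> adj x y) -> #|att v K| <= 3 -> False.
Proof.
move=> K0 KO cl cX X3; pose T := ~: (K :|: att v K).
have KX x : x \in K -> x \notin att v K.
  by move=> /(subsetP KO); rewrite farP => /andP[_ vx]; apply/attP => -[h]; rewrite h in vx.
have nKv : v \notin K by apply/negP => /(subsetP KO); rewrite farP eqxx.
apply: (@cut K (att v K) T (fun y => [set y]) (fun y => [set y])) => //.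
- by rewrite disjoints_subset setCK subsetUl.
- by rewrite disjoints_subset; apply/subsetP => x /KX; rewrite in_setC.
- by rewrite disjoints_subset setCK subsetUr.
- by rewrite /T setUCr.
- by apply/set0Pn; exists v; rewrite in_setC in_setU negb_or nKv /=; apply/attP => -[]; rewrite adj_irrefl.
- move=> x y xK; rewrite in_setC in_setU negb_or => /andP[yK yX]; apply/negP => xy.
  have [yO|] := boolP (y \in far v); first by case/negP: yK; apply: cl xy.
  rewrite farP negb_and !negbK => /orP[/eqP yv|vy].
    by have := subsetP KO x xK; rewrite farP -yv adj_sym xy andbF.
  by case/negP: yX; apply/attP; split=> //; exists x; rewrite // adj_sym.
- exact: cliquable1.
- exact: cliquable1.
- exact: leq_trans X3 _.
- by move=> E; rewrite E in X3.
Qed.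

Section AtV.
Variable v : G.
Local Notation d := (size (enum (nb v))).
Local Notation s_ := (nth_nb v).
Local Notation F := (non_adj v).
(** Stands for [direct6] or [direct7], so that degrees 6 and 7 share what follows. *)
Variable dir : seq (nat * nat) -> bool.
Hypothesis dirP : forall F, dir F -> exists g, check7 d.+1 (cone F) g.

Lemma not_direct : ~ dir F.
Proof. by case/dirP => g cg; apply: noK; apply: family_K7 (nbW_family v) cg. Qed.

Lemma fill_dir K i j : conn (@adj G) K -> K \subset far v -> has_pair F i j ->
  s_ i \in att v K -> s_ j \in att v K -> dir (drop_pair F i j) -> False.
Proof.
move=> cK KO; rewrite has_pairF => /and4P[ij id jd _] iX jX /dirP[g cg].
apply: noK; apply: family_K7 (fill_family id jd ij cK _ _ _) cg.
- exact: far_disj.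
- by move: iX; rewrite inE => /andP[].
- by move: jX; rewrite inE => /andP[].
Qed.

(* The set attached to a component contains a non-adjacent pair, which the
   component fills, or it is a clique with at most three vertices. *)
Lemma type_iv x : x \in far v -> drops dir F F -> no_indep4 d F -> False.
Proof.
move=> xO /allP dF /allP nF; have [K [cK KO xK cl]] := comp_far xO.
have noF i j : has_pair F i j -> s_ i \in att v K -> s_ j \in att v K -> False.
  have [] := boolP ((i, j) \in F) => [ij _ iX jX|nij].
    apply: (fill_dir cK KO _ iX jX (dF _ ij)); by rewrite /has_pair ij.
  rewrite /has_pair (negbTE nij) /= => ji iX jX.
  by apply: (fill_dir cK KO _ jX iX (dF _ ji)); rewrite /has_pair ji.
have Xd y : y \in att v K -> exists2 i, i < d & y = s_ i.
  by case/attP; rewrite -nbE => /nb_nth.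
have cX y z : y \in att v K -> z \in att v K -> y != z -> adj y z.
  move=> yX zX; have [i id yi] := Xd y yX; have [j jd zj] := Xd z zX; subst y z => ij.
  apply/negPn/negP => nij; apply: (noF i j) => //; rewrite has_pairF id jd nij !andbT.
  by apply: contraNneq ij => ->.
have [X3|X4] := leqP #|att v K| 3.
  by apply: (clique_cut _ KO cl cX X3); apply/set0Pn; exists x.
pose I := [seq i <- iota 0 d | s_ i \in att v K].
have sI : size I = #|att v K|.
  rewrite cardE -(size_map s_); apply/perm_size/uniq_perm; rewrite ?enum_uniq //.
    rewrite map_inj_in_uniq ?filter_uniq ?iota_uniq // => i j; rewrite !mem_filter !mem_iota /=.
    by move=> /andP[_ id] /andP[_ jd]; apply: nth_nb_inj.
  move=> y; rewrite mem_enum; apply/mapP/idP => [[i]|yX].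
    by rewrite mem_filter => /andP[? _] ->.
  by have [i id yi] := Xd y yX; exists i; rewrite // mem_filter -yi yX mem_iota.
have /nF/hasP[[i j] ij] : take 4 I \in fours d.
  have tI : subseq (take 4 I) (iota 0 d).
    exact: subseq_trans (take_subseq _ _) (filter_subseq _ _).
  by have := mem_subs tI; rewrite size_takel // sI.
move=> /andP[/= /mem_take + /mem_take]; rewrite !mem_filter => /andP[iX _] /andP[jX _].
by apply: (noF i j) => //; rewrite /has_pair ij.
Qed.

Section Cycle.
Variables a b c e : nat.
Local Notation q := [:: a; b; c; e].
Hypothesis d7 : d = 7.
Hypothesis gq : good_cycle F q.

Let uq : uniq q. Proof. by case/and3P: gq. Qed.

Lemma cycP i j : has_pair (cyc q) i j -> (i \in q) && (j \in q).
Proof.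
rewrite /has_pair /cyc /= !inE !xpair_eqE; case/orP => /or4P[] /andP[/eqP -> /eqP ->];
by rewrite !(eqxx, orbT).
Qed.

Lemma cycF i j : has_pair (cyc q) i j -> has_pair F i j.
Proof.
by case/and3P: gq => _ /allP h _ /orP[] /h //=; rewrite /has_pair orbC.
Qed.

Lemma Fcyc i j : has_pair F i j -> has_pair (cyc q) i j || (i \notin q) && (j \notin q).
Proof.
case/and3P: gq => _ _ /allP h /orP[] /h //=.
by rewrite andbC => /orP[|->]; rewrite ?orbT // => h'; apply/orP; left; rewrite /has_pair orbC.
Qed.

Lemma q_lt i : i \in q -> i < 7.
Proof.
have lt j k : has_pair (cyc q) j k -> j < 7.
  by move/cycF; rewrite has_pairF d7 => /and4P[].
rewrite !inE => /or4P[] /eqP ->; [apply: (lt _ b)|apply: (lt _ c)|apply: (lt _ e)|apply: (lt _ a)];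
by rewrite /has_pair /cyc /= !inE !(eqxx, orbT).
Qed.

Lemma rest3 : exists r1 r2 r3, [/\ uniq [:: r1; r2; r3], all (fun r => (r \notin q) && (r < 7)) [:: r1; r2; r3] &
  forall i, i < 7 -> (i \in q) || (i \in [:: r1; r2; r3])].
Proof.
pose I3 := [seq i <- iota 0 7 | i \notin q].
have s3 : size I3 = 3.
  have := count_predC (mem q) (iota 0 7); rewrite size_iota -!size_filter.
  have -> : size [seq x <- iota 0 7 | mem q x] = size q.
    apply/perm_size/uniq_perm; rewrite ?filter_uniq ?iota_uniq // => i.
    by rewrite mem_filter mem_iota /= andb_idr // => /q_lt.
  by move=> E; apply/eqP; rewrite -(eqn_add2l 4) -[X in _ == X]E.
have uI : uniq I3 by rewrite filter_uniq ?iota_uniq.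
have mI i : (i \in I3) = (i \notin q) && (i < 7) by rewrite mem_filter mem_iota.
case: I3 s3 uI mI => [|r1 [|r2 [|r3 []]]] // _ uI mI; exists r1, r2, r3; split=> //.
  by apply/allP => i; rewrite mI.
by move=> i i7; rewrite mI i7 andbT orbN.
Qed.

Lemma adjF i j : i < 7 -> j < 7 -> i != j -> ~~ has_pair F i j -> adj (s_ i) (s_ j).
Proof. by rewrite has_pairF d7 => -> -> -> /=; rewrite negbK. Qed.

Lemma cyc_diag : ~~ has_pair (cyc q) a c /\ ~~ has_pair (cyc q) b e.
Proof.
move: uq; rewrite /has_pair /cyc /= !inE !xpair_eqE => U.
by split; move: U; do !case: eqVneq => //= ?; subst.
Qed.
End Cycle.
(* If no component joins two consecutive vertices of the 4-cycle a b c e, then v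
   and its three other neighbours separate a, c from b, e. *)
Lemma cycle_dir a b c e : d = 7 -> good_cycle F [:: a; b; c; e] ->
  (if all (fun p => has_pair (cyc [:: a; b; c; e]) p.1 p.2) F then true else
  [&& 4 < size F, drops dir F (cyc [:: a; b; c; e]) &
  has (fun p => (p.1 \notin [:: a; b; c; e]) && (p.2 \notin [:: a; b; c; e])) F]) -> False.
Proof.
set q := [:: a; b; c; e] => d7 gq H.
have [r1 [r2 [r3 [ur nr er]]]] := rest3 d7 gq.
have [uq _ _] := and3P gq.
have r7 i : i \in [:: r1; r2; r3] -> i < 7 by move/(allP nr) => /andP[].
have rq i : i \in [:: r1; r2; r3] -> i \notin q by move/(allP nr) => /andP[].
have q7 i : i \in q -> i < 7 by apply: q_lt.
have nqr i : i \in q -> i \notin [:: r1; r2; r3] by apply: contraL; apply: rq.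
have qr i j : i \in q -> j \in [:: r1; r2; r3] -> adj (s_ i) (s_ j).
  move=> iq jr; apply: adjF (q7 _ iq) (r7 _ jr) _ _ => //.
    by apply: contraTneq iq => ->; apply: rq.
  by apply/negP => /(Fcyc gq); rewrite iq orbF => /cycP /andP[_]; apply/negP/rq.
have [nac nbe] := cyc_diag gq.
have qac : adj (s_ a) (s_ c).
  apply: adjF => //; rewrite ?q7 ?inE ?eqxx ?orbT //.
    by move: uq; rewrite /= !inE !negb_or => /and4P[/and3P[]].
  by apply/negP => /(Fcyc gq); rewrite (negbTE nac) !inE eqxx.
have qbe : adj (s_ b) (s_ e).
  apply: adjF => //; rewrite ?q7 ?inE ?eqxx ?orbT //.
    by move: uq; rewrite /= !inE !negb_or => /and4P[_ /andP[]].
  by apply/negP => /(Fcyc gq); rewrite (negbTE nbe) !inE eqxx orbT.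
have vs i : i < 7 -> adj v (s_ i) by rewrite -d7; apply: nth_nb_adj.
have s_inj i j : i < 7 -> j < 7 -> s_ i = s_ j -> i = j by rewrite -{1 2}d7; apply: nth_nb_inj.
have vn i : i < 7 -> v != s_ i by move/vs => h; apply: contraTneq h => <-; rewrite adj_irrefl.
have aq : a \in q by rewrite !inE eqxx.
have bq : b \in q by rewrite !inE eqxx orbT.
have ccq : c \in q by rewrite !inE eqxx !orbT.
have eq : e \in q by rewrite !inE eqxx !orbT.
have i1 : r1 \in [:: r1; r2; r3] by rewrite !inE eqxx.
have i2 : r2 \in [:: r1; r2; r3] by rewrite !inE eqxx orbT.
have i3 : r3 \in [:: r1; r2; r3] by rewrite !inE eqxx !orbT.
have uall : uniq (v :: map s_ (q ++ [:: r1; r2; r3])).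
  rewrite cons_uniq; apply/andP; split.
    by apply/mapP => -[i]; rewrite mem_cat => /orP[/q7|/r7] /vn /eqP.
  rewrite map_inj_in_uniq.
    by rewrite cat_uniq uq ur andTb andbT; apply/hasPn => i; apply: rq.
  by move=> i j; rewrite !mem_cat => /orP[/q7|/r7] i7 /orP[/q7|/r7] j7; apply: s_inj.
have [all4|nall] := boolP (all (fun p => has_pair (cyc q) p.1 p.2) F).
  have rr i j : i \in [:: r1; r2; r3] -> j \in [:: r1; r2; r3] -> i != j -> adj (s_ i) (s_ j).
    move=> ir jr ij; apply: adjF => //; rewrite ?r7 //; apply/negP => h.
    suff /cycP/andP[iq _] : has_pair (cyc q) i j by have := rq i ir; rewrite iq.
    by case/orP: h => /(allP all4) //=; rewrite /has_pair orbC.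
  move: (ur); rewrite /= !inE negb_or andbT => /andP[/andP[n12 n13] n23].
  (* Here the closed neighbourhood is D: the diagonals [ac] and [be] are its two edges, and [v],
     [r1], [r2], [r3] span the K_4. *)
  apply: noD; apply: (family_mm (M := dmat) (W := fun i => [set nth v [:: s_ a; s_ c; s_ b; s_ e; v; s_ r1; s_ r2; s_ r3] i])).
  apply: family_points => //.
    rewrite -[X in uniq X]/[seq nth v (v :: map s_ (q ++ [:: r1; r2; r3])) i | i <- [:: 1; 3; 2; 4; 0; 5; 6; 7]].
    have lt8 : all (fun i => i < 8) [:: 1; 3; 2; 4; 0; 5; 6; 7] by [].
    rewrite map_inj_in_uniq // => i j /(allP lt8) i8 /(allP lt8) j8 /eqP.
    by rewrite nth_uniq // => /eqP.
  have sy x y : adj x y -> adj y x by rewrite adj_sym.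
  by move=> [|[|[|[|[|[|[|[|i]]]]]]]] [|[|[|[|[|[|[|[|j]]]]]]]] //= _ _ _ _;
    auto using qr, rr, vs, sy, q7, r7.
move: H; rewrite (negbTE nall) => /and3P[_ /allP dcyc /hasP[[i0 j0] ij0 /andP[/= i0q j0q]]].
have fill K i j : conn (@adj G) K -> K \subset far v -> has_pair (cyc q) i j ->
    touch (@adj G) [set s_ i] K -> touch (@adj G) [set s_ j] K -> False.
  move=> cK KO ij ti tj; have [iq jq] := andP (cycP ij).
  have iX : s_ i \in att v K by rewrite inE ti nth_nb_in // d7 q7.
  have jX : s_ j \in att v K by rewrite inE tj nth_nb_in // d7 q7.
  have hF := cycF gq ij.
  case/orP: ij => /dcyc /= dd.
    exact: (fill_dir cK KO hF iX jX dd).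
  by apply: (fill_dir cK KO _ jX iX dd); rewrite /has_pair orbC.
pose Yl := [:: v; s_ r1; s_ r2; s_ r3]; pose Y := [set x in Yl].
have uYl : uniq Yl.
  rewrite -[Yl]/(v :: map s_ [:: r1; r2; r3]) cons_uniq map_inj_in_uniq => [|i j /r7 i7 /r7 j7]; last exact: s_inj.
  by rewrite ur andbT; apply/mapP => -[i /r7/vn /eqP].
have cY : #|Y| = 4 by rewrite cardsE (card_uniqP uYl).
have YF : v \in Y /\ forall i, i \in [:: r1; r2; r3] -> s_ i \in Y.
  split=> [|i]; first by rewrite inE /Yl inE eqxx.
  by rewrite inE /Yl !inE => /or3P[] /eqP ->; rewrite eqxx ?orbT.
have {YF} [vY rY] := YF.
have YP x : x \in Y -> x = v \/ exists2 i, i \in [:: r1; r2; r3] & x = s_ i.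
  rewrite inE /Yl inE => /orP[/eqP ->|]; first by left.
  by rewrite !inE => /or3P[] /eqP ->; right; [exists r1|exists r2|exists r3].
have nqY i : i \in q -> s_ i \notin Y.
  move=> iq; apply/negP => /YP[|[j jr]].
    by move/esym/eqP; apply/negP/vn/q7.
  by move/(s_inj _ _ (q7 _ iq) (r7 _ jr)) => E; have := nqr i iq; rewrite E jr.
have nbF x : x \in nb v -> exists2 i, (i \in q) || (i \in [:: r1; r2; r3]) & x = s_ i.
  by move/nb_nth => [i]; rewrite d7 => /er ii ->; exists i.
have farY x : x \in far v -> x \notin Y.
  rewrite farP => /andP[xv vx]; apply/negP => /YP[E|[i /r7/vs h E]]; first by rewrite E eqxx in xv.
  by rewrite E h in vx.
have farq x i : x \in far v -> i \in q -> x != s_ i.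
  by rewrite farP => /andP[_ vx] /q7/vs h; apply: contraNneq vx => ->.
pose ac := [set s_ a; s_ c].
pose P x := [exists K : {set G}, [&& conn (@adj G) K, K \subset far v, x \in K & touch (@adj G) ac K]].
have PP x : reflect (exists K : {set G}, [/\ conn (@adj G) K, K \subset far v, x \in K & touch (@adj G) ac K]) (P x).
  by apply: (iffP existsP) => -[K h]; exists K; [case/and4P: h|apply/and4P].
(* [S] collects [a], [c] and what they reach outside the closed neighbourhood; by [fill] none of
   this touches [b] or [e]. *)
pose S := [set x | (x \in ac) || P x]; pose T := ~: (S :|: Y).
have Pfar x : P x -> x \in far v by case/PP => K [_ /subsetP KO /KO].
have acq x : x \in ac -> exists2 i, i \in [:: a; c] & x = s_ i.
  by rewrite !inE => /orP[] /eqP ->; [exists a|exists c]; rewrite ?inE ?eqxx ?orbT.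
have ac_q i : i \in [:: a; c] -> i \in q by rewrite !inE => /orP[] ->; rewrite ?orbT.
have dSY : [disjoint S & Y].
  rewrite disjoints_subset; apply/subsetP => x; rewrite in_setC inE => /orP[/acq[i /ac_q iq ->]|/Pfar/farY //].
  exact: nqY.
have be_ac i j : i \in [:: a; c] -> j \in [:: b; e] -> has_pair (cyc q) i j.
  by rewrite !inE => /orP[]/eqP -> /orP[]/eqP ->; rewrite /has_pair /cyc /= !inE !(eqxx, orbT).
have be_q i : i \in [:: b; e] -> i \in q by rewrite !inE => /orP[] ->; rewrite ?orbT.
have beT i : i \in [:: b; e] -> s_ i \in T.
  move=> ib; rewrite in_setC in_setU negb_or nqY ?be_q // andbT inE negb_or; apply/andP; split; last first.
    apply/negP => /Pfar; rewrite farP => /andP[_ /negP]; apply; exact/vs/q7/be_q.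
  apply/negP => /acq[j ja] /(s_inj _ _ (q7 _ (be_q _ ib)) (q7 _ (ac_q _ ja))) E; subst j.
  have := be_ac _ _ ja ib; move/(cycF gq); rewrite has_pairF eqxx //.
(* In [Y] only pairs among [r1], [r2], [r3] can be non-adjacent. Giving one cycle vertex to [r1] and
   another to [r2] repairs all three, as cycle vertices are adjacent to every [r]. *)
pose ext (p r : nat) (y : G) : {set G} :=
  if y == s_ r1 then [set y; s_ p] else if y == s_ r2 then [set y; s_ r] else [set y].
have side (p r : nat) (U : {set G}) : p \in q -> r \in q -> p != r -> s_ p \in U -> s_ r \in U ->
    cliquable Y (ext p r) U.
  move=> pq rq' pr pU rU; pose cc := ext p r; rewrite -/cc.
  have self y : y \in cc y by rewrite /cc /ext; case: ifP => _; [|case: ifP => _]; rewrite !inE eqxx.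
  have n12 : s_ r1 != s_ r2 by move: uYl; rewrite /= !inE !negb_or => /and3P[_ /andP[]].
  have n13 : s_ r1 != s_ r3 by move: uYl; rewrite /= !inE !negb_or => /and3P[_ /andP[]].
  have n23 : s_ r2 != s_ r3 by move: uYl; rewrite /= !inE !negb_or => /and4P[].
  have ccP y x : x \in cc y -> [\/ x = y, x = s_ p /\ y = s_ r1 | x = s_ r /\ y = s_ r2].
    rewrite /cc /ext; case: eqP => [->|_]; [|case: eqP => [->|_]]; rewrite !inE.
    - by case/orP => /eqP ->; [apply: Or31|apply: Or32].
    - by case/orP => /eqP ->; [apply: Or31|apply: Or33].
    - by move/eqP; apply: Or31.
  split=> [y yY|y z x yY zY|].
  - rewrite self /cc /ext; case: eqP => [->|_]; [|case: eqP => [->|_]]; split=> //.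
    + by apply: conn2; [apply: asym | rewrite adj_sym qr].
    + by apply/subsetP => x; rewrite !inE => /orP[] /eqP ->; rewrite ?eqxx ?pU ?orbT.
    + by apply: conn2; [apply: asym | rewrite adj_sym qr].
    + by apply/subsetP => x; rewrite !inE => /orP[] /eqP ->; rewrite ?eqxx ?rU ?orbT.
    + exact: conn1.
    + exact: subsetUl.
  - have nY i : i \in q -> forall w, w \in Y -> s_ i <> w by move=> iq w wY E; have := nqY i iq; rewrite E wY.
    have npr : s_ p <> s_ r by move/(s_inj _ _ (q7 _ pq) (q7 _ rq')) => E; rewrite E eqxx in pr.
    case/ccP => [->|[-> E]|[-> E]] /ccP [E'|[E' E2]|[E' E2]] //; try by [case: (nY _ pq _ zY)|case: (nY _ rq' _ zY)].
    + by case: (nY _ pq _ yY).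
    + by case: (nY _ rq' _ yY).
    + by rewrite E E2.
    + by case: npr.
    + by rewrite E E2.
  have ts y z : touch (@adj G) (cc y) (cc z) = touch (@adj G) (cc z) (cc y).
    by rewrite touch_sym //; apply: asym.
  have tv i : i \in [:: r1; r2; r3] -> touch (@adj G) (cc v) (cc (s_ i)).
    by move=> ir; apply/touchP; exists v, (s_ i); rewrite !self vs ?r7.
  have c1 : s_ p \in cc (s_ r1) by rewrite /cc /ext eqxx !inE eqxx orbT.
  have c2 : s_ r \in cc (s_ r2) by rewrite /cc /ext eq_sym (negbTE n12) eqxx !inE eqxx orbT.
  have t12 : touch (@adj G) (cc (s_ r1)) (cc (s_ r2)) by apply/touchP; exists (s_ p), (s_ r2); rewrite c1 self qr.
  have t13 : touch (@adj G) (cc (s_ r1)) (cc (s_ r3)) by apply/touchP; exists (s_ p), (s_ r3); rewrite c1 self qr.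
  have t23 : touch (@adj G) (cc (s_ r2)) (cc (s_ r3)) by apply/touchP; exists (s_ r), (s_ r3); rewrite c2 self qr.
  move=> y z /YP[->|[i ir ->]] /YP[->|[j jr ->]] ; rewrite ?eqxx //.
  + by move=> _; apply: tv.
  + by move=> _; rewrite ts; apply: tv.
  move: ir jr; rewrite !inE => /or3P[] /eqP -> /or3P[] /eqP ->; rewrite ?eqxx // 1?ts //.
have ac_ne : a != c by move: uq; rewrite /= !inE !negb_or => /and4P[/and3P[]].
have be_ne : b != e by move: uq; rewrite /= !inE !negb_or => /and4P[_ /andP[]].
have aS : s_ a \in S by rewrite !inE eqxx.
have cS : s_ c \in S by rewrite !inE eqxx orbT.
have bT : s_ b \in T by apply: beT; rewrite !inE eqxx.
have eT : s_ e \in T by apply: beT; rewrite !inE eqxx orbT.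
apply: (@cut S Y T _ _ _ dSY _ _ _ _ _ (side a c S aq ccq ac_ne aS cS) (side b e T bq eq be_ne bT eT)).
- by rewrite disjoints_subset setCK subsetUl.
- by rewrite disjoints_subset setCK subsetUr.
- by rewrite setUCr.
- by apply/set0Pn; exists (s_ a).
- by apply/set0Pn; exists (s_ b).
- move=> x y xS yT; apply/negP => xy.
  have yT' : y \in far v \/ exists2 i, i \in [:: b; e] & y = s_ i.
    have [yf|nyf] := boolP (y \in far v); [by left|right; move: nyf].
    have /andP[yS yY] : (y \notin S) && (y \notin Y) by move: yT; rewrite in_setC in_setU negb_or.
    rewrite farP negb_and !negbK => /orP[/eqP E|]; first by rewrite E vY in yY.
    rewrite -nbE => /nbF[i]; case/orP => [iq|ir] E; last by rewrite E rY in yY.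
    by exists i => //; move: iq yS; rewrite E !inE !negb_or => /or4P[] /eqP ->; rewrite !(eqxx, orbT, andbF).
  have nyP : ~ P y.
    by move=> Py; move: yT; rewrite in_setC in_setU inE Py orbT.
  move: xS; rewrite inE => /orP[xac|/PP[K [cK KO xK tK]]].
    case: yT' => [yf|[j jb E]].
      apply: nyP; apply/PP; exists [set y]; rewrite conn1 sub1set yf inE eqxx; split=> //.
      by apply/touchP; exists x, y; rewrite inE.
    have [i ia E'] := acq _ xac; have := cycF gq (be_ac _ _ ia jb).
    by rewrite has_pairF -E -E' xy !andbF.
  case: yT' => [yf|[j jb E]].
    apply: nyP; apply/PP; exists (y |: K); split.
    + exact: (connU1 (@asym G) cK xK xy).
    + by rewrite subUset sub1set yf.
    + exact: setU11.
    + by apply: touchS tK => //; apply: subsetUr.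
  case/touchP: tK => z [w [/acq[i ia ->] wK zw]].
  apply: (fill K i j cK KO (be_ac _ _ ia jb)).
    by apply/touchP; exists (s_ i), w; rewrite inE.
  by apply/touchP; exists (s_ j), x; rewrite inE eqxx -E adj_sym.
- by rewrite cY.
(* The pair of [F] off the cycle lies in [Y], so [Y] is not complete and the equality case of [cut]
   is excluded. *)
- move=> _; move: ij0; rewrite mem_F d7 => /andP[/andP[ij0 j7] nij].
  have ir : i0 \in [:: r1; r2; r3] by have := er i0 (ltn_trans ij0 j7); rewrite (negbTE i0q).
  have jr : j0 \in [:: r1; r2; r3] by have := er j0 j7; rewrite (negbTE j0q).
  have := ein_lt (rY _ ir) (rY _ jr) _ nij; rewrite cY; apply.
  by apply/eqP => /(s_inj _ _ (r7 _ ir) (r7 _ jr)) E; rewrite E ltnn in ij0.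
Qed.

End AtV.

Lemma deg6 v : #|nb v| = 6 -> False.
Proof.
move=> d6; have sd : size (enum (nb v)) = 6 by rewrite -cardE.
have cl : classify6 (non_adj v).
  rewrite /non_adj sd; apply: en_correct; first exact: en6.
  have := @deg_F _ v 1; rewrite /non_adj sd; apply => i id; have : adj v (nth_nb v i).
    by apply: nth_nb_adj; rewrite sd.
  by move/few_nonnb; rewrite d6.
have dP F : direct6 F -> exists g, check7 (size (enum (nb v))).+1 (cone F) g by rewrite sd; apply: direct6P.
case/orP: cl => [|/and3P[F1 dF nF]]; first exact: (not_direct dP).
have [/set0Pn[x xO]|/negPn/eqP O0] := boolP (far v != set0).
  by apply: (type_iv dP xO dF); rewrite sd.
have cG : #|G| = 7.
  by rewrite -cardsT -setC0 -O0 setCK cardsU1 nb_irr d6.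
by have := size_F v; move: hd; rewrite cG; lia.
Qed.

Lemma deg7 v : #|nb v| = 7 -> False.
Proof.
move=> d7; have sd : size (enum (nb v)) = 7 by rewrite -cardE.
have cl : classify7 (non_adj v).
  rewrite /non_adj sd; apply: en_correct; first exact: en7.
  have := @deg_F _ v 2; rewrite /non_adj sd; apply => i id; have : adj v (nth_nb v i).
    by apply: nth_nb_adj; rewrite sd.
  by move/few_nonnb; rewrite d7.
have dP F : direct7 F -> exists g, check7 (size (enum (nb v))).+1 (cone F) g by rewrite sd; apply: direct7P.
have O4 : 4 < size (non_adj v) -> exists x, x \in far v.
  move=> F1; apply/set0Pn; apply/eqP => O0.
  have cG : #|G| = 8 by rewrite -cardsT -setC0 -O0 setCK cardsU1 nb_irr d7.
  by have := size_F v; move: hd; rewrite cG; lia.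
move: cl; rewrite /classify7; case: ifP => [/(not_direct dP) //|_].
case: ifP => [|_ /and3P[/O4[x xO] dF nF]]; last by apply: (type_iv dP xO dF); rewrite sd.
rewrite someE => /hasP[q qq]; case: ifP => // gq cq _.
have [a [b [c [e qE]]]] : exists a b c e, q = [:: a; b; c; e].
  case/flattenP: qq => L /mapP[r _ ->]; case: r => [|a [|b [|c [|e []]]]] //; rewrite !inE.
  by case/or3P => /eqP ->; do 4 eexists.
subst q; apply: (cycle_dir dP sd gq); exact: cq.
Qed.

(** For degree 5 the bound of [few_nonnb] is zero. *)
Lemma deg5_clique v x y : #|nb v| = 5 -> x \in v |: nb v -> y \in v |: nb v -> x != y -> adj x y.
Proof.
rewrite !in_setU1 !nbE => d5 /orP[/eqP ->|vx] /orP[/eqP ->|vy] xy //; first by rewrite eqxx in xy.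
  by rewrite adj_sym.
have := few_nonnb vx; rewrite d5 leqn0 cards_eq0 => /eqP /setP/(_ y).
by rewrite !inE vy andbT eq_sym (negbTE xy) /= => /negbFE.
Qed.

(** [K] passes between [S] and [T] only through [y]. A part without [y] therefore has its exit edge
    on the same side; a part with [y] is treated through its complement. *)
Lemma conn_side (e : rel G) K S T y : symmetric e -> conn e K -> y \in K -> K \subset y |: (S :|: T) ->
  (forall s t, s \in S -> t \in T -> ~~ e s t) -> conn e (y |: (K :&: S)).
Proof.
move=> se /connP[K0 H] yK KST nST; apply/connP; split; first by apply/set0Pn; exists y; rewrite setU11.
set L := y |: _; have LK : L \subset K by rewrite subUset sub1set yK subsetIl.
have out B : B \subset L -> B != set0 -> y \notin B -> exists a b, [/\ a \in B, b \in L, b \notin B & e a b].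
  move=> BL B0 yB; have [|a [b [aB bK bB ab]]] := H B (subset_trans BL LK) B0.
    by apply: contraNneq yB => ->.
  exists a, b; split=> //; have := subsetP KST b bK; rewrite !in_setU1 in_setI bK in_setU.
  case/or3P => [->//|->|bT]; rewrite ?orbT //.
  have := subsetP BL a aB; rewrite in_setU1 in_setI => /orP[/eqP E|/andP[_ aS]].
    by rewrite -E aB in yB.
  by have := nST a b aS bT; rewrite ab.
move=> B BL B0 BnL; have [yB|yB] := boolP (y \in B); last exact: out.
have [|||a [b [aB bL bB ab]]] := out (L :\: B); rewrite ?subsetDl //.
- by rewrite setD_eq0; apply: contra BnL => LB; rewrite eqEsubset BL.
- by rewrite inE yB.
exists b, a; move: aB bB; rewrite !in_setD bL andbT negbK => /andP[nab aL] bB.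
by split=> //; rewrite se.
Qed.

(* N[v] is a K_6, and the part of the graph behind a 4-clique of N[v] contains
   another vertex of degree 5; link the two K_6's by Menger's theorem. *)
Lemma deg5 v : #|nb v| = 5 -> False.
Proof.
move=> d5; have cl x y := @deg5_clique v x y d5.
have [x xO] : exists x, x \in far v.
  apply/set0Pn; apply/eqP => O0; have := card_ge7.
  by rewrite -cardsT -setC0 -O0 setCK cardsU1 nb_irr d5.
have [K [cK KO xK clK]] := comp_far xO.
set X := att v K; have Xn : X \subset nb v by apply/subsetP => y /attP[]; rewrite nbE.
have cX y z : y \in X -> z \in X -> y != z -> adj y z.
  by move=> /(subsetP Xn) yn /(subsetP Xn) zn; apply: cl; rewrite in_setU1 ?yn ?zn orbT.
have [X3|X4] := leqP #|X| 3; first by apply: (clique_cut (conn0 cK) KO clK cX X3).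
have nXK y : y \in X -> y \notin K.
  by move=> /attP[vy _]; apply/negP => /(subsetP KO); rewrite farP vy andbF.
have vK : v \notin K by apply/negP => /(subsetP KO); rewrite farP eqxx.
have := subset_leq_card Xn; rewrite d5 leq_eqVlt ltnS => /orP[/eqP X5|Xle].
  have XE : X = nb v by apply/eqP; rewrite eqEcard Xn d5 X5.
  have sd : size (enum (nb v)) = 5 by rewrite -cardE.
  have sn i : i < 5 -> nth_nb v i \in nb v by move=> i5; apply: nth_nb_in; rewrite sd.
  pose M i j := (i < j) && (1 < j).
  pose W i := if i is i'.+1 then (if i' is k.+1 then [set nth_nb v k] else K) else [set v].
  (* All five neighbours are attached to [K], so contracting [K] gives a K_7 in which only [v] and
     [K] may be non-adjacent. *)
  apply: noK; apply: (@family_K7 7 M G W (iota 0 7)); last by vm_compute.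
  have nK i : i < 5 -> nth_nb v i \notin K by move/sn; rewrite -XE; apply: nXK.
  have nv i : i < 5 -> nth_nb v i <> v by move=> i5 E; have := sn i i5; rewrite E (negbTE (nb_irr v)).
  split.
  - by move=> [|[|i]] _ //=; apply: conn1.
  - move=> [|[|i]] [|[|j]] y //=; rewrite ?ltnS ?inE => iL jL.
    + by move/eqP ->; rewrite (negbTE vK).
    + by move/eqP -> => /eqP /esym /(nv _ jL).
    + by move=> yK /eqP E; rewrite -E yK in vK.
    + by move=> yK /eqP E; have := nK _ jL; rewrite -E yK.
    + by move/eqP -> => /eqP /(nv _ iL).
    + by move/eqP ->; rewrite (negbTE (nK _ iL)).
    + by move/eqP -> => /eqP E; rewrite (@nth_nb_inj G v i j) // sd.
  - move=> [|[|i]] [|[|j]] //= iL jL ij _.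
    + by apply/touchP; exists v, (nth_nb v j); split; rewrite ?inE // -nbE sn.
    + have := sn j jL; rewrite -XE => /attP[_ [y yK xy]].
      by apply/touchP; exists y, (nth_nb v j); rewrite inE adj_sym.
    + apply/touchP; exists (nth_nb v i), (nth_nb v j); rewrite !inE; split=> //; apply: cX; rewrite ?XE ?sn //.
      by apply/eqP => /nth_nb_inj E; case: ij; rewrite E // sd.
have {Xle} X4 : #|X| = 4 by apply/eqP; rewrite eqn_leq X4 Xle.
have [w wn wX] : exists2 w, w \in nb v & w \notin X.
  by apply/subsetPn; apply/negP => /subset_leq_card; rewrite d5 X4.
pose Z := K :|: X.
have nbK y : y \in K -> nb y \subset Z.
  move=> yK; apply/subsetP => z; rewrite nbE in_setU => yz.
  have [zO|] := boolP (z \in far v); first by rewrite (clK y z).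
  rewrite farP negb_and !negbK => /orP[/eqP E|vz].
    by have := subsetP KO y yK; rewrite farP -E adj_sym yz andbF.
  by apply/orP; right; apply/attP; split=> //; exists y; rewrite // adj_sym.
have dKX : [disjoint X & K] by rewrite disjoints_subset; apply/subsetP => y /nXK; rewrite in_setC.
have cZ : #|Z| = #|K| + 4.
  by rewrite cardsU setIC; move: dKX; rewrite -setI_eq0 => /eqP ->; rewrite cards0 subn0 X4.
have vZ : v \notin Z by rewrite in_setU negb_or vK; apply/attP => -[]; rewrite adj_irrefl.
have wZ : w \notin Z.
  rewrite in_setU negb_or wX andbT; apply/negP => /(subsetP KO); rewrite farP -nbE wn andbF //.
(* If all degrees in [K] were at least 8, then [ein Z Z] would be at least 8k + 4 + 12 with k =
   [#|K|], where 4 comes from the edges between [X] and [K] and 12 from the clique [X]. Minimality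
   allows only 8(k + 4) - 18. *)
have [v' v'K v'7] : exists2 v', v' \in K & #|nb v'| <= 7.
  have [/exists_inP //|/exists_inPn H] := boolP [exists x in K, #|nb x| <= 7].
  have eK : 8 * #|K| <= ein K Z.
    rewrite einE mulnC -sum_nat_const; apply: leq_sum => y yK.
    by rewrite (setIidPl (nbK y yK)) ltnNge H.
  have eX : 4 <= ein X K.
    rewrite -X4 einE -sum1_card; apply: leq_sum => y /attP[_ [z zK yz]].
    by rewrite card_gt0; apply/set0Pn; exists z; rewrite inE nbE yz.
  have eXX : ein X X = 12 by rewrite ein_clique // X4.
  have : ein Z Z + 18 <= 8 * #|Z|.
    apply: induced_bd => //; rewrite cZ; have := proper_card (_ : Z \proper [set: G]).
    rewrite cardsT cZ => -> //; first lia.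
    by rewrite properT; apply: contraNneq vZ => ->; rewrite inE.
  rewrite {1}/Z einUl 1?disjoint_sym // [ein X Z]einUr 1?disjoint_sym // eXX cZ; lia.
have d5' : #|nb v'| = 5.
  have := mindeg v'; case: (ltngtP #|nb v'| 5) v'7 => // h1 h2 _.
  have [E|E] : #|nb v'| = 6 \/ #|nb v'| = 7 by move: h1 h2; clear; lia.
    by case: (deg6 E).
  by case: (deg7 E).
pose B := v' |: nb v'; have cB : #|B| = 6 by rewrite cardsU1 nb_irr d5'.
have clB y z : y \in B -> z \in B -> y != z -> adj y z by apply: deg5_clique.
have BZ : B \subset Z by rewrite subUset sub1set in_setU v'K nbK.
have XZ : X \subset Z by apply: subsetUr.
pose e := [rel y z | [&& y \in Z, z \in Z & @adj G y z]].
have se : symmetric e by move=> y z /=; rewrite adj_sym andbCA.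
have ea A : conn e A -> conn (@adj G) A by apply: conn_mono => y z _ _ /and3P[].
have eZ A : conn e A -> meets A Z -> A \subset Z.
  move=> cA /meetsP[y yA yZ]; apply: (conn_sub (U := setT) cA _ yA yZ) => //.
  by move=> z t _ _ /and3P[].
have [Y [c [sep lk]]] := menger X B se.
case: lk => lk dc.
have cZs y : y \in Y -> c y \subset Z.
  by move=> /lk[c1 _ c3 _]; apply: eZ => //; move: c3; rewrite !(meetsC (c y)); apply: meetsS.
have YZ y : y \in Y -> y \in Z by move=> yY; have [_ h _ _] := lk y yY; apply: (subsetP (cZs y yY)).
have [Y4 _] : #|Y| <= #|X| /\ _ := hit_card (fun y h => (let: And4 _ _ a _ := lk y h in a)) dc.
rewrite X4 leq_eqVlt ltnS in Y4; case/orP: Y4 => [/eqP Y4|Y3].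
  pose good y (T : {set G}) := [&& T \subset c y, conn e T, meets T X & #|T :&: B| == 1].
  have exT y : y \in Y -> exists T, good y T.
    move=> /lk[c1 _ c3 c4]; have [T [b [T1 T2 T3 T4 _]]] := conn_trim se c1 c3 c4.
    by exists T; rewrite /good T1 T2 /meets T3 T4 cards1.
  pose t y : {set G} := odflt set0 [pick T | good y T].
  have tP y : y \in Y -> [/\ t y \subset c y, conn e (t y), meets (t y) X & #|t y :&: B| = 1].
    move=> /exT[T gT]; rewrite /t; case: pickP => [T' /and4P[? ? ? /eqP ?] //|/(_ T)].
    by rewrite gT.
  pose U := \bigcup_(y in Y) (t y :&: B).
  have cU : #|U| <= 4.
    apply: (@leq_trans (\sum_(y in Y) 1)); last by rewrite sum1_card Y4.
    rewrite /U; elim/big_rec2: _ => [|y D m yY le]; first by rewrite cards0.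
    apply: leq_trans (leq_card_setU _ _) _; by have [_ _ _ ->] := tP y yY; rewrite leq_add2l.
  have /card_gt1P[u1 [u2 [u1U u2U u12]]] : 1 < #|B :\: U|.
    have := cardsD B U; have := subset_leq_card (subsetIr B U); move: cB cU; clear; lia.
  have nu u y : u \in B :\: U -> y \in Y -> u \notin t y.
    rewrite in_setD => /andP[uU uB] yY; apply: contra uU => ut; apply/bigcupP; exists y => //.
    by rewrite in_setI ut.
  have uB u : u \in B :\: U -> u \in B by rewrite in_setD => /andP[].
  have sY : size (enum Y) = 4 by rewrite -cardE.
  pose y_ i := nth v (enum Y) i.
  have yY i : i < 4 -> y_ i \in Y by move=> i4; rewrite -mem_enum mem_nth // sY.
  have yi i j : i < 4 -> j < 4 -> y_ i = y_ j -> i = j.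
    by move=> i4 j4 /eqP; rewrite nth_uniq ?enum_uniq ?sY // => /eqP.
  pose W i := if i is k.+4 then t (y_ k) else [set nth v [:: v; w; u1; u2] i].
  have tZ i x' : i < 4 -> x' \in t (y_ i) -> x' \in Z.
    by move=> /yY h; have [/subsetP s _ _ _] := tP _ h; move/s; apply: (subsetP (cZs _ h)).
  have tB i : i < 4 -> exists2 b, b \in t (y_ i) & b \in B.
    move=> /yY h; have [_ _ _ /eqP/cards1P[b bE]] := tP _ h; exists b;
    by have := set11 b; rewrite -bE inE => /andP[].
  have tX i : i < 4 -> exists2 b, b \in t (y_ i) & b \in X.
    by move=> /yY h; have [_ _ /meetsP[b bt bX] _] := tP _ h; exists b.
  have disj i j z : i < 4 -> j < 4 -> z \in t (y_ i) -> z \in t (y_ j) -> i = j.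
    move=> i4 j4 zi zj; apply: (yi _ _ i4 j4); apply: (dc _ _ z); rewrite ?yY //.
      by have [/subsetP s _ _ _] := tP _ (yY i i4); apply: s.
    by have [/subsetP s _ _ _] := tP _ (yY j j4); apply: s.
  have vw : v <> w by move=> E; have := wn; rewrite -E (negbTE (nb_irr v)).
  have tv i : i < 4 -> touch (@adj G) [set v] (t (y_ i)).
    by move/tX => [b bt /(subsetP Xn)]; rewrite nbE => vb; apply/touchP; exists v, b; rewrite inE.
  have tw i : i < 4 -> touch (@adj G) [set w] (t (y_ i)).
    move/tX => [b bt bX]; apply/touchP; exists w, b; rewrite inE; split=> //.
    apply: cl; rewrite ?in_setU1 ?wn ?orbT // ?(subsetP Xn _ bX) ?orbT //.
    by apply: contraNneq wX => ->.
  have tu u i : u \in B :\: U -> i < 4 -> touch (@adj G) [set u] (t (y_ i)).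
    move=> uu i4; have [b bt bB] := tB i i4; apply/touchP; exists u, b; rewrite inE; split=> //.
    apply: clB (uB _ uu) bB _; apply: contraTneq bt => <-; apply: nu => //; exact: yY.
  apply: noD; apply: (@family_mm 8 dmat G W); split.
  - move=> [|[|[|[|i]]]] //= i8; try exact: conn1.
    by apply: ea; have [] := tP _ (yY i i8).
  - have inj4 i j z : i < 4 -> j < 4 -> z = nth v [:: v; w; u1; u2] i -> z = nth v [:: v; w; u1; u2] j -> i = j.
      have uu : uniq [:: v; w; u1; u2].
        have inZ z' : z' \in B :\: U -> z' \in Z by move/uB/(subsetP BZ).
        rewrite /= !inE !negb_or u12 andbT; apply/andP; split; [apply/and3P; split|apply/andP; split].
        - exact/eqP.
        - by apply: contraNneq vZ => ->; apply: inZ.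
        - by apply: contraNneq vZ => ->; apply: inZ.
        - by apply/andP; split; apply: contraNneq wZ => ->; apply: inZ.
        - by [].
      by move=> i4 j4 -> /eqP; rewrite nth_uniq // => /eqP.
    have nt i k z : i < 4 -> k < 4 -> z \in [set nth v [:: v; w; u1; u2] i] -> z \in t (y_ k) -> False.
      move=> i4 k4; rewrite inE => /eqP ->; case: i i4 => [|[|[|[|i]]]] //= _.
      - by move/(tZ _ _ k4); apply/negP.
      - by move/(tZ _ _ k4); apply/negP.
      - by apply/negP/nu; rewrite ?yY.
      - by apply/negP/nu; rewrite ?yY.
    have W4 i : i < 4 -> W i = [set nth v [:: v; w; u1; u2] i] by case: i => [|[|[|[|i]]]].
    move=> i j z; case: (ltnP i 4) => [i4|]; case: (ltnP j 4) => [j4|].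
    + by rewrite !W4 // !inE => _ _ /eqP zi /eqP zj; apply: (inj4 _ _ z).
    + by rewrite (W4 i i4); case: j => [|[|[|[|j]]]] //= _ _ j8 zi zj; case: (nt _ _ _ i4 j8 zi zj).
    + by rewrite (W4 j j4); case: i => [|[|[|[|i]]]] //= _ i8 _ zi zj; case: (nt _ _ _ j4 i8 zj zi).
    + case: i => [|[|[|[|i]]]] //; case: j => [|[|[|[|j]]]] //= _ _ i8 j8 zi zj.
      by rewrite (disj i j z).
  move=> [|[|[|[|i]]]] [|[|[|[|j]]]] //= i8 j8 ij _; do ?[exact: tv|exact: tw|exact: tu].
  - by apply/touchP; exists v, w; rewrite !inE; split=> //; rewrite -nbE.
  - by apply/touchP; exists u1, u2; rewrite !inE; split=> //; apply: clB; rewrite ?uB.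
  - have [b bt bB] := tB i i8; have [b' bt' bB'] := tB j j8; apply/touchP; exists b, b'; split=> //.
    by apply: clB => //; apply/eqP => E; case: ij; rewrite (disj i j b) // E.
(* With at most three linking sets, [Y] is a forbidden cut, [S] being what [B] reaches in [Z] off
   [Y]. The linking sets end in the cliques [B] and [X], which makes [Y] complete from either
   side. *)
pose P z := [exists L : {set G}, [&& conn e L, [disjoint L & Y], meets L B & z \in L]].
have PP z : reflect (exists L : {set G}, [/\ conn e L, [disjoint L & Y], meets L B & z \in L]) (P z).
  by apply: (iffP existsP) => -[L h]; exists L; [case/and4P: h|apply/and4P].
pose S := [set z | P z]; pose T := ~: (S :|: Y).
have SZ z : z \in S -> z \in Z.
  rewrite inE => /PP[L [L1 _ L3 zL]]; apply: subsetP zL; apply: eZ => //.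
  by rewrite meetsC; rewrite meetsC in L3; apply: meetsS L3.
have SB z : z \in B -> z \notin Y -> z \in S.
  move=> zB zY; rewrite inE; apply/PP; exists [set z]; rewrite conn1 inE eqxx disjoints1; split=> //.
  by apply/meetsP; exists z; [apply: set11|].
have SX z : z \in X -> z \notin S.
  move=> zX; rewrite inE; apply/PP => -[L [L1 L2 L3 zL]].
  have LX : meets L X by apply/meetsP; exists z.
  by have := sep L L1 LX L3; rewrite /meets L2.
have vT : v \in T.
  rewrite in_setC in_setU negb_or; apply/andP; split; first by apply: contra vZ; apply: SZ.
  by apply: contra vZ; apply: YZ.
have [b bB bY] : exists2 b, b \in B & b \notin Y.
  by apply/subsetPn; apply/negP => /subset_leq_card; rewrite cB; move: Y3; clear; lia.
have nST x' y : x' \in S -> y \in T -> ~~ adj x' y.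
  move=> xS; rewrite in_setC in_setU negb_or => /andP[yS yY]; apply/negP => xy.
  have [xK'|xK'] := boolP (x' \in K); last first.
    by have := SZ _ xS; rewrite in_setU (negbTE xK') /= => /SX; rewrite xS.
  have yZ : y \in Z by apply: (subsetP (nbK _ xK')); rewrite nbE.
  move: (xS); rewrite inE => /PP[L [L1 L2 L3 xL]]; case/negP: yS; rewrite inE; apply/PP.
  exists (y |: L); split; last exact: setU11.
  - by apply: (connU1 se L1 xL); rewrite /= (SZ _ xS) yZ.
  - by rewrite -setI_eq0 setIUl setU_eq0 !setI_eq0 L2 andbT disjoints1.
  - by apply: meetsS L3; apply: subsetUr.
have nSTe x' y : x' \in S -> y \in T -> ~~ e x' y.
  by move=> xS yT; apply/negP => /and3P[_ _]; apply/negP/nST.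
have nTSe x' y : x' \in T -> y \in S -> ~~ e x' y.
  move=> xT yS; apply/negP => /and3P[xZ yZ xy].
  by have := nSTe y x' yS xT; rewrite /= xZ yZ adj_sym xy.
have cST y : y \in Y -> c y \subset y |: (S :|: T).
  move=> yY; apply/subsetP => z zc; rewrite in_setU1 in_setU in_setC in_setU.
  have [zY|] := boolP (z \in Y); last by case: (z \in S); rewrite ?orbT.
  have [_ zz _ _] := lk z zY.
  by rewrite (dc z y z zY yY zz zc) eqxx.
apply: (@cut S Y T (fun y => y |: (c y :&: S)) (fun y => y |: (c y :&: T))).
- by rewrite disjoints_subset setCK subsetUl.
- rewrite disjoints_subset; apply/subsetP => z; rewrite in_setC inE => /PP[L [_ L2 _ zL]].
  by have /pred0P/(_ z) := L2; rewrite /= zL /= => ->.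
- by rewrite disjoints_subset setCK subsetUr.
- by rewrite setUCr.
- by apply/set0Pn; exists b; apply: SB.
- by apply/set0Pn; exists v.
- exact: nST.
- have sub y : y \in Y -> y |: (c y :&: S) \subset c y.
    by move=> yY; have [_ yc _ _] := lk y yY; rewrite subUset sub1set yc subsetIl.
  split=> [y yY|y z x' yY zY xy xz|y z yY zY yz].
  + have [cy yc _ _] := lk y yY; rewrite setU11 setUS ?subsetIr //; split=> //.
    by apply: ea; apply: (conn_side se cy yc (cST y yY)).
  + by apply: (dc _ _ x' yY zY); [apply: (subsetP (sub y yY))|apply: (subsetP (sub z zY))].
  have hit y' : y' \in Y -> exists2 r, r \in y' |: (c y' :&: S) & r \in B.
    move=> yY'; have [_ _ _ /meetsP[r rc rB]] := lk y' yY'; exists r => //.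
    rewrite in_setU1 in_setI rc /=; have [rY|rY] := boolP (r \in Y); last by rewrite SB ?orbT.
    by have [_ rr _ _] := lk r rY; rewrite (dc r y' r rY yY' rr rc) eqxx.
  have [r r1 rB] := hit y yY; have [r' r1' rB'] := hit z zY.
  apply/touchP; exists r, r'; split=> //; apply: clB => //; apply: contraNneq yz => E.
  by apply/eqP; apply: (dc _ _ r yY zY); [apply: (subsetP (sub y yY))|apply: (subsetP (sub z zY)); rewrite E].
- have sub y : y \in Y -> y |: (c y :&: T) \subset c y.
    by move=> yY; have [_ yc _ _] := lk y yY; rewrite subUset sub1set yc subsetIl.
  split=> [y yY|y z x' yY zY xy xz|y z yY zY yz].
  + have [cy yc _ _] := lk y yY; rewrite setU11 setUS ?subsetIr //; split=> //.
    by apply: ea; apply: (conn_side se cy yc _ nTSe); rewrite (setUC T) cST.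
  + by apply: (dc _ _ x' yY zY); [apply: (subsetP (sub y yY))|apply: (subsetP (sub z zY))].
  have hit y' : y' \in Y -> exists2 r, r \in y' |: (c y' :&: T) & r \in X.
    move=> yY'; have [_ _ /meetsP[r rc rX] _] := lk y' yY'; exists r => //.
    rewrite in_setU1 in_setI rc /= in_setC in_setU (negbTE (SX _ rX)) /=.
    have [rY|rY] := boolP (r \in Y); last by rewrite orbT.
    by have [_ rr _ _] := lk r rY; rewrite (dc r y' r rY yY' rr rc) eqxx.
  have [r r1 rB] := hit y yY; have [r' r1' rB'] := hit z zY.
  apply/touchP; exists r, r'; split=> //; apply: cX => //; apply: contraNneq yz => E.
  by apply/eqP; apply: (dc _ _ r yY zY); [apply: (subsetP (sub y yY))|apply: (subsetP (sub z zY)); rewrite E].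
- exact: leq_trans Y3 _.
- by move=> E; rewrite E in Y3.
Qed.

Lemma critical_false : False.
Proof.
have [v v7] : exists v, #|nb v| <= 7.
  have [/existsP //|/existsPn H] := boolP [exists v : G, #|nb v| <= 7].
  have : 8 * #|G| <= ein [set: G] [set: G].
    rewrite einE mulnC -cardsT -sum_nat_const; apply: leq_sum => y _.
    by rewrite setIT ltnNge H.
  by rewrite einT; move: hd; clear; lia.
have := mindeg v; case: (ltngtP #|nb v| 5) => // [h1 _|/deg5 //].
have [E|E] : #|nb v| = 6 \/ #|nb v| = 7 by move: h1 v7; clear; lia.
  by case: (deg6 E).
by case: (deg7 E).
Qed.
End Critical.

(** * The extremal theorem *)

Lemma mm_del_edges (G : sgraph) (D : {set {set G}}) : mm (del_edges D) G.
Proof.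
apply: (@mm_sets (@del_edges G D) G (fun x => [set x])) => [x|x y z|x y].
- exact: conn1.
- by rewrite !inE => /eqP -> /eqP.
by move=> /andP[xy _]; apply/touchP; exists x, y; rewrite !inE.
Qed.

Lemma edges_del_edges (G : sgraph) (D : {set {set G}}) : edges (@del_edges G D) = edges G :\: D.
Proof.
apply/setP => s; rewrite in_setD; apply/imsetP/andP => [[p]|[sD /imsetP[p]]].
  by rewrite inE => /andP[pa pD] ->; split=> //; apply: imset_f; rewrite inE.
by rewrite inE => pa E; exists p; rewrite // inE /= /del_edges_adj pa -E.
Qed.

Lemma subset_of_card (T : finType) (A : {set T}) k : k <= #|A| -> exists2 D : {set T}, D \subset A & #|D| = k.
Proof.
move=> kA; exists [set x in take k (enum A)].
  by apply/subsetP => x; rewrite inE => /mem_take; rewrite mem_enum.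
by rewrite cardsE (card_uniqP _) ?take_uniq ?enum_uniq // size_takel // -cardE.
Qed.

(** Deleting surplus edges makes the count exactly 4n - 8. A smaller minor violating [bd] has one of
    the two minors by induction, and passes it on to the graph. *)
Theorem extremal (G : sgraph) : 3 <= #|G| -> 4 * #|G| <= #|edges G| + 8 -> mm K7eq G \/ mm Dg G.
Proof.
have [n] := ubnP #|G|; elim: n G => // n IH G; rewrite ltnS => Gn n3 eG.
have [|D DE cD] := @subset_of_card _ (edges G) (#|edges G| + 8 - 4 * #|G|); first by lia.
pose H := @del_edges G D.
have eH : #|edges H| + 8 = 4 * #|G|.
  suff : #|edges G :\: D| + 8 = 4 * #|G| by rewrite -edges_del_edges.
  by rewrite cardsD (setIidPr DE) cD; lia.
have [K|nK] := classic (mm K7eq H); first by left; apply: mm_trans K (mm_del_edges D).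
have [K|nD] := classic (mm Dg H); first by right; apply: mm_trans K (mm_del_edges D).
case: (@critical_false H) => // [|A W R mA /andP[A3 AH] RP].
  have cH : #|H| = #|G| by [].
  by rewrite darts_edge cH; move: eH; clear; lia.
rewrite leqNgt; apply/negP => lt.
have := qg_darts RP; rewrite darts_edge => R2.
have [|||K|K] := IH (qg A W); rewrite ?card_qg //.
- exact: leq_trans AH Gn.
- by move: R2 lt; clear; lia.
- by apply: nK; apply: mm_trans K (qg_mm mA).
- by apply: nD; apply: mm_trans K (qg_mm mA).
Qed.

(** * The automaton of pushes *)

Definition prs5 := pairs 5.
Definition prs4 := pairs 4.
Definition op i j : nat * nat := if i < j then (i, j) else (j, i).

(* [gam]: adjacent pairs among five paths; [lab]: labels of their heads; [pr]:
   the two paths whose heads share a label; [tht]: adjacent pairs of labels. *)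
Definition st := (seq (nat * nat) * seq nat * (nat * nat) * seq (nat * nat))%type.
Definition gam (s : st) := s.1.1.1.
Definition lab (s : st) := s.1.1.2.
Definition pr (s : st) := s.1.2.
Definition tht (s : st) := s.2.

Definition add prs (E g : seq (nat * nat)) := [seq p <- prs | (p \in g) || (p \in E)].
Definition others i j := [seq c <- iota 0 5 | (c != i) && (c != j)].

(** Path [al] will be absorbed by its a-set and path [bb.1] by its b-set; of the three other paths,
    [c] must be adjacent to the remaining two. *)
Definition success (s : st) :=
  some (fun al => some (fun bb : nat * nat => if al == bb.1 then false else
    some (fun c => all (fun c' => (c' == c) || (op c c' \in gam s)) (others al bb.1)) (others al bb.1))
  [:: pr s; ((pr s).2, (pr s).1)]) [:: 0; 1].

(* The head of path mv, labelled d, is replaced by a neighbour with label l,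
   which is adjacent to the heads of the paths in nbr and to the head labelled l. *)
Definition step (s : st) mv l (nbr : seq nat) : st :=
  let h := index l (lab s) in
  (add prs5 (op mv h :: [seq op mv c | c <- nbr]) (gam s),
   set_nth 0 (lab s) mv l, op mv h,
   add prs4 (op l (nth 0 (lab s) mv) :: [seq op l (nth 0 (lab s) c) | c <- nbr]) (tht s)).

Fixpoint sublists (T : Type) (s : seq T) :=
  if s is x :: s' then let r := sublists s' in [seq x :: t | t <- r] ++ r else [:: [::]].

Lemma mem_sublists (T : eqType) (P : pred T) s : filter P s \in sublists s.
Proof.
elim: s => //= x s IH; rewrite mem_cat; case: (P x); last by rewrite IH orbT.
by rewrite map_f ?IH.
Qed.

Definition trans (s : st) : seq st :=
  flatten [seq flatten [seq [seq step s mv l nbr | nbr <- sublists (others mv (index l (lab s)))]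
    | l <- iota 0 4 & l != nth 0 (lab s) mv] | mv <- [:: (pr s).1; (pr s).2]].

(** The label carried by two heads is numbered 0, and these heads end paths 0 and 1. *)
Definition lab0 := [:: 0; 0; 1; 2; 3].
Definition init g : st :=
  (g, lab0, (0, 1), [seq t <- prs4 | has (fun p => op (nth 0 lab0 p.1) (nth 0 lab0 p.2) == t) g]).
Definition inits := [seq init ((0, 1) :: g) | g <- sublists (behead prs5)].

(** A trie with digits 0 to 4 for the visited states; [key] puts together the states that [dom] can
    compare. *)
Inductive tree := Leaf | Node (x : seq st) (c0 c1 c2 c3 c4 : tree).

Fixpoint tget (k : seq nat) t {struct t} := if t is Node x c0 c1 c2 c3 c4 then
  match k with
  | [::] => x
  | 0 :: k' => tget k' c0 | 1 :: k' => tget k' c1 | 2 :: k' => tget k' c2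
  | 3 :: k' => tget k' c3 | _ :: k' => tget k' c4
  end else [::].

Fixpoint tadd (k : seq nat) s t := let: (x, c0, c1, c2, c3, c4) :=
    if t is Node x c0 c1 c2 c3 c4 then (x, c0, c1, c2, c3, c4) else ([::], Leaf, Leaf, Leaf, Leaf, Leaf) in
  match k with
  | [::] => Node (s :: x) c0 c1 c2 c3 c4
  | 0 :: k' => Node x (tadd k' s c0) c1 c2 c3 c4
  | 1 :: k' => Node x c0 (tadd k' s c1) c2 c3 c4
  | 2 :: k' => Node x c0 c1 (tadd k' s c2) c3 c4
  | 3 :: k' => Node x c0 c1 c2 (tadd k' s c3) c4
  | _ :: k' => Node x c0 c1 c2 c3 (tadd k' s c4)
  end.

Fixpoint tall (f : st -> bool) t := if t is Node x c0 c1 c2 c3 c4 then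
  [&& all f x, tall f c0, tall f c1, tall f c2, tall f c3 & tall f c4] else true.

Lemma tallP f t k s : tall f t -> s \in tget k t -> f s.
Proof.
elim: t k => //= x c0 I0 c1 I1 c2 I2 c3 I3 c4 I4 k /and5P[fx h0 h1 h2 /andP[h3 h4]].
case: k => [|[|[|[|[|n]]]] k] /=; [|exact: (I0 _ h0)|exact: (I1 _ h1)|exact: (I2 _ h2)|exact: (I3 _ h3)|exact: (I4 _ h4)].
exact: (allP fx).
Qed.

Definition key (s : st) := (pr s).1 :: (pr s).2 :: lab s.

Fixpoint sub (g g' : seq (nat * nat)) := if g is p :: h then (if p \in g' then sub h g' else false) else true.

Lemma subP g g' : sub g g' -> {subset g <= g'}.
Proof.
elim: g => //= p g IH; case: ifP => // pg /IH sg x; rewrite inE => /orP[/eqP -> //|]; exact: sg.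
Qed.

Lemma subP' g g' : {subset g <= g'} -> sub g g'.
Proof.
elim: g => //= p g IH sg; rewrite sg ?mem_head //; apply: IH => x xg.
by apply: sg; rewrite inE xg orbT.
Qed.

(* Whatever is described by s is also described by r, so s need not be kept. *)
Definition dom (r s : st) := if lab r == lab s then if pr r == pr s then
  if sub (gam r) (gam s) then sub (tht s) (tht r) else false else false else false.

Definition known R s := some (fun r => dom r s) (tget (key s) R).

Definition visit acc s := let: (R, new) := acc in
  if success s then acc else if known R s then acc else (tadd (key s) s R, s :: new).

Fixpoint bfs n R new := if n is n'.+1 then
  (if new is [::] then R else
  let: (R', new') := foldl (fun acc s => foldl visit acc (trans s)) (R, [::]) new in bfs n' R' new') else R.

(** The number 40 is fuel for the search; that it has closed is certified afterwards by
    [invariant]. *)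
Definition reached := let: (R, new) := foldl visit (Leaf, [::]) (rev inits) in bfs 40 R new.

Definition invariant R := [&& all (fun s => if success s then true else known R s) inits,
  tall (fun s => all (fun t => if success t then true else known R t) (trans s)) R &
  tall (fun s => ~~ sub prs4 (tht s)) R].

Lemma reached_ok : invariant reached.
Proof. vm_cast_no_check (erefl true). Qed.

Lemma opC i j : op i j = op j i.
Proof. by rewrite /op; case: (ltngtP i j) => [||->]. Qed.

Lemma op_prs n i j : i < n -> j < n -> i != j -> op i j \in pairs n.
Proof.
move=> iL jL ij; rewrite /op; case: (ltngtP i j) ij => // ltij _.
  by apply/allpairsPdep; exists i, j; rewrite !mem_iota; split=> //; move: iL jL ltij; clear; lia.
by apply/allpairsPdep; exists j, i; rewrite !mem_iota; split=> //; move: iL jL ltij; clear; lia.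
Qed.

Lemma mem_add p prs E g : (p \in add prs E g) = ((p \in g) || (p \in E)) && (p \in prs).
Proof. by rewrite mem_filter. Qed.

Lemma mem_others i j c : (c \in others i j) = [&& c != i, c != j & c < 5].
Proof. by rewrite mem_filter mem_iota -andbA. Qed.

Lemma trans_mem s mv l P : mv = (pr s).1 \/ mv = (pr s).2 -> l < 4 -> l != nth 0 (lab s) mv ->
  step s mv l [seq c <- others mv (index l (lab s)) | P c] \in trans s.
Proof.
move=> hm l4 ln; apply/flatten_mapP; exists mv.
  by case: hm => E; rewrite !inE -E eqxx ?orbT.
apply/flatten_mapP; exists l; first by rewrite mem_filter ln mem_iota.
by apply: map_f; apply: mem_sublists.
Qed.

(* The 9-vertex pattern: 0, 1 are the two a-sets, 2 and 3 the b-sets matched to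
   paths be and be', and 4 + i is path i. *)
Definition pat (E : seq (nat * nat)) be be' i j :=
  if j <= i then false else if j < 2 then true else if j < 4 then (i == 2)
  else let c := j - 4 in
  if i < 2 then (1 < c) || (c == i) else if i == 2 then c != be' else if i == 3 then c != be
  else (i - 4, c) \in E.

Definition fin_edges al be be' c := [:: (0, 1), op be be' & [seq op c c' | c' <- others al be & c' != c]].

(** In K7eq, 5 is the a-set [al] with path [al], 6 the b-set matched to [be] with path [be], and 4
    is path [c]. The other a-set and b-set are 0 and 1, the last two paths 2 and 3: these are the
    two missing edges. The pairs in [fin_edges] make up for the contacts that [pat] does not grant
    between a path and an a- or b-set. *)
Definition fin_map al be c := let D := [seq c' <- others al be | c' != c] in
  [seq (if k == al then 5 else 0) | k <- [:: 0; 1]] ++ [:: 6; 1] ++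
  [seq (if j == al then 5 else if j == be then 6 else if j == c then 4 else 2 + index j D) | j <- iota 0 5].

Lemma fin_check al be be' c : al < 2 -> be < 5 -> be' < 5 -> al != be -> be != be' -> c \in others al be ->
  check7 9 (pat (fin_edges al be be' c) be be') (fin_map al be c).
Proof.
have H : all (fun al => all (fun be => all (fun be' => (al != be) && (be != be') ==>
    all (fun c => check7 9 (pat (fin_edges al be be' c) be be') (fin_map al be c)) (others al be))
    (iota 0 5)) (iota 0 5)) (iota 0 2) by vm_compute.
have io n k : k < n -> k \in iota 0 n by rewrite mem_iota.
move=> /io al2 /io be5 /io be'5 ab bb cD.
have := allP (allP (allP H al al2) be be5) be' be'5.
by rewrite ab bb => /allP; apply.
Qed.

Lemma successP s : success s -> exists al be be' c, [/\ al < 2, al != be, (be, be') = pr s \/ (be', be) = pr s,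
  c \in others al be & forall c', c' \in others al be -> c' != c -> op c c' \in gam s].
Proof.
rewrite /success someE => /hasP[al al2]; rewrite someE => /hasP[[be be'] bb /=].
case: eqP => // /eqP ab; rewrite someE => /hasP[c cD /allP cP]; exists al, be, be', c; split=> //.
- by move: al2; rewrite !inE => /orP[]/eqP ->.
- move: bb; rewrite !inE => /orP[]/eqP E; [by left|right].
  by case: E => -> ->; case: (pr s).
by move=> c' /cP /orP[->|].
Qed.

(** * Boundaries *)

Section Boundary.
Variable G : sgraph.
Implicit Types (S X : {set G}) (x y p : G).

Lemma boundaryP S x : reflect (x \notin S /\ exists2 y, y \in S & adj x y) (x \in boundary S).
Proof.
rewrite !inE; apply: (iffP andP) => -[xS]; first by case/exists_inP => y yS xy; split=> //; exists y.
by case=> y yS xy; split=> //; apply/exists_inP; exists y.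
Qed.

Lemma boundary_in S x y : y \in S -> adj x y -> (x \in S) || (x \in boundary S).
Proof. by move=> yS xy; case: (boolP (x \in S)) => //= xS; apply/boundaryP; split=> //; exists y. Qed.

(** Submodularity is proved vertex by vertex, so that equality of the cardinalities gives back
    equality at every vertex. *)
Lemma boundary_submod S X p : (p \in boundary (S :&: X)) + (p \in boundary (S :|: X)) <=
  (p \in boundary S) + (p \in boundary X).
Proof.
have cap : p \in boundary (S :&: X) -> (p \notin S \/ p \notin X) /\
    (p \in S) || (p \in boundary S) /\ (p \in X) || (p \in boundary X).
  move=> /boundaryP[pSX [y]]; rewrite inE => /andP[yS yX] py; split; last by split; apply: boundary_in py.
  by move: pSX; rewrite inE negb_and => /orP.
have cup : p \in boundary (S :|: X) -> [/\ p \notin S, p \notin X & (p \in boundary S) || (p \in boundary X)].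
  move=> /boundaryP[pSX [y]]; move: pSX; rewrite !inE negb_or => /andP[pS pX] yU py; rewrite pS pX; split=> //.
  by case/orP: yU => yU; apply/orP; [left|right]; apply/exists_inP; exists y.
have nS : p \in boundary S -> p \notin S by case/boundaryP.
have nX : p \in boundary X -> p \notin X by case/boundaryP.
case: (boolP (p \in boundary (S :&: X))) => [/cap[o [s x]]|_];
  case: (boolP (p \in boundary (S :|: X))) => [/cup[pS pX u]|_] //.
- by move: s x; rewrite (negbTE pS) (negbTE pX) /= => -> ->.
- case: o => [pS|pX]; first by move: s; rewrite (negbTE pS) /= => ->.
  by move: x; rewrite (negbTE pX) /= => ->; rewrite addn1.
- by case/orP: u => ->; rewrite ?addn1.
Qed.

Lemma card_sum (T : finType) (A : {set T}) : #|A| = \sum_x (x \in A).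
Proof. by rewrite -sum1_card big_mkcond. Qed.

Lemma boundary_submod_card S X :
  #|boundary (S :&: X)| + #|boundary (S :|: X)| <= #|boundary S| + #|boundary X|.
Proof. by rewrite !card_sum -!big_split; apply: leq_sum => p _; apply: boundary_submod. Qed.

Lemma boundary_submod_eq S X :
  #|boundary S| + #|boundary X| <= #|boundary (S :&: X)| + #|boundary (S :|: X)| ->
  forall p, (p \in boundary (S :&: X)) + (p \in boundary (S :|: X)) = (p \in boundary S) + (p \in boundary X).
Proof.
move=> H p; apply/eqP; rewrite eqn_leq boundary_submod leqNgt; apply/negP => lt; move: H.
rewrite !card_sum -!big_split /= leqNgt => /negP[].
rewrite (bigD1 p) //= [X in _ < X](bigD1 p) //= -addSn; apply: leq_add => //.
by apply: leq_sum => q _; apply: boundary_submod.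
Qed.
End Boundary.

(** * Critical sets and the chain from the a's to the b's *)

Section Core.
Variables (G : sgraph) (a1 a2 b1 b2 : G) (lam : G -> 'I_4).
Implicit Types (S X : {set G}) (x y p q : G).

Definition zv x := x \notin [:: a1; a2; b1; b2].
Definition Z (i : 'I_4) : {set G} := [set x | zv x && (lam x == i)].
Definition good S := [&& a1 \in S, a2 \in S, b1 \notin S :|: boundary S & b2 \notin S :|: boundary S].
Definition crit S := good S && (#|boundary S| == 5).

Hypothesis Hu : uniq [:: a1; a2; b1; b2].
Hypothesis Haa : adj a1 a2.
Hypothesis Hbb : adj b1 b2.
Hypothesis Hab : forall a b, a \in [:: a1; a2] -> b \in [:: b1; b2] -> ~~ adj a b.
Hypothesis Zconn : forall i, conn (@adj G) (Z i).
Hypothesis Ztouch : forall i j, i != j -> touch (@adj G) (Z i) (Z j).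
Hypothesis Znb : forall c i, c \in [:: a1; a2; b1; b2] -> touch (@adj G) [set c] (Z i).
(* Otherwise the edge xy can be contracted. *)
Hypothesis tight : forall x y, zv x -> zv y -> lam x = lam y -> adj x y ->
  exists S, [/\ crit S, x \in boundary S & y \in boundary S].
Hypothesis noS : forall S, good S -> 5 <= #|boundary S|.

Definition bb b := b \in [:: b1; b2].
Definition aa a := a \in [:: a1; a2].

Lemma aaE a : aa a = (a == a1) || (a == a2). Proof. by rewrite /aa !inE. Qed.
Lemma bbE b : bb b = (b == b1) || (b == b2). Proof. by rewrite /bb !inE. Qed.

Lemma goodP S : reflect ((forall a, aa a -> a \in S) /\ (forall b, bb b -> b \notin S /\ b \notin boundary S)) (good S).
Proof.
apply: (iffP and4P) => [[h1 h2 h3 h4]|[ha hb]].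
  split=> [a|b]; rewrite ?aaE ?bbE => /orP[]/eqP -> //.
  - by move: h3; rewrite in_setU negb_or => /andP[].
  - by move: h4; rewrite in_setU negb_or => /andP[].
have [b11 b12] := hb b1 (mem_head _ _); have [|b21 b22] := hb b2; first by rewrite bbE eqxx orbT.
by split; rewrite ?in_setU ?negb_or ?b11 ?b21 //; apply: ha; rewrite aaE eqxx ?orbT.
Qed.

Lemma aa_or_bb x : zv x = ~~ aa x && ~~ bb x.
Proof. by rewrite /zv /aa /bb !inE !negb_or -!andbA. Qed.

Lemma ZP x i : (x \in Z i) = zv x && (lam x == i). Proof. by rewrite inE. Qed.

Lemma nbZ c i : ~~ zv c -> exists2 x, x \in Z i & adj c x.
Proof.
rewrite negbK => cc; have /touchP[c' [x [/set1P -> xZ cx]]] := Znb i cc; by exists x.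
Qed.

Lemma bb_nz b : bb b -> ~~ zv b. Proof. by rewrite aa_or_bb => ->; rewrite andbF. Qed.
Lemma aa_nz b : aa b -> ~~ zv b. Proof. by rewrite aa_or_bb => ->. Qed.
Lemma bb1 : bb b1. Proof. exact: mem_head. Qed.

Lemma good_boundary_zv S x : good S -> x \in boundary S -> zv x.
Proof.
move=> /goodP[ha hb] xN; rewrite aa_or_bb; apply/andP; split; apply/negP => h.
  by have /boundaryP[] := xN; rewrite ha.
by have [_] := hb x h; rewrite xN.
Qed.

Lemma good_out S b x : good S -> bb b -> adj b x -> x \notin S.
Proof.
move=> /goodP[_ hb] h bx; apply/negP => xS; have [n1 n2] := hb b h.
by have := boundary_in xS bx; rewrite (negbTE n1) (negbTE n2).
Qed.

(** [Z i] contains a neighbour of [a1], in [S] or on its boundary, and a neighbour of [b1], outside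
    [S]. So a boundary carries all four labels. *)
Lemma good_hit S i : good S -> exists2 x, x \in boundary S & x \in Z i.
Proof.
move=> gS; have [y yZ by_] := nbZ i (bb_nz bb1); have yS := good_out gS bb1 by_.
have [x xZ ax] : exists2 x, x \in Z i & adj a1 x by apply: nbZ; rewrite /zv mem_head.
have a1S : a1 \in S by have /goodP[h _] := gS; apply: h; apply: mem_head.
have [xS|xS] := boolP (x \in S); last first.
  by exists x => //; apply/boundaryP; split=> //; exists a1; rewrite // adj_sym.
have /connP[_ H] := Zconn i; have [|||u [w [+ wZ + uw]]] := H (Z i :&: S).
- exact: subsetIl.
- by apply/set0Pn; exists x; rewrite in_setI xZ.
- by apply/eqP => E; move: yZ; rewrite -E in_setI (negbTE yS) andbF.
rewrite !in_setI wZ => /andP[_ uS] /= wS; exists w => //; apply/boundaryP; split=> //.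
by exists u; rewrite // adj_sym.
Qed.

(** Union and intersection are good again, so [noS] gives each at least five boundary vertices, and
    submodularity holds with equality. *)
Lemma crit_UI S X : crit S -> crit X -> [/\ crit (S :&: X), crit (S :|: X) &
  forall p, (p \in boundary (S :&: X)) + (p \in boundary (S :|: X)) = (p \in boundary S) + (p \in boundary X)].
Proof.
move=> /andP[gS /eqP S5] /andP[gX /eqP X5].
have [/goodP[Sa Sb] /goodP[Xa Xb]] := (gS, gX).
have gI : good (S :&: X).
  apply/goodP; split=> [a h|b h]; first by rewrite in_setI Sa ?Xa.
  have [s1 s2] := Sb b h; rewrite in_setI (negbTE s1); split=> //.
  apply/boundaryP => -[_ [y]]; rewrite in_setI => /andP[yS _] by_.
  by have := good_out gS h by_; rewrite yS.
have gU : good (S :|: X).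
  apply/goodP; split=> [a h|b h]; first by rewrite in_setU Sa.
  have [s1 s2] := Sb b h; have [x1 x2] := Xb b h; rewrite in_setU negb_or s1 x1; split=> //.
  apply/boundaryP => -[_ [y]]; rewrite in_setU => /orP[yS|yS] by_.
    by have := good_out gS h by_; rewrite yS.
  by have := good_out gX h by_; rewrite yS.
have := boundary_submod_card S X; have := noS gI; have := noS gU; rewrite S5 X5 => u5 i5 le.
have [eI eU] : #|boundary (S :&: X)| = 5 /\ #|boundary (S :|: X)| = 5 by move: u5 i5 le; clear; lia.
split; rewrite /crit ?gI ?gU ?eI ?eU //.
by apply: boundary_submod_eq; rewrite S5 X5 eI eU.
Qed.

Definition S0 : {set G} := [set a1; a2].

Lemma good0 : good S0.
Proof.
apply/goodP; split=> [a|b h]; first by rewrite /aa !inE.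
have nb : b \notin S0.
  move: Hu h; rewrite /= /bb !inE !negb_or => /and4P[/and3P[_ n1 n2] /andP[n3 n4] _ _] /orP[]/eqP ->;
  by rewrite ![_ == a1]eq_sym ![_ == a2]eq_sym ?n1 ?n2 ?n3 ?n4.
split=> //; apply/boundaryP => -[_ [y yS by_]].
have /Hab/(_ h) : y \in [:: a1; a2] by move: yS; rewrite !inE.
by rewrite adj_sym by_.
Qed.

(* An edge leaving a minimal critical set inside a branch set would be crossed by
   another critical set. *)
Lemma crit0 : crit S0.
Proof.
have [S cS] : exists S, crit S.
  (* Without critical sets [tight] leaves no edge inside a branch set, so each is a single vertex
     and the boundary of [S0] has at most four. *)
  have [/existsP //|/existsPn nS] := boolP [exists S : {set G}, crit S].
  have inj : {in boundary S0 &, injective lam}.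
    move=> x y /(good_boundary_zv good0) zx /(good_boundary_zv good0) zy E; apply/eqP/negPn/negP => xy.
    have xZ : x \in Z (lam x) by rewrite ZP zx eqxx.
    have yZ : y \in Z (lam x) by rewrite ZP zy E eqxx.
    have [|w wZ /andP[wx xw]] := conn_edge (Zconn (lam x)) xZ.
      by apply: contraNneq xy => E'; move: yZ; rewrite E' inE eq_sym.
    move: wZ; rewrite ZP => /andP[zw /eqP lw].
    by have [S [cS _ _]] := tight zx zw (esym lw) xw; have := nS S; rewrite cS.
  have := noS good0; rewrite -(card_in_imset inj) leqNgt => /negP[].
  by apply: leq_ltn_trans (max_card _) _; rewrite card_ord.
case: (@arg_minnP _ S crit (fun S => #|S|) cS) => {cS}S cS min.
suff -> : S0 = S by [].
have gS : good S by case/andP: cS.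
have /goodP[Sa Sb] := gS.
apply/eqP; rewrite eqEsubset; apply/andP; split.
  by apply/subsetP => x; rewrite !inE => /orP[]/eqP ->; apply: Sa; rewrite aaE eqxx ?orbT.
apply/subsetP => x xS; apply/negPn/negP => x0.
have zx : zv x.
  rewrite aa_or_bb; apply/andP; split; last by apply/negP => /Sb[]; rewrite xS.
  by apply: contra x0; rewrite /aa !inE.
have [y yZ by_] := nbZ (lam x) (bb_nz bb1); have yS := good_out gS bb1 by_.
have /connP[_ H] := Zconn (lam x); have [|||u [w [+ wZ + uw]]] := H (Z (lam x) :&: S).
- exact: subsetIl.
- by apply/set0Pn; exists x; rewrite in_setI xS ZP zx eqxx.
- by apply/eqP => E; move: yZ; rewrite -E in_setI (negbTE yS) andbF.
rewrite !in_setI wZ => /andP[uZ uS] /= wS.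
move: uZ wZ; rewrite !ZP => /andP[zu /eqP lu] /andP[zw /eqP lw].
have [X [cX uX wX]] := tight zu zw (etrans lu (esym lw)) uw.
have [cI _ _] := crit_UI cS cX; have := min _ cI.
have [nuX _] := boundaryP _ _ uX.
rewrite leqNgt => /negP[]; apply: proper_card; apply/properP; split; first exact: subsetIl.
by exists u; rewrite // in_setI (negbTE nuX) andbF.
Qed.

Lemma pair_exists S : crit S -> exists p p', [/\ p \in boundary S, p' \in boundary S, p != p' & lam p = lam p'].
Proof.
move=> /andP[_ /eqP S5].
have [inj|] := boolP [forall p in boundary S, forall p' in boundary S, (lam p == lam p') ==> (p == p')].
  have : #|boundary S| <= 4.
    rewrite -(card_in_imset (f := lam)); first by apply: leq_trans (max_card _) _; rewrite card_ord.
    by move=> p p' pN pN' E; apply/eqP; move/forall_inP/(_ p pN)/forall_inP/(_ p' pN'): inj; rewrite E eqxx.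
  by rewrite S5.
case/forall_inPn => p pN /forall_inPn[p' pN']; rewrite negb_imply => /andP[/eqP E n].
by exists p, p'.
Qed.

(** When a member of a pair is removed, the other four boundary vertices still carry all four
    labels, each exactly once. So every pair contains every member of every other. *)
Lemma pair_uniq S p p' r r' : crit S -> p \in boundary S -> p' \in boundary S -> p != p' -> lam p = lam p' ->
  r \in boundary S -> r' \in boundary S -> r != r' -> lam r = lam r' -> (r = p /\ r' = p') \/ (r = p' /\ r' = p).
Proof.
move=> /andP[gS /eqP S5].
have key p0 p0' r0 r0' : p0 \in boundary S -> p0' \in boundary S -> p0 != p0' -> lam p0 = lam p0' ->
    r0 \in boundary S -> r0' \in boundary S -> r0 != r0' -> lam r0 = lam r0' -> p0 = r0 \/ p0 = r0'.
  move=> pN pN' pp lp rN rN' rr lr.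
  have c4 : #|boundary S :\ p0| = 4 by have := cardsD1 p0 (boundary S); rewrite pN S5 => -[].
  have im : lam @: (boundary S :\ p0) = setT.
    apply/setP => i; rewrite in_setT; have [x xN] := good_hit i gS; rewrite ZP => /andP[_ /eqP xi].
    apply/imsetP; have [E|xp] := eqVneq x p0; last by exists x; rewrite // in_setD1 xp.
    by exists p0'; rewrite ?in_setD1 ?pN' 1?eq_sym ?pp // -lp -E.
  have /imset_injP inj : #|lam @: (boundary S :\ p0)| == #|boundary S :\ p0| by rewrite im cardsT card_ord c4.
  have [->|n1] := eqVneq p0 r0; first by left.
  have [->|n2] := eqVneq p0 r0'; first by right.
  case/eqP: rr; apply: inj => //; rewrite in_setD1 ?rN ?rN' eq_sym ?n1 ?n2 //.
move=> pN pN' pp lp rN rN' rr lr.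
have pp2 : p' != p by rewrite eq_sym.
have [E1|E1] := key _ _ _ _ pN pN' pp lp rN rN' rr lr;
have [E2|E2] := key _ _ _ _ pN' pN pp2 (esym lp) rN rN' rr lr; subst; auto.
- by rewrite eqxx in pp.
- by rewrite eqxx in pp.
Qed.

(** Connectivity of what remains of each branch set provides the edges to which [tight] is
    applied. *)
Definition inv S := forall i, conn (@adj G) (Z i :\: S).

Lemma inv0 : inv S0.
Proof.
move=> i; rewrite (_ : Z i :\: S0 = Z i) //; apply/setDidPl.
rewrite disjoints_subset; apply/subsetP => x; rewrite ZP in_setC => /andP[zx _].
by apply: contraTN zx => h; apply: aa_nz; move: h; rewrite /aa !inE.
Qed.

(* Let S' be a minimal critical set above S.  Equality in submodularity shows that
   any edge of a branch set between S' - S and the rest joins the pair of S. *)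
Lemma step_exists S t : crit S -> inv S -> zv t -> t \notin S -> t \notin boundary S ->
  exists p p' q, [/\ p \in boundary S, p' \in boundary S, p != p', lam p = lam p' & adj p p'] /\
   [/\ zv q, q \notin S, q \notin boundary S, adj p q & lam q != lam p] /\
   [/\ crit (p |: S), inv (p |: S) & boundary (p |: S) = q |: (boundary S :\ p)].
Proof.
move=> cS iS zt tS tN; have gS : good S by case/andP: cS.
have tZ : t \in Z (lam t) by rewrite ZP zt eqxx.
(* What remains of the branch set of [t] contains an edge from a vertex beyond the boundary to a
   boundary vertex. The critical set for this edge is not contained in [S], so the union is
   larger. *)
have [S1 [cS1 sS1]] : exists S', crit S' /\ S \proper S'.
  have [x xN xZ] := good_hit (lam t) gS; have [xS _] := boundaryP _ _ xN.
  have /connP[_ H] := iS (lam t); have [|||u [w [+ + + uw]]] := H ((Z (lam t) :\: S) :\: boundary S).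
  - exact: subsetDl.
  - by apply/set0Pn; exists t; rewrite !in_setD tN tS.
  - by apply/eqP => /setP/(_ x); rewrite !in_setD xN xS xZ.
  rewrite !in_setD => /and3P[uN uS uZ] /andP[wS wZ]; rewrite wS wZ !andbT negbK => wN.
  move: uZ wZ; rewrite !ZP => /andP[zu /eqP lu] /andP[zw /eqP lw].
  have [X [cX uX wX]] := tight zu zw (etrans lu (esym lw)) uw.
  have [_ cU _] := crit_UI cS cX; exists (S :|: X); split=> //; rewrite properE subsetUl /=.
  apply/subsetPn; have [_ [y yX uy]] := boundaryP _ _ uX; exists y; first by rewrite in_setU yX orbT.
  by apply/negP => yS; have := boundary_in yS uy; rewrite (negbTE uS) (negbTE uN).
pose P S' := crit S' && (S \proper S').
have P1 : P S1 by rewrite /P cS1.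
case: (@arg_minnP _ S1 P (fun S => #|S|) P1) => {S1 cS1 sS1 P1}S' /andP[cS' sS'] min.
have sub : S \subset S' by apply: proper_sub.
have gS' : good S' by case/andP: cS'.
have E p q : zv p -> zv q -> lam p = lam q -> adj p q -> p \in S' -> p \notin S -> q \notin S ->
    p \in boundary S /\ q \in boundary S.
  move=> zp zq lpq pq pS' pS qS; have [X [cX pX qX]] := tight zp zq lpq pq.
  have [_ cSX eq1] := crit_UI cS cX; have [cM _ eq2] := crit_UI cSX cS'.
  have [npX _] := boundaryP _ _ pX; have [nqX _] := boundaryP _ _ qX.
  (* This intersection is critical, contains [S] and omits [p], so the minimality of [S']
     applies. *)
  have ES : (S :|: X) :&: S' = S.
    apply/eqP; apply/negPn/negP => ne.
    have SM : S \proper (S :|: X) :&: S' by rewrite properEneq eq_sym ne subsetI subsetUl sub.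
    have := min _ (introT andP (conj cM SM)); rewrite leqNgt => /negP[]; apply: proper_card.
    apply/properP; split; first exact: subsetIr.
    by exists p; rewrite // in_setI in_setU (negbTE pS) (negbTE npX).
  rewrite ES in eq2.
  have inU z : z \in boundary X -> z \notin S -> z \in boundary (S :|: X).
    move=> /boundaryP[zX [y yX zy]] zS; apply/boundaryP; rewrite in_setU negb_or zS zX; split=> //.
    by exists y; rewrite // in_setU yX orbT.
  have inB z : z \in S' -> z \notin S -> z \in boundary X -> z \in boundary S.
    move=> zS' zS zX; have := eq2 z; rewrite (inU z zX zS).
    have -> : (z \in boundary (S :|: X :|: S')) = false.
      by apply/boundaryP => -[]; rewrite in_setU zS' orbT.
    by case: (z \in boundary S).
  split; first exact: inB.
  have [qS'|qS'] := boolP (q \in S'); first exact: inB.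
  have := eq2 q; rewrite (inU q qX qS).
  have -> : q \in boundary S' by apply/boundaryP; split=> //; exists p; rewrite // adj_sym.
  by case: (q \in boundary S) => //; case: (_ \in _).
have zS' x : x \in S' -> x \notin S -> zv x.
  move=> xS' xS; rewrite aa_or_bb; apply/andP; split; apply/negP => h.
    by have /goodP[ha _] := gS; rewrite ha in xS.
  by have /goodP[_ /(_ x h)[]] := gS'; rewrite xS'.
have [_ [p pS' pS]] := properP sS'.
have zp := zS' p pS' pS; have pZ : p \in Z (lam p) :\: S by rewrite in_setD pS ZP zp eqxx.
have [w wZ bw] := nbZ (lam p) (bb_nz bb1).
have wS' := good_out gS' bb1 bw; have wS := good_out gS bb1 bw.
have wp : w != p by apply: contraNneq wS' => ->.
have [|p' + /andP[pp' app']] := conn_edge (iS (lam p)) pZ.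
  by apply: contraNneq wp => Ep; rewrite -in_set1 -Ep in_setD wS.
rewrite in_setD => /andP[p'S]; rewrite ZP => /andP[zp' /eqP lp'].
have [pN pN'] := E p p' zp zp' (esym lp') app' pS' pS p'S.
rewrite eq_sym in pp'.
have only x y : zv x -> zv y -> lam x = lam y -> adj x y -> x \in S' -> x \notin S -> y \notin S ->
    (x = p /\ y = p') \/ (x = p' /\ y = p).
  move=> zx zy lxy xy xS' xS yS; have [xN yN] := E x y zx zy lxy xy xS' xS yS.
  apply: (pair_uniq cS pN pN' pp' (esym lp') xN yN) => //.
  by apply: contraTneq xy => ->; rewrite adj_irrefl.
(* Otherwise [p] and [p'] would have no further neighbour in the rest of their branch set, although
   it is connected and contains the neighbour [w] of [b1]. *)
have p'S' : p' \notin S'.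
  apply/negP => p'S'; have /connP[_ H] := iS (lam p); have [|||u [y [+ + + uy]]] := H [set p; p'].
  - by rewrite subUset !sub1set pZ in_setD p'S ZP zp' lp' eqxx.
  - by apply/set0Pn; exists p; rewrite !inE eqxx.
  - apply/eqP => EL; have : w \in Z (lam p) :\: S by rewrite in_setD wS.
    by rewrite -EL in_set2 (negbTE wp) /= => /eqP Ew; rewrite Ew p'S' in wS'.
  rewrite in_setD ZP => up /andP[yS /andP[zy /eqP ly]] yp.
  have [zu lu uS' uS] : [/\ zv u, lam u = lam p, u \in S' & u \notin S].
    by move: up; rewrite !inE => /orP[]/eqP ->.
  have [] := only u y zu zy (etrans lu (esym ly)) uy uS' uS yS;
  by case=> _ Ey; move: yp; rewrite Ey !inE eqxx ?orbT.
have ES' : S' = p |: S.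
  apply/eqP; rewrite eqEsubset subUset sub1set pS' sub !andbT; apply/subsetP => x xS'.
  rewrite in_setU1; have [xS|xS] := boolP (x \in S); rewrite ?orbT ?orbF //.
  have zx := zS' x xS' xS; have xZ : x \in Z (lam x) :\: S by rewrite in_setD xS ZP zx eqxx.
  have [y yZ by_] := nbZ (lam x) (bb_nz bb1); have yS' := good_out gS' bb1 by_.
  have [|z + /andP[zx' xz]] := conn_edge (iS (lam x)) xZ.
    apply: contraNneq yS' => Ex; have : y \in Z (lam x) :\: S by rewrite in_setD yZ (good_out gS bb1 by_).
    by rewrite Ex inE => /eqP ->.
  rewrite in_setD ZP => /andP[zS /andP[zz /eqP lz]].
  have [] := only x z zx zz (esym lz) xz xS' xS zS; first by case=> ->; rewrite eqxx.
  by case=> Ex _; rewrite Ex (negbTE p'S') in xS'.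
rewrite {min sS' sub}ES' in cS' gS' E zS' pS' wS' only p'S'.
(* The boundary of [p |: S] again has five vertices but omits [p], so it has gained one. *)
have [q qN qS] : exists2 q, q \in boundary (p |: S) & q \notin boundary S.
  apply/subsetPn; apply/negP => sN; have : boundary (p |: S) \subset boundary S :\ p.
    apply/subsetP => x xN; rewrite in_setD1 (subsetP sN) // andbT.
    by have /boundaryP[+ _] := xN; rewrite in_setU1 negb_or => /andP[].
  move/subset_leq_card; have := cardsD1 p (boundary S); rewrite pN.
  by have /andP[_ /eqP ->] := cS; have /andP[_ /eqP ->] := cS'; clear; lia.
have [qpS [y yS' qy]] := boundaryP _ _ qN.
have [qp qnS] : q != p /\ q \notin S by move: qpS; rewrite in_setU1 negb_or => /andP[].
have Ey : y = p.
  move: yS'; rewrite in_setU1 => /orP[/eqP //|yS].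
  by have := boundary_in yS qy; rewrite (negbTE qnS) (negbTE qS).
rewrite {y yS'}Ey in qy.
have zq := good_boundary_zv gS' qN.
have lq : lam q != lam p.
  apply/eqP => lq; rewrite adj_sym in qy.
  have [[_ Eq]|[Ep _]] := only p q zp zq (esym lq) qy pS' pS qnS.
    by move: qS; rewrite Eq pN'.
  by rewrite Ep eqxx in pp'.
have Npq : boundary (p |: S) = q |: (boundary S :\ p).
  apply/esym/eqP; rewrite eqEcard; apply/andP; split.
    rewrite subUset sub1set qN; apply/subsetP => x; rewrite in_setD1 => /andP[xp /boundaryP[xS [y yS xy]]].
    by apply/boundaryP; rewrite in_setU1 negb_or xp xS; split=> //; exists y; rewrite // in_setU1 yS orbT.
  have := cardsD1 p (boundary S); rewrite pN cardsU1 in_setD1 (negbTE qS) andbF.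
  by have /andP[_ /eqP ->] := cS; have /andP[_ /eqP ->] := cS'; clear; lia.
exists p, p', q; split; first by split=> //; rewrite lp'.
split; first by split=> //; rewrite adj_sym.
split=> // i.
have [->|il] := eqVneq i (lam p); last first.
  rewrite (_ : _ :\: _ = Z i :\: S); first exact: iS.
  apply/setP => x; rewrite !in_setD in_setU1 negb_or -andbA; have [->|//] := eqVneq x p.
  by rewrite ZP eq_sym (negbTE il) !andbF.
set L := Z (lam p) :\: S; rewrite (_ : _ :\: _ = L :\ p); last first.
  by apply/setP => x; rewrite !in_setD in_set1 in_setU1 negb_or -andbA.
apply/connP; split.
  by apply/set0Pn; exists p'; rewrite in_setD1 eq_sym pp' in_setD p'S ZP zp' lp' eqxx.
move=> B BL B0 BnL.
have /connP[_ H] := iS (lam p).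
(* In the rest of its branch set [p] is a leaf attached to [p'], so removing it keeps the rest
   connected. *)
have nbp x : x \in L -> adj p x -> x = p'.
  rewrite in_setD ZP => /andP[xS /andP[zx /eqP lx]] px.
  have [[_ //]|[Ep _]] := only p x zp zx (esym lx) px pS' pS xS.
  by rewrite Ep eqxx in pp'.
have pB : p \notin B by apply/negP => /(subsetP BL); rewrite in_setD1 eqxx.
have BL' : B \subset L by apply: subset_trans BL (subsetDl _ _).
have [p'B|p'B] := boolP (p' \in B).
  have [|||u [y [uB yL yB uy]]] := H (p |: B).
  - by rewrite subUset sub1set pZ.
  - by apply/set0Pn; exists p; rewrite setU11.
  - apply: contraNneq BnL => EB; rewrite -/L in EB; rewrite -EB; apply/eqP/setP => x.
    by rewrite in_setD1 in_setU1; have [->|] := eqVneq x p; rewrite // (negbTE pB).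
  move: yB; rewrite in_setU1 negb_or => /andP[yp yB].
  move: uB; rewrite in_setU1 => /orP[/eqP Eu|uB].
    by rewrite Eu in uy; move: yB; rewrite (nbp y yL uy) p'B.
  by exists u, y; rewrite in_setD1 yp.
have [|||u [y [uB yL yB uy]]] := H B => //.
  by apply: contraNneq pB => ->.
exists u, y; split=> //; rewrite in_setD1 yL andbT; apply/eqP => Ey; rewrite Ey adj_sym in uy.
by move: p'B; rewrite -(nbp u (subsetP BL' u uB) uy) uB.
Qed.

(* Dually to a1 and a2, the sets B and B' are matched to the pair p, p' of
   boundary vertices with the same label. *)
Definition bstruct S p p' B B' :=
  [/\ p \in boundary S, p' \in boundary S, p != p', lam p = lam p' & adj p p'] /\
  [/\ conn (@adj G) B, conn (@adj G) B', B \subset ~: (S :|: boundary S),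
      B' \subset ~: (S :|: boundary S) & [disjoint B & B']] /\
  [/\ touch (@adj G) B B', touch (@adj G) B [set p], touch (@adj G) B' [set p'] &
    forall y, y \in boundary S -> lam y != lam p -> touch (@adj G) B [set y] /\ touch (@adj G) B' [set y]].

Lemma bstruct_sym S p p' B B' : bstruct S p p' B B' -> bstruct S p' p B' B.
Proof.
case=> -[h1 h2 h3 h4 h5] [[k1 k2 k3 k4 k5] [l1 l2 l3 l4]]; split; first by rewrite eq_sym adj_sym.
split; first by rewrite disjoint_sym.
split=> //; first by rewrite touch_sym //; apply: asym.
by move=> y yN; rewrite -h4 => yp; have [] := l4 y yN yp.
Qed.

Lemma touch1 x y : adj x y -> touch (@adj G) [set x] [set y].
Proof. by move=> xy; apply/touchP; exists x, y; rewrite !inE. Qed.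

Lemma not_zv_out S x : good S -> ~~ zv x -> x \notin S -> bb x.
Proof. by move=> /goodP[ha _]; rewrite aa_or_bb negb_and !negbK => /orP[/ha->|]. Qed.

(** At the end of the chain [b1] and [b2] themselves serve, in one of the two orders. *)
Lemma last_bstruct S : crit S -> inv S -> (forall t, zv t -> (t \in S) || (t \in boundary S)) ->
  exists p p' B B', bstruct S p p' B B'.
Proof.
move=> cS iS full; have gS : good S by case/andP: cS.
have [p [p' [pN p'N pp lp]]] := pair_exists cS.
have [_ hb] := goodP _ gS.
have inN t : zv t -> t \notin S -> t \in boundary S by move/full => /orP[->|].
have zN := good_boundary_zv gS.
have [pS _] := boundaryP _ _ pN; have [p'S _] := boundaryP _ _ p'N.
have pZ : p \in Z (lam p) :\: S by rewrite in_setD pS ZP eqxx zN.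
have p'Z : p' \in Z (lam p) :\: S by rewrite in_setD p'S ZP lp eqxx zN.
have app : adj p p'.
  have [|y + /andP[yp py]] := conn_edge (iS (lam p)) pZ.
    by apply: contraNneq pp => E; move: p'Z; rewrite E inE eq_sym.
  rewrite in_setD ZP => /andP[yS /andP[zy /eqP ly]].
  rewrite eq_sym in yp.
  have [[_ <- //]|[_ Ey]] := pair_uniq cS pN p'N pp lp pN (inN y zy yS) yp (esym ly).
  by rewrite Ey eqxx in yp.
have other b y : bb b -> y \in boundary S -> lam y != lam p -> adj b y.
  move=> hb' yN ly; have [x] := nbZ (lam y) (bb_nz hb'); rewrite ZP => /andP[zx /eqP lx] bx.
  have xN := inN x zx (good_out gS hb' bx).
  have [<- //|xy] := eqVneq x y.
  have [[Ex Ey]|[Ex Ey]] := pair_uniq cS pN p'N pp lp xN yN xy lx; move: ly; by rewrite Ey ?lp eqxx.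
have some_p b : bb b -> adj b p \/ adj b p'.
  move=> hb'; have [x] := nbZ (lam p) (bb_nz hb'); rewrite ZP => /andP[zx /eqP lx] bx.
  have xN := inN x zx (good_out gS hb' bx).
  have [<-|xp] := eqVneq x p; first by left.
  by have [[Ex _]|[<- _]] := pair_uniq cS pN p'N pp lp xN pN xp lx; [rewrite Ex eqxx in xp|right].
(* Otherwise [r] could be moved into [S], leaving only four boundary vertices. *)
have some_b r : r \in boundary S -> adj b1 r \/ adj b2 r.
  move=> rN; have [h1|n1] := boolP (adj b1 r); first by left.
  have [h2|n2] := boolP (adj b2 r); first by right.
  have nbr b : bb b -> ~~ adj b r by rewrite bbE => /orP[]/eqP ->.
  have gr : good (r |: S).
    have /goodP[ha _] := gS.
    apply/goodP; split=> [a /ha aS|b h]; first by rewrite in_setU1 aS orbT.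
    have [bS bN] := hb b h.
    rewrite in_setU1 negb_or bS andbT; split.
      by apply: contraTneq (zN r rN) => <-; apply: bb_nz.
    apply/boundaryP => -[_ [y]]; rewrite in_setU1 => /orP[/eqP -> br|yS by_].
      by have := nbr b h; rewrite br.
    by have := boundary_in yS by_; rewrite (negbTE bS) (negbTE bN).
  have sub : boundary (r |: S) \subset boundary S :\ r.
    apply/subsetP => x /boundaryP[]; rewrite in_setU1 negb_or => /andP[xr xS] [y yr xy].
    rewrite in_setD1 xr /=; move: yr; rewrite in_setU1 => /orP[/eqP Ey|yS].
      have [zx|zx] := boolP (zv x); first exact: inN.
      by have := nbr x (not_zv_out gS zx xS); rewrite -Ey xy.
    by have := boundary_in yS xy; rewrite (negbTE xS).
  have := leq_trans (noS gr) (subset_leq_card sub).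
  by have := cardsD1 r (boundary S); rewrite rN; have /andP[_ /eqP ->] := cS; clear; lia.
have fin b b' : bb b -> bb b' -> b != b' -> adj b b' -> adj b p -> adj b' p' -> bstruct S p p' [set b] [set b'].
  move=> h h' bb' abb bp b'p'; have [b1' b2'] := hb b h; have [b3' b4'] := hb b' h'.
  split; first by split.
  split; first split; rewrite ?sub1set ?in_setC ?in_setU ?negb_or ?b1' ?b3' //; try exact: conn1.
    by rewrite disjoints1 in_set1.
  by split; [exact: touch1|exact: touch1|exact: touch1|move=> y yN ly; split; apply: touch1; apply: other].
have b12 : b1 != b2 by move: Hu; rewrite /= !inE => /and4P[].
have B1 : bb b1 by rewrite bbE eqxx.
have B2 : bb b2 by rewrite bbE eqxx orbT.
have [[h1 h2]|[h1 h2]] : (adj b1 p /\ adj b2 p') \/ (adj b1 p' /\ adj b2 p).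
  by case: (some_p _ B1) => ?; case: (some_p _ B2) => ?; case: (some_b _ pN) => ?;
    case: (some_b _ p'N) => ?; auto.
  by exists p, p', [set b1], [set b2]; apply: fin.
have b21 : b2 != b1 by rewrite eq_sym.
have Hba : adj b2 b1 by rewrite adj_sym.
by exists p, p', [set b2], [set b1]; apply: fin.
Qed.

(** Backwards along the chain: the set matched to the new boundary vertex [q] absorbs [q] and
    thereby reaches [p]. The other set already reaches [p'], whose label is not the repeated one of
    the next boundary. *)
Lemma bstruct_exists S : crit S -> inv S -> exists p p' B B', bstruct S p p' B B'.
Proof.
have [n] := ubnP #|~: S|; elim: n S => // n IH S; rewrite ltnS => Sn cS iS.
have [/existsP[t /and3P[zt tS tN]]|/existsPn full] :=
  boolP [exists t, [&& zv t, t \notin S & t \notin boundary S]]; last first.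
  apply: last_bstruct => // t zt; have := full t; rewrite zt /=.
  by rewrite -negb_or negbK.
have [p [p' [q [[pN p'N pp lp app] [[zq qS qN apq lqp] [cS' iS' NS']]]]]] := step_exists cS iS zt tS tN.
have [pS _] := boundaryP _ _ pN.
have [|r [x [B [B' bs]]]] := IH (p |: S) _ cS' iS'.
  apply: leq_trans Sn; apply: proper_card; apply/properP; split.
    by rewrite setCS subsetUr.
  by exists p; rewrite in_setC ?setU11.
have inS' y : y \in boundary S -> y != p -> y \in boundary (p |: S).
  by move=> yN yp; rewrite NS' in_setU1 in_setD1 yp yN orbT.
(* The pair of the new boundary contains [q], for otherwise it would be a second pair of the old
   boundary. *)
wlog Er : r x B B' bs / r = q.
  move=> H; have [[rN xN rx lrx arx] _] := bs.
  have [Er|rq] := eqVneq r q; first exact: H bs Er.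
  have [Ex|xq] := eqVneq x q; first exact: H (bstruct_sym bs) Ex.
  move: rN xN; rewrite NS' !in_setU1 !in_setD1 (negbTE rq) (negbTE xq) /= => /andP[rp rN] /andP[xp xN].
  have [[E _]|[_ E]] := pair_uniq cS pN p'N pp lp rN xN rx lrx; first by rewrite E eqxx in rp.
  by rewrite E eqxx in xp.
subst r; have [[_ xN qx lqx aqx] [[cB cB' sB sB' dB] [tBB tBq tBx tB]]] := bs.
have sub : ~: (p |: S :|: boundary (p |: S)) \subset ~: (S :|: boundary S).
  rewrite setCS; apply/subsetP => y; rewrite in_setU => /orP[yS|yN]; first by rewrite in_setU in_setU1 yS orbT.
  by rewrite in_setU in_setU1; have [//|yp] := eqVneq y p; rewrite inS' ?orbT.
have [xp xN'] : x != p /\ x \in boundary S.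
  by move: xN; rewrite NS' in_setU1 eq_sym (negbTE qx) in_setD1 => /andP.
have qN' : q \in boundary (p |: S) by rewrite NS' setU11.
have qB' : q \notin B'.
  by apply/negP => /(subsetP sB'); rewrite in_setC in_setU qN' orbT.
have p'N' : p' \in boundary (p |: S) by apply: inS'; rewrite // eq_sym.
exists p, p', (q |: B), B'; split; first by split.
split; first split.
- rewrite setUC; apply: connU => //; [exact: asym|exact: conn1|by left].
- by [].
- rewrite subUset sub1set in_setC in_setU negb_or qS qN; exact: subset_trans sub.
- exact: subset_trans sub.
- by rewrite -setI_eq0 setIUl setU_eq0 !setI_eq0 dB andbT disjoints1.
split.
- by apply: touchS tBB => //; apply: subsetUr.
- by apply/touchP; exists q, p; rewrite setU11 inE adj_sym.
- have ly' : lam p' != lam q by rewrite -lp eq_sym.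
  by have [] := tB p' p'N' ly'.
move=> y yN ly; have yp : y != p by apply: contraNneq ly => ->.
have yN' := inS' y yN yp.
have [lyq|lyq] := eqVneq (lam y) (lam q); last first.
  by have [h1 h2] := tB y yN' lyq; split=> //; apply: touchS h1 => //; apply: subsetUr.
have -> : y = x.
  apply/eqP/negPn/negP => yx; have lyx : lam y = lam x by rewrite lyq.
  by have [[Ey _]|[Ey _]] := pair_uniq cS pN p'N pp lp yN xN' yx lyx; move: ly; rewrite Ey ?lp eqxx.
split=> //; by apply/touchP; exists q, x; rewrite setU11 inE.
Qed.

(** * The automaton along the chain *)

Section Run.
Variables (al : nat -> G) (P : nat -> 'I_4).
Hypothesis al_aa : forall k, k < 2 -> aa (al k).
Hypothesis al_adj : adj (al 0) (al 1).
Hypothesis P_inj : forall k l, k < 4 -> l < 4 -> P k = P l -> k = l.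
Hypothesis P_surj : forall i, exists2 k, k < 4 & P k = i.

(* The state s bounds the adjacencies of the paths C from below and those of the
   labels from above; P decodes the labels of s. *)
Record config S (s : st) (h : nat -> G) (C : nat -> {set G}) : Prop := Config {
  cf_conn : forall i : nat, i < 5 -> [/\ conn (@adj G) (C i), h i \in C i & h i \in boundary S];
  cf_in : forall (i : nat) x, i < 5 -> x \in C i -> (x \in S) && zv x || (x == h i);
  cf_disj : forall (i j : nat) x, i < 5 -> j < 5 -> x \in C i -> x \in C j -> i = j;
  cf_bd : forall y, y \in boundary S -> exists2 i : nat, i < 5 & y = h i;
  cf_al : forall k j, k < 2 -> j < 5 -> (1 < j) || (j == k) -> touch (@adj G) [set al k] (C j);
  cf_01 : touch (@adj G) (C 0) (C 1);
  cf_gam : forall i j : nat, i < 5 -> j < 5 -> op i j \in gam s -> touch (@adj G) (C i) (C j);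
  cf_lab : size (lab s) = 5 /\ forall i : nat, i < 5 -> nth 0 (lab s) i < 4 /\ lam (h i) = P (nth 0 (lab s) i);
  cf_pr : [/\ (pr s).1 < (pr s).2, (pr s).2 < 5 & nth 0 (lab s) (pr s).1 = nth 0 (lab s) (pr s).2];
  cf_tht : forall x y k l, (x \in S) || (x \in boundary S) -> (y \in S) || (y \in boundary S) ->
    zv x -> zv y -> adj x y -> k < 4 -> l < 4 -> k != l -> lam x = P k -> lam y = P l -> op k l \in tht s }.

Lemma config_dom S r s h C : dom r s -> config S s h C -> config S r h C.
Proof.
rewrite /dom; case: eqP => // El; case: eqP => // Ep; case: ifP => // /subP gs /subP ts.
case=> c1 c2 c3 c4 c5 c6 c7 c8 c9 c10; split=> //.
- by move=> i j iL jL /gs; apply: c7.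
- by rewrite El.
- by rewrite Ep El.
- by move=> x y k l *; apply: ts; apply: (c10 x y).
Qed.

Lemma config_inj S s h C (i j : nat) : config S s h C -> i < 5 -> j < 5 -> h i = h j -> i = j.
Proof.
move=> cf iL jL E; apply: (cf_disj cf iL jL (x := h i)); first by have [] := cf_conn cf iL.
by rewrite E; have [] := cf_conn cf jL.
Qed.

(** [bstruct_exists] supplies the sets matched to the pair from beyond [S]; with the a's and the
    five paths they realize [pat]. *)
Lemma finish S s h C : crit S -> inv S -> config S s h C -> success s -> mm K7eq G.
Proof.
move=> cS iS cf /successP[i [be [be' [c [i2 ib bb' cD cP]]]]].
have gS : good S by case/andP: cS.
have [p1 p2 lpr] := cf_pr cf.
have [be5 be'5 bne lbb] : [/\ be < 5, be' < 5, be != be' & nth 0 (lab s) be = nth 0 (lab s) be'].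
  have lt1 := ltn_trans p1 p2.
  by case: bb' => E; rewrite -E /= in p1 p2 lpr lt1; split=> //; move: p1; case: (ltngtP be be').
have hN j : j < 5 -> h j \in boundary S by case/(cf_conn cf).
have hbb : h be != h be' by apply: contra bne => /eqP /(config_inj cf be5 be'5) ->.
have lhb : lam (h be) = lam (h be') by have [_ l] := cf_lab cf; rewrite (l _ be5).2 (l _ be'5).2 lbb.
have [B [B' bs]] : exists B B', bstruct S (h be) (h be') B B'.
  have [p [p' [B [B' bs]]]] := bstruct_exists cS iS; have [[pN p'N pp lp _] _] := bs.
  have [[-> ->]|[-> ->]] := pair_uniq cS pN p'N pp lp (hN _ be5) (hN _ be'5) hbb lhb.
    by exists B, B'.
  by exists B', B; apply: bstruct_sym.
have [[_ _ _ _ abb] [[cB cB' sB sB' dB] [tBB tBp tBp' tB]]] := bs.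
pose W k := if k is j.+4 then C j else nth set0 [:: [set al 0]; [set al 1]; B; B'] k.
apply: (@family_K7 9 (pat (fin_edges i be be' c) be be') G W (fin_map i be c)); last exact: fin_check.
have Cz j x : j < 5 -> x \in C j -> zv x /\ (x \in S :|: boundary S).
  move=> jL /(cf_in cf jL) /orP[/andP[xS zx]|/eqP ->]; first by rewrite in_setU xS.
  by rewrite in_setU hN ?orbT // (good_boundary_zv gS) ?hN.
have alS k : k < 2 -> al k \in S by move=> /al_aa; have /goodP[ha _] := gS; apply: ha.
have nB x : x \in B -> x \notin S :|: boundary S by move/(subsetP sB); rewrite in_setC.
have nB' x : x \in B' -> x \notin S :|: boundary S by move/(subsetP sB'); rewrite in_setC.
have al01 : al 0 <> al 1 by move=> E; have := al_adj; rewrite E adj_irrefl.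
have alSN k : k < 2 -> al k \in S :|: boundary S by move=> k2; rewrite in_setU alS.
have nal k j : k < 2 -> j < 5 -> al k \in C j -> False.
  by move=> k2 jL /(Cz _ _ jL)[+ _]; apply/negP/aa_nz/al_aa.
have dB' x : x \in B -> x \in B' -> False.
  by move=> xB xB'; have /pred0P/(_ x) := dB; rewrite /= xB xB'.
have hC j : j < 5 -> h j \in C j by case/(cf_conn cf).
have tC (X : {set G}) j : j < 5 -> touch (@adj G) X [set h j] -> touch (@adj G) X (C j).
  by move=> jL; apply: touchS => //; rewrite sub1set hC.
split.
- by move=> [|[|[|[|j]]]] jL //=; rewrite ?conn1 //; case: (cf_conn cf (i := j)).
- move=> [|[|[|[|k]]]] [|[|[|[|j]]]] x //= kL jL; rewrite ?inE.
  + by move=> /eqP -> /eqP.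
  + by move=> /eqP -> /nB; rewrite alSN.
  + by move=> /eqP -> /nB'; rewrite alSN.
  + by move=> /eqP -> /(nal 0 _ isT jL).
  + by move=> /eqP -> /eqP/esym.
  + by move=> /eqP -> /nB; rewrite alSN.
  + by move=> /eqP -> /nB'; rewrite alSN.
  + by move=> /eqP -> /(nal 1 _ isT jL).
  + by move=> /nB + /eqP E; rewrite E alSN.
  + by move=> /nB + /eqP E; rewrite E alSN.
  + by move=> xB /(dB' _ xB).
  + by move=> /nB + /(Cz _ _ jL)[_ h']; rewrite h'.
  + by move=> /nB' + /eqP E; rewrite E alSN.
  + by move=> /nB' + /eqP E; rewrite E alSN.
  + by move=> xB' /dB' /(_ xB').
  + by move=> /nB' + /(Cz _ _ jL)[_ h']; rewrite h'.
  + by move=> xC /eqP E; case: (nal 0 k isT kL); rewrite -E.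
  + by move=> xC /eqP E; case: (nal 1 k isT kL); rewrite -E.
  + by move=> /(Cz _ _ kL)[_ h'] /nB; rewrite h'.
  + by move=> /(Cz _ _ kL)[_ h'] /nB'; rewrite h'.
  + by move=> xk xj; rewrite (cf_disj cf (i := k) (j := j) kL jL xk xj).
have tBC j : j < 5 -> j != be' -> touch (@adj G) B (C j).
  move=> jL jb; apply: tC => //; have [->//|jbe] := eqVneq j be.
  have [E|ne] := eqVneq (lam (h j)) (lam (h be)); last by case: (tB _ (hN _ jL) ne).
  have hj : h j != h be by apply: contra jbe => /eqP /(config_inj cf jL be5) ->.
  have [[E' _]|[E' _]] := pair_uniq cS (hN _ be5) (hN _ be'5) hbb lhb (hN _ jL) (hN _ be5) hj E.
    by rewrite E' eqxx in hj.
  by case/eqP: jb; apply: config_inj cf jL be'5 E'.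
have tBC' j : j < 5 -> j != be -> touch (@adj G) B' (C j).
  move=> jL jb; apply: tC => //; have [->//|jbe] := eqVneq j be'.
  have [E|ne] := eqVneq (lam (h j)) (lam (h be)); last by case: (tB _ (hN _ jL) ne).
  have hj : h j != h be by apply: contra jb => /eqP /(config_inj cf jL be5) ->.
  have [[E' _]|[E' _]] := pair_uniq cS (hN _ be5) (hN _ be'5) hbb lhb (hN _ jL) (hN _ be5) hj E.
    by rewrite E' eqxx in hj.
  by case/eqP: jbe; apply: config_inj cf jL be'5 E'.
have tE k j : k < 5 -> j < 5 -> (k, j) \in fin_edges i be be' c -> touch (@adj G) (C k) (C j).
  move=> kL jL; rewrite /fin_edges !inE => /or3P[].
  - by move/eqP => -[-> ->]; apply: cf_01 cf.
  - have tb : touch (@adj G) (C be) (C be').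
      by apply/touchP; exists (h be), (h be'); rewrite !hC.
    rewrite /op; case: ifP => _ /eqP[-> ->] //; rewrite touch_sym //; exact: asym.
  - case/mapP => c'; rewrite mem_filter => /andP[cc' cD'] E.
    have c5 : c < 5 by move: cD; rewrite mem_others => /and3P[].
    have c'5 : c' < 5 by move: cD'; rewrite mem_others => /and3P[].
    have := cf_gam cf c5 c'5 (cP c' cD' cc').
    by move: E; rewrite /op; case: ifP => _ [-> ->] //; rewrite touch_sym //; exact: asym.
move=> [|[|[|[|k]]]] [|[|[|[|j]]]] kL jL kj; rewrite /pat //=.
- by move=> _; apply: touch1.
- by rewrite !subSS subn0; apply: (cf_al cf (k := 0)).
- by rewrite !subSS subn0; apply: (cf_al cf (k := 1)).
- by rewrite !subSS subn0; apply: tBC.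
- by rewrite !subSS subn0; apply: tBC'.
by case: ifP => // _; rewrite !subSS !subn0; apply: tE.
Qed.
Lemma touch_op (C : nat -> {set G}) (i j k l : nat) :
  op i j = op k l -> touch (@adj G) (C k) (C l) -> touch (@adj G) (C i) (C j).
Proof.
rewrite /op; case: ifP => _; case: ifP => _ [-> ->] //; rewrite touch_sym //; exact: asym.
Qed.

Definition upd (T : Type) (m : nat) (v : T) (f : nat -> T) i := if i == m then v else f i.

(** Path [m] grows by [q]. A neighbour of [q] in [S] or on its boundary must lie on the boundary,
    hence is a head, so the heads adjacent to [q] account for all new adjacencies of labels. *)
Lemma config_step S s h C (m c l : nat) q : good S -> good (h m |: S) -> config S s h C -> m < 5 -> c < 5 ->
  c = index l (lab s) -> m != c -> l < 4 -> lam q = P l -> nth 0 (lab s) c = l -> nth 0 (lab s) m != l ->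
  zv q -> q \notin S -> q \notin boundary S -> adj (h m) q -> adj q (h c) ->
  boundary (h m |: S) = q |: (boundary S :\ h m) ->
  config (h m |: S) (step s m l [seq c' <- others m c | adj q (h c')])
    (upd m q h) (upd m (q |: C m) C).
Proof.
move=> gS gS' cf m5 c5 cE mc l4 lq lc lm zq qS qN hmq qhc NS'.
have hN i : i < 5 -> h i \in boundary S by case/(cf_conn cf).
have hC i : i < 5 -> h i \in C i by case/(cf_conn cf).
have hz i : i < 5 -> zv (h i) by move/hN; apply: good_boundary_zv.
have qC i : i < 5 -> q \notin C i.
  move=> i5; apply/negP => /(cf_in cf i5); rewrite (negbTE qS) /= => /eqP E.
  by rewrite E hN in qN.
set h' := upd m q h; set C' := upd m (q |: C m) C.
have CC i x : x \in C i -> x \in C' i.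
  by rewrite /C' /upd; case: eqP => [->|] // xm; rewrite setU1r.
have tCC i k : touch (@adj G) (C i) (C k) -> touch (@adj G) (C' i) (C' k).
  by apply: touchS; apply/subsetP => x; apply: CC.
have qC' : q \in C' m by rewrite /C' /upd eqxx setU11.
have [sl labP] := cf_lab cf.
have old x : (x \in h m |: S) || (x \in boundary (h m |: S)) -> x = q \/ (x \in S) || (x \in boundary S).
  rewrite NS' !in_setU1 in_setD1; case/orP => [/orP[/eqP ->|->]|/orP[/eqP ->|/andP[_ ->]]]; auto.
    by right; rewrite hN ?orbT.
  by right; rewrite orbT.
have hneq i : i < 5 -> i != m -> h i != h m.
  by move=> i5 im; apply: contra im => /eqP /(config_inj cf i5 m5) ->.
set t := step _ _ _ _.
have gE : gam t = add prs5 (op m c :: [seq op m c' | c' <- [seq c' <- others m c | adj q (h c')]]) (gam s).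
  by rewrite /t /step -cE.
have lE : lab t = set_nth 0 (lab s) m l by [].
have pE : pr t = op m c by rewrite /t /step -cE.
have tE : tht t = add prs4 (op l (nth 0 (lab s) m) ::
    [seq op l (nth 0 (lab s) c') | c' <- [seq c' <- others m c | adj q (h c')]]) (tht s).
  by rewrite /t /step -cE.
clearbody t.
split.
- move=> i i5; rewrite /h' /C' /upd; have [_|im] := eqVneq i m; rewrite /=.
    rewrite setU11 NS' setU11; split=> //; apply: (connU1 (@asym G) _ (hC m m5) hmq).
    by case: (cf_conn cf m5).
  have [cc hc hb] := cf_conn cf i5; split=> //.
  by rewrite NS' in_setU1 in_setD1 hb hneq ?orbT.
- move=> i x i5; rewrite /h' /C' /upd; have [_|im] := eqVneq i m; rewrite /=.
    rewrite in_setU1 => /orP[->|/(cf_in cf m5)]; rewrite ?orbT // in_setU1.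
    by case/orP => [/andP[-> ->]|/eqP ->]; rewrite ?eqxx ?hz ?orbT.
  by move/(cf_in cf i5) => /orP[/andP[xS zx]|->]; rewrite ?orbT // in_setU1 xS zx orbT.
- move=> i k x i5 k5; rewrite /C' /upd; have [->|im] := eqVneq i m; have [->|km] := eqVneq k m; rewrite //=.
  + rewrite in_setU1 => /orP[/eqP ->|xm] xk; first by have := qC k k5; rewrite xk.
    exact: (cf_disj cf m5 k5 xm xk).
  + move=> xi; rewrite in_setU1 => /orP[/eqP E|xm]; first by have := qC i i5; rewrite -E xi.
    exact: (cf_disj cf i5 m5 xi xm).
  + exact: (cf_disj cf i5 k5).
- move=> y; rewrite NS' in_setU1 in_setD1 => /orP[/eqP ->|/andP[ym /(cf_bd cf)[i i5 yi]]].
    by exists m; rewrite // /h' /upd eqxx.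
  by exists i => //; rewrite /h' /upd; case: eqP => // E; rewrite yi E eqxx in ym.
- move=> k i k2 i5 H; apply: (touchS _ _ (cf_al cf k2 i5 H)) => //; apply/subsetP => x; exact: CC.
- exact: tCC (cf_01 cf).
- move=> i k i5 k5; rewrite gE mem_add => /andP[/orP[g|+] _]; first exact/tCC/(cf_gam cf).
  have tq c' : adj q (h c') -> c' < 5 -> c' != m -> touch (@adj G) (C' m) (C' c').
    move=> qc' c'5 c'm; apply/touchP; exists q, (h c'); rewrite qC'; split=> //.
    by apply: CC; apply: hC.
  rewrite in_cons; case/orP => [/eqP E|].
    by apply: (touch_op (C := C') E); apply: tq; rewrite // eq_sym.
  case/mapP => c' + E; rewrite mem_filter mem_others => /andP[qc' /and3P[c'm _ c'5]].
  by apply: (touch_op (C := C') E); apply: tq.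
- rewrite lE; split; first by rewrite size_set_nth sl; apply/maxn_idPr.
  move=> i i5; rewrite nth_set_nth /= /h' /upd; have [_|im] := eqVneq i m => //.
  exact: labP.
- rewrite pE lE !nth_set_nth /=.
  have ne : c != m by rewrite eq_sym.
  rewrite /op; case: (ltngtP m c) mc => // h1 _ /=; rewrite eqxx.
    by rewrite (negbTE ne); split.
  by rewrite (negbTE ne); split.
move=> x y k k' xS yS zx zy xy k4 k'4 kk lx ly.
have inP : op k k' \in prs4 by apply: op_prs.
rewrite tE mem_add inP andbT.
have qcase z : z != q -> (z \in S) || (z \in boundary S) -> zv z -> adj q z -> forall k', k' < 4 -> k' != l -> lam z = P k' ->
   op l k' \in (op l (nth 0 (lab s) m) :: [seq op l (nth 0 (lab s) c') | c' <- [seq c' <- others m c | adj q (h c')]]).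
  move=> zq' zSN zz qz k0 k04 kl lz.
  have zN : z \in boundary S.
    case/orP: zSN => // zS; rewrite adj_sym in qz.
    by have := boundary_in zS (etrans (adj_sym q z) qz); rewrite (negbTE qS) (negbTE qN).
  have [i i5 zi] := cf_bd cf zN; have [li4 li] := labP i i5.
  have ki : k0 = nth 0 (lab s) i by apply: P_inj; rewrite // -lz zi li.
  rewrite ki in_cons; have [->|im] := eqVneq i m; first by rewrite eqxx.
  apply/orP; right; apply/mapP; exists i => //; rewrite mem_filter -zi qz mem_others im i5 andbT /=.
  by apply: contraNneq kl => Ei; rewrite ki Ei lc.
have [Ex|xo] := old x xS; have [Ey|yo] := old y yS.
- by move: xy; rewrite Ex Ey adj_irrefl.
- have Ek : k = l by apply: P_inj; rewrite // -lx Ex lq.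
  apply/orP; right; rewrite Ek; apply: (qcase y) => //; last by rewrite eq_sym -Ek.
    by apply: contraTneq xy => ->; rewrite Ex adj_irrefl.
  by rewrite -Ex.
- have Ek : k' = l by apply: P_inj; rewrite // -ly Ey lq.
  apply/orP; right; rewrite opC Ek; apply: (qcase x) => //; last by rewrite -Ek.
    by apply: contraTneq xy => ->; rewrite Ey adj_irrefl.
  by rewrite -Ey adj_sym.
by apply/orP; left; apply: (cf_tht cf xo yo).
Qed.

Variable R : tree.
Hypothesis R_ok : invariant R.
Hypothesis noK : ~ mm K7eq G.

Lemma run S s key h C : s \in tget key R -> crit S -> inv S -> config S s h C -> False.
Proof.
have [n] := ubnP #|~: S|; elim: n S s key h C => // n IH S s key h C; rewrite ltnS => Sn sR cS iS cf.
have [_ cl nf] := and3P R_ok.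
have gS : good S by case/andP: cS.
have [/existsP[t /and3P[zt tS tN]]|/existsPn full] :=
  boolP [exists t, [&& zv t, t \notin S & t \notin boundary S]]; last first.
  (* The chain is exhausted. The branch sets lie in [S] and its boundary and touch pairwise, so
     [tht s] contains every pair of labels, which no stored state allows. *)
  case/negP: (tallP nf sR); apply: subP' => -[k l]; rewrite mem_pairs => /andP[kl l4].
  have k4 := ltn_trans kl l4.
  have /touchP[x [y [xZ yZ xy]]] : touch (@adj G) (Z (P k)) (Z (P l)).
    by apply: Ztouch; apply/eqP => /(P_inj k4 l4) E; rewrite E ltnn in kl.
  have inSN z : zv z -> (z \in S) || (z \in boundary S).
    by move=> zz; have := full z; rewrite zz /= -negb_or negbK.
  move: xZ yZ; rewrite !ZP => /andP[zx /eqP lx] /andP[zy /eqP ly].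
  have -> : (k, l) = op k l by rewrite /op kl.
  by apply: (cf_tht cf (inSN x zx) (inSN y zy)) => //; rewrite neq_ltn kl.
have [p [p' [q [[pN p'N pp lp app] [[zq qS qN apq lqp] [cS' iS' NS']]]]]] := step_exists cS iS zt tS tN.
have [pS _] := boundaryP _ _ pN.
have gS' : good (p |: S) by case/andP: cS'.
have [m m5 Em] := cf_bd cf pN; have [l l4 El] := P_surj (lam q).
have [sl labP] := cf_lab cf.
have hN i : i < 5 -> h i \in boundary S by case/(cf_conn cf).
have lm : nth 0 (lab s) m != l.
  by apply: contra lqp => /eqP E; have [_ e] := labP m m5; rewrite Em e E El.
have [x xN] := good_hit (lam q) gS; rewrite ZP => /andP[zx /eqP lx].
have lin : l \in lab s.
  have [i i5 xi] := cf_bd cf xN; have [li4 li] := labP i i5.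
  have -> : l = nth 0 (lab s) i by apply: P_inj; rewrite // -li -xi El lx.
  by rewrite mem_nth // sl.
pose c := index l (lab s); have c5 : c < 5 by rewrite -sl index_mem.
have lc : nth 0 (lab s) c = l by apply: nth_index.
have mc : m != c by apply: contraNneq lm => ->; rewrite lc.
have hcN : h c \in boundary (p |: S).
  rewrite NS' in_setU1 in_setD1 hN // andbT; apply/orP; right.
  by rewrite Em; apply: contraNneq mc => /(config_inj cf c5 m5) ->.
have qN' : q \in boundary (p |: S) by rewrite NS' setU11.
have lqc : lam q = lam (h c) by have [_ ->] := labP c c5; rewrite lc El.
(* The pair of the next boundary consists of [q] and the old head with its label; that it is
   adjacent comes from the other end of the chain. *)
have qhc : adj q (h c).
  have [r [r' [B [B' [[rN r'N rr lr arr] _]]]]] := bstruct_exists cS' iS'.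
  have qc : q != h c by apply: contraNneq qN => ->; apply: hN.
  have [[-> ->]//|[-> ->]] := pair_uniq cS' rN r'N rr lr qN' hcN qc lqc.
  by rewrite adj_sym.
have mpr : m = (pr s).1 \/ m = (pr s).2.
  have [p1 p2 lpr] := cf_pr cf; have p1' := ltn_trans p1 p2.
  have hne : h (pr s).1 != h (pr s).2.
    by apply/eqP => /(config_inj cf p1' p2) E; rewrite E ltnn in p1.
  have leq' : lam (h (pr s).1) = lam (h (pr s).2).
    by have [_ ->] := labP _ p1'; have [_ ->] := labP _ p2; rewrite lpr.
  have [[E _]|[E _]] := pair_uniq cS (hN _ p1') (hN _ p2) hne leq' pN p'N pp lp.
    by left; apply: (config_inj cf m5 p1'); rewrite -Em.
  by right; apply: (config_inj cf m5 p2); rewrite -Em.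
rewrite Em in NS' cS' iS' gS' apq.
have cf' := config_step gS gS' cf m5 c5 (erefl c) mc l4 (esym El) lc lm zq qS qN apq qhc NS'.
have ln : l != nth 0 (lab s) m by rewrite eq_sym.
have tR := trans_mem (fun c' => adj q (h c')) mpr l4 ln.
have /allP/(_ _ tR) := tallP cl sR; case: ifP => [/(finish cS' iS' cf') //|_].
rewrite /known someE => /hasP[r rR rd].
apply: (IH _ _ _ _ _ _ rR cS' iS' (config_dom rd cf')).
apply: leq_trans Sn; apply: proper_card; apply/properP; split.
  by rewrite setCS subsetUr.
by exists p; rewrite in_setC // -Em setU11.
Qed.
End Run.
Hypothesis noK : ~ mm K7eq G.

Lemma core_false : False.
Proof.
have g0 := good0; have c0 := crit0.
have [p [p' [pN p'N pp lp]]] := pair_exists c0.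
have zN := good_boundary_zv g0.
have aN a x : aa a -> zv x -> adj a x -> x \in boundary S0.
  move=> ha zx ax; apply/boundaryP; split; last by exists a; rewrite 1?adj_sym //; move: ha; rewrite aaE !inE.
  by apply: contraTN zx => h; apply: aa_nz; move: h; rewrite aaE !inE.
have app : adj p p'.
  have [r [r' [B [B' [[rN r'N rr lr arr] _]]]]] := bstruct_exists c0 inv0.
  have [[-> ->]//|[-> ->]] := pair_uniq c0 rN r'N rr lr pN p'N pp lp.
  by rewrite adj_sym.
have only x y : x \in boundary S0 -> y \in boundary S0 -> lam x = lam y -> lam x != lam p -> x = y.
  move=> xN yN lxy lxp; apply/eqP/negPn/negP => xy.
  by have [[E _]|[E _]] := pair_uniq c0 pN p'N pp lp xN yN xy lxy; move: lxp; rewrite E ?lp eqxx.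
(* The repeated label comes first, in agreement with [lab0]. *)
pose L := lam p :: enum [set~ lam p].
have sL : size L = 4 by rewrite /= -cardE cardsC1 card_ord.
have uL : uniq L by rewrite /= mem_enum !inE eqxx enum_uniq.
pose P k := nth (lam p) L k.
have P_inj k l : k < 4 -> l < 4 -> P k = P l -> k = l.
  by move=> k4 l4 /eqP; rewrite nth_uniq ?sL // => /eqP.
have P_surj i : exists2 k, k < 4 & P k = i.
  have iL : i \in L by rewrite inE mem_enum !inE orbN.
  by exists (index i L); [move: iL; rewrite -index_mem sL | apply: nth_index].
have [x1 x1N] := good_hit (P 1) g0; rewrite ZP => /andP[zx1 /eqP lx1].
have [x2 x2N] := good_hit (P 2) g0; rewrite ZP => /andP[zx2 /eqP lx2].
have [x3 x3N] := good_hit (P 3) g0; rewrite ZP => /andP[zx3 /eqP lx3].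
pose h i := nth p [:: p; p'; x1; x2; x3] i.
have hN i : i < 5 -> h i \in boundary S0 by case: i => [|[|[|[|[|i]]]]].
have hl i : i < 5 -> nth 0 lab0 i < 4 /\ lam (h i) = P (nth 0 lab0 i).
  by case: i => [|[|[|[|[|i]]]]].
have h_inj i j : i < 5 -> j < 5 -> h i = h j -> i = j.
  move=> i5 j5 E; have E' : nth 0 lab0 i = nth 0 lab0 j.
    by have [i4 li] := hl i i5; have [j4 lj] := hl j j5; apply: P_inj; rewrite // -li -lj E.
  move: E E'; case: i i5 => [|[|[|[|[|i]]]]] // _; case: j j5 => [|[|[|[|[|j]]]]] //= _ E _.
    by move: pp; rewrite /h /= in E; rewrite E eqxx.
  by move: pp; rewrite /h /= in E; rewrite E eqxx.
have adj_other a i : aa a -> i < 5 -> 1 < i -> adj a (h i).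
  move=> ha i5 i1; have [x] := nbZ (lam (h i)) (aa_nz ha); rewrite ZP => /andP[zx /eqP lx] ax.
  rewrite -(only x (h i)) ?hN //; first exact: aN ha zx ax.
  rewrite lx; have [i4 ->] := hl i i5; apply/eqP => /(P_inj _ 0 i4 isT).
  by case: i i5 i1 {lx i4} => [|[|[|[|[|i]]]]].
have some_p a : aa a -> adj a p \/ adj a p'.
  move=> ha; have [x] := nbZ (lam p) (aa_nz ha); rewrite ZP => /andP[zx /eqP lx] ax.
  have xN := aN a x ha zx ax.
  have [<-|xp] := eqVneq x p; first by left.
  by have [[E _]|[<- _]] := pair_uniq c0 pN p'N pp lp xN pN xp lx; [rewrite E eqxx in xp|right].
have some_a r : r \in boundary S0 -> adj a1 r \/ adj a2 r.
  by case/boundaryP => _ [y]; rewrite !inE => /orP[]/eqP ->; rewrite adj_sym; auto.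
have A1 : aa a1 by rewrite aaE eqxx.
have A2 : aa a2 by rewrite aaE eqxx orbT.
(* The a's are numbered so that each is adjacent to the start of the path with its number. *)
have [al [al_aa al_adj al_p al_p']] : exists al : nat -> G, [/\ forall k, k < 2 -> aa (al k),
    adj (al 0) (al 1), adj (al 0) p & adj (al 1) p'].
  have [[h1 h2]|[h1 h2]] : (adj a1 p /\ adj a2 p') \/ (adj a1 p' /\ adj a2 p).
    by case: (some_p _ A1) => ?; case: (some_p _ A2) => ?; case: (some_a _ pN) => ?;
      case: (some_a _ p'N) => ?; auto.
    by exists (fun k => if k is 0 then a1 else a2); split=> // -[|[|k]].
  by exists (fun k => if k is 0 then a2 else a1); split=> //; [case=> [|[|k]]|rewrite adj_sym].
pose g := (0, 1) :: [seq c <- behead prs5 | adj (h c.1) (h c.2)].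
have cf : config al P S0 (init g) h (fun i => [set h i]).
  split.
  - by move=> i i5; rewrite inE eqxx hN //; split=> //; apply: conn1.
  - by move=> i x i5; rewrite inE => ->; rewrite orbT.
  - by move=> i j x i5 j5; rewrite !inE => /eqP -> /eqP; apply: h_inj.
  - move=> y yN; have [k k4 Ek] := P_surj (lam y); have [Ep|ly] := eqVneq (lam y) (lam p).
      have [->|yp] := eqVneq y p; first by exists 0.
      have [[E _]|[-> _]] := pair_uniq c0 pN p'N pp lp yN pN yp Ep; last by exists 1.
      by rewrite E eqxx in yp.
    exists k.+1 => //; apply: only => //; first exact: hN.
    by rewrite -Ek; case: k k4 Ek => [|[|[|[|k]]]].
  - move=> k j k2 j5 /orP[j1|/eqP Ej]; apply: touch1; first by apply: adj_other => //; apply: al_aa.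
    by rewrite Ej; case: k k2 {Ej} => [|[|k]].
  - exact: touch1.
  - move=> i j i5 j5; have -> : gam (init g) = g by [].
    rewrite /g in_cons => /orP[/eqP E|]; 
      first by apply: (touch_op (C := fun i => [set h i]) (k := 0) (l := 1) E); apply: touch1.
    rewrite mem_filter => /andP[+ _]; rewrite /op; case: ifP => _ /= aij; first exact: touch1.
    by apply: touch1; rewrite adj_sym.
  - by split.
  - by split.
  move=> x y k l xS yS zx zy xy k4 l4 kl lx ly.
  have inN z : (z \in S0) || (z \in boundary S0) -> zv z -> exists2 i, i < 5 & z = h i.
    move=> zS zz; have zB : z \in boundary S0.
      case/orP: zS => // zS; have := zz; rewrite (negbTE (_ : ~~ zv z)) //.
      by apply: aa_nz; move: zS; rewrite aaE !inE.
    have [k0 k04 Ek] := P_surj (lam z); have [Ep|lz] := eqVneq (lam z) (lam p).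
      have [->|yp] := eqVneq z p; first by exists 0.
      have [[E _]|[-> _]] := pair_uniq c0 pN p'N pp lp zB pN yp Ep; last by exists 1.
      by rewrite E eqxx in yp.
    exists k0.+1 => //; apply: only => //; first exact: hN.
    by rewrite -Ek; case: k0 k04 Ek => [|[|[|[|k0]]]].
  have [i i5 Ei] := inN x xS zx; have [j j5 Ej] := inN y yS zy.
  have [i4 li] := hl i i5; have [j4 lj] := hl j j5.
  have ki : k = nth 0 lab0 i by apply: P_inj; rewrite // -lx Ei li.
  have lj' : l = nth 0 lab0 j by apply: P_inj; rewrite // -ly Ej lj.
  have ij : i != j by apply: contraNneq kl => Eij; rewrite ki lj' Eij.
  have -> : tht (init g) = [seq t <- prs4 | has (fun p : nat * nat => op (nth 0 lab0 p.1) (nth 0 lab0 p.2) == t) g].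
    by [].
  rewrite mem_filter op_prs // andbT; apply/hasP; exists (op i j).
    rewrite /g in_cons; have [//|n01] := eqVneq (op i j) (0, 1).
    have := op_prs i5 j5 ij; have -> : pairs 5 = (0, 1) :: behead prs5 by [].
    rewrite in_cons (negbTE n01) mem_filter /= => ->; rewrite andbT /op.
    by case: ifP => _ /=; rewrite -Ei -Ej // adj_sym.
  have [E|E] : op i j = (i, j) \/ op i j = (j, i) by rewrite /op; case: ifP; auto.
    by rewrite E /= ki lj'.
  by rewrite E /= ki lj' opC.
have [in_R _ _] := and3P reached_ok.
have g_in : init g \in inits by apply: (map_f (fun g' => init ((0, 1) :: g'))); apply: mem_sublists.
have := allP in_R _ g_in; case: ifP => [su _|_].
  exact: noK (finish al_aa al_adj c0 inv0 cf su).
rewrite /known someE => /hasP[r rR rd].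
exact: (run al_aa al_adj P_inj P_surj reached_ok noK rR c0 inv0 (config_dom rd cf)).
Qed.

End Core.

(** * Separating the a-sets from the b-sets *)

Section Lift.
Variables (G D : sgraph) (phi : G -> option D) (A : {set G}) (W : G -> {set G}).
Hypothesis phiP : minor_map phi.
Hypothesis model : model_on A W.
Hypothesis cover : forall v, phi v <> None -> exists2 z, z \in A & v \in W z.
Hypothesis closed : forall z u v, z \in A -> u \in W z -> adj u v -> exists2 z', z' \in A & v \in W z'.
Hypothesis same : forall z u, z \in A -> u \in W z -> phi u = phi z.

Definition restr (u : qg A W) : option D := phi (val u).
Definition lift (S : {set qg A W}) : {set G} := \bigcup_(z in S) W (val z).

Lemma liftP (S : {set qg A W}) v : reflect (exists2 z : qg A W, z \in S & v \in W (val z)) (v \in lift S).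
Proof. exact: bigcupP. Qed.

Lemma W_inj (z z' : qg A W) u : u \in W (val z) -> u \in W (val z') -> z = z'.
Proof. by move=> uz uz'; apply: val_inj; apply: (model.2 _ _ u) => //; apply: valP. Qed.

Lemma fiber_cover i v : v \in fiber phi i -> exists2 z : qg A W, z \in fiber restr i & v \in W (val z).
Proof.
rewrite inE => /eqP vi; have [|z zA vz] := cover (v := v); first by rewrite vi.
pose m : qg A W := exist _ z zA.
by exists m => //; rewrite inE /restr /= -(same zA vz) vi.
Qed.

Lemma fiber_restr (z : qg A W) u i : z \in fiber restr i -> u \in W (val z) -> u \in fiber phi i.
Proof. by rewrite !inE => /eqP zi uz; rewrite (same (valP z) uz); apply/eqP. Qed.

Lemma qg_edge (z z' : qg A W) u u' : u \in W (val z) -> u' \in W (val z') -> adj u u' -> z != z' -> adj z z'.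
Proof.
move=> uz uz' uu zz; rewrite /adj /= /qg_adj val_eqE zz /=.
by apply/touchP; exists u, u'.
Qed.

Lemma restr_minor_map : minor_map restr.
Proof.
have [cphi tphi] := phiP; split=> [i|i j ij].
  have /connP[/set0Pn[v0 vi0] H] := cphi i; apply/connP; split.
    by have [z zi _] := fiber_cover vi0; apply/set0Pn; exists z.
  move=> B Bi B0 BnK.
  have [|||u [v [uB vi vB uv]]] := H (lift B).
  - by apply/subsetP => u /liftP[z /(subsetP Bi)]; apply: fiber_restr.
  - have /set0Pn[z zB] := B0; have /set0Pn[u uz] := conn0 (model.1 _ (valP z)).
    by apply/set0Pn; exists u; apply/liftP; exists z.
  - apply: contra BnK => /eqP EB; rewrite eqEsubset Bi /=; apply/subsetP => z zi.
    have /set0Pn[u uz] := conn0 (model.1 _ (valP z)).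
    have := fiber_restr zi uz; rewrite -EB => /liftP[z' zB' uz'].
    by rewrite (W_inj uz uz').
  have [z zB uz] := liftP _ _ uB; have [z' z'i vz'] := fiber_cover vi.
  have z'B : z' \notin B by apply: contra vB => z'B; apply/liftP; exists z'.
  exists z, z'; split=> //; apply: (qg_edge uz vz' uv).
  by apply: contraNneq z'B => <-.
have /touchP[u [v [ui vj uv]]] := tphi i j ij.
have [z zi uz] := fiber_cover ui; have [z' z'j vz'] := fiber_cover vj.
apply/touchP; exists z, z'; split=> //; apply: (qg_edge uz vz' uv).
apply: contraTneq ij => E; move: zi z'j; rewrite !inE E => /eqP -> /eqP [->].
by rewrite adj_irrefl.
Qed.

(** By [closed] an edge leaving the lift ends in some [W z'], and this [z'] is then a boundary
    vertex of [S]. *)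
Lemma lift_boundary (S : {set qg A W}) : boundary (lift S) \subset lift (boundary S).
Proof.
apply/subsetP => v /boundaryP[vS [u /liftP[z zS uz] vu]].
have [|z' z'A vz'] := closed (valP z) uz (v := v); first by rewrite adj_sym.
pose m : qg A W := exist _ z' z'A.
have mS : m \notin S by apply: contra vS => mS; apply/liftP; exists m.
apply/liftP; exists m => //; apply/boundaryP; split=> //; exists z => //.
apply: (qg_edge (vz' : v \in W (val m)) uz vu).
by apply: contraNneq mS => ->.
Qed.

Lemma lift_fiber (S : {set qg A W}) i : fiber restr i \subset S -> fiber phi i \subset lift S.
Proof.
move=> iS; apply/subsetP => v /fiber_cover[z zi vz]; apply/liftP; exists z => //.
exact: (subsetP iS).
Qed.

Lemma lift_disjoint (S : {set qg A W}) i : [disjoint fiber restr i & S] -> [disjoint fiber phi i & lift S].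
Proof.
move=> iS; rewrite disjoints_subset; apply/subsetP => v /fiber_cover[z zi vz].
rewrite in_setC; apply/negP => /liftP[z' z'S vz'].
by have /pred0P/(_ z) := iS; rewrite /= zi (W_inj vz vz') z'S.
Qed.
End Lift.

Definition splits (G : sgraph) (phi : G -> option Dg) (S : {set G}) :=
  (forall i : Dg, i < 2 -> fiber phi i \subset S) /\
  (forall i : Dg, 2 <= i < 4 -> [disjoint fiber phi i & S :|: boundary S]).

Lemma lift_splits (G : sgraph) (phi : G -> option Dg) A W (S : {set qg A W}) : minor_map phi -> model_on A W ->
  (forall v, phi v <> None -> exists2 z, z \in A & v \in W z) ->
  (forall z u v, z \in A -> u \in W z -> adj u v -> exists2 z', z' \in A & v \in W z') ->
  (forall z u, z \in A -> u \in W z -> phi u = phi z) ->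
  splits (@restr _ _ phi A W) S -> splits phi (lift S).
Proof.
move=> p m cov clo same [s1 s2]; split=> i hi; first exact: lift_fiber (s1 i hi).
have := s2 i hi; rewrite -!setI_eq0 !setIUr !setU_eq0 !setI_eq0 => /andP[d1 d2].
rewrite lift_disjoint //=; have := lift_disjoint m cov same d2.
by rewrite !disjoints_subset => /subset_trans; apply; rewrite setCS lift_boundary.
Qed.

(** Counting the unlabelled vertices a second time makes labelling a vertex decrease the measure
    too, besides deleting one and contracting an edge. *)
Theorem separation (G : sgraph) (phi : G -> option Dg) : minor_map phi ->
  mm K7eq G \/ exists2 S : {set G}, splits phi S & #|boundary S| <= 4.
Proof.
have [n] := ubnP (#|G| + #|[set x | phi x == None]|).
elim: n G phi => // n IH G phi; rewrite ltnS => Gn mphi.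
have [//|nG] := classic (mm K7eq G \/ exists2 S : {set G}, splits phi S & #|boundary S| <= 4).
have noK : ~ mm K7eq G by move=> h; apply: nG; left.
have no4 S : splits phi S -> 5 <= #|boundary S|.
  by move=> sS; rewrite ltnNge; apply/negP => h; apply: nG; right; exists S.
have [cphi tphi] := mphi.
have relabel x y i : phi x = None -> adj x y -> phi y = Some i -> False.
  move=> px xy py; pose phi' z := if z == x then Some i else phi z.
  have sub j : fiber phi j \subset fiber phi' j.
    by apply/subsetP => z; rewrite !inE /phi'; case: (z =P x) => [->|//]; rewrite px.
  have mphi' : minor_map phi'.
    split=> [j|j k jk]; last exact: touchS (tphi j k jk).
    have [ji|ji] := eqVneq j i.
      rewrite (_ : fiber phi' j = x |: fiber phi j); last first.
        by apply/setP => z; rewrite !inE /phi'; case: (z =P x) => [->|//]; rewrite ji eqxx.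
      by apply: (connU1 (@asym G) (cphi j) (x := y)); rewrite 1?adj_sym // inE py ji.
    rewrite (_ : fiber phi' j = fiber phi j) //; apply/setP => z; rewrite !inE /phi'.
    case: (z =P x) => [->|//]; rewrite px; apply/eqP => -[E]; by rewrite E eqxx in ji.
  have [|//|[S [s1 s2] S4]] := IH G phi' _ mphi'.
    apply: leq_trans Gn; rewrite ltn_add2l; apply: proper_card; apply/properP; split.
      by apply/subsetP => z; rewrite !inE /phi'; case: (z =P x).
    by exists x; rewrite !inE ?px // /phi' eqxx.
  have : splits phi S.
    split=> k hk; first exact: subset_trans (sub k) (s1 k hk).
    by have := s2 k hk; rewrite !disjoints_subset; apply: subset_trans.
  by move/no4; rewrite ltnNge S4.
have all_lab x : phi x <> None.
  move=> px; pose A := [set z | phi z != None]; pose W (z : G) := [set z].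
  have mA : model_on A W by split=> [z _|z z' u _ _]; [apply: conn1|rewrite !inE => /eqP -> /eqP].
  have cov v : phi v <> None -> exists2 z, z \in A & v \in W z.
    by move=> /eqP h; exists v; rewrite !inE.
  have clo z u v : z \in A -> u \in W z -> adj u v -> exists2 z', z' \in A & v \in W z'.
    rewrite !inE => zA /eqP -> zv; exists v; rewrite !inE //; apply/eqP => pv.
    case pz: (phi z) zA => [i|] // _; apply: (relabel v z i pv _ pz); by rewrite adj_sym.
  have same z u : z \in A -> u \in W z -> phi u = phi z by rewrite !inE => _ /eqP ->.
  have [|/mm_trans/(_ (qg_mm mA)) //|[S sS S4]] := IH (qg A W) (@restr _ _ phi A W) _ (restr_minor_map mphi mA cov same).
    have -> : [set x0 : qg A W | @restr _ _ phi A W x0 == None] = set0.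
      by apply/setP => z; rewrite !inE; have := valP z; rewrite inE => /negbTE.
    rewrite cards0 addn0 card_qg; apply: leq_trans Gn; apply: ltn_addr.
    rewrite -cardsT; apply: proper_card; rewrite properT; apply/eqP => /setP/(_ x).
    by rewrite !inE px.
  have := no4 _ (lift_splits mphi mA cov clo same sS); rewrite ltnNge => /negP[].
  apply: (leq_trans _ S4); apply: leq_trans (subset_leq_card (lift_boundary clo S)) _.
  rewrite -(card_imset _ val_inj); apply: subset_leq_card; apply/subsetP => v /liftP[z zS].
  by rewrite inE => /eqP ->; apply: imset_f.
(* After the contraction a splitting set has at most four boundary vertices. Its lift has at least
   five, so the contracted vertex is one of them and opens up into [x] and [y]. *)
have contract_step x y i : phi x = Some i -> phi y = Some i -> x != y -> adj x y ->
    4 <= i /\ exists S, [/\ splits phi S, #|boundary S| = 5, x \in boundary S & y \in boundary S].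
  move=> px py xy axy; pose A := ~: [set y].
  pose W (z : G) := if z == x then [set x; y] else [set z].
  have xA : x \in A by rewrite in_setC in_set1.
  have inW z u : u \in W z -> u = z \/ (z = x /\ u = y).
    rewrite /W; case: eqP => [->|_]; last by rewrite inE => /eqP ->; left.
    by rewrite !inE => /orP[] /eqP ->; auto.
  have self z : z \in W z by rewrite /W; case: eqP => [->|_]; rewrite !inE eqxx.
  have mA : model_on A W.
    split=> [z _|z z' u].
      by rewrite /W; case: eqP => _; [apply: (conn2 (@asym G) axy)|apply: conn1].
    rewrite !in_setC !in_set1 => zy z'y /inW[->|[-> ->]] /inW[E|[E1 E2]] //.
    + by rewrite E2 eqxx in zy.
    + by rewrite E eqxx in z'y.
  have covA v : exists2 z, z \in A & v \in W z.
    have [->|vy] := eqVneq v y; first by exists x => //; rewrite /W eqxx !inE eqxx orbT.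
    by exists v => //; rewrite in_setC in_set1.
  have cov v : phi v <> None -> exists2 z, z \in A & v \in W z by move=> _; apply: covA.
  have clo z u v : z \in A -> u \in W z -> adj u v -> exists2 z', z' \in A & v \in W z'.
    by move=> _ _ _; apply: covA.
  have same z u : z \in A -> u \in W z -> phi u = phi z.
    by move=> _ /inW[->|[-> ->]] //; rewrite px py.
  have [|/mm_trans/(_ (qg_mm mA)) //|[S sS S4]] := IH (qg A W) (@restr _ _ phi A W) _ (restr_minor_map mphi mA cov same).
    have -> : [set x0 : qg A W | @restr _ _ phi A W x0 == None] = set0.
      by apply/setP => z; rewrite !inE; apply/eqP/all_lab.
    rewrite cards0 addn0 card_qg cardsC1; apply: leq_trans Gn; apply: ltn_addr.
    by rewrite ltn_predL; apply/card_gt0P; exists x.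
  pose m : qg A W := exist _ x xA.
  have sl := lift_splits mphi mA cov clo same sS.
  have bs : boundary (lift S) \subset lift (boundary S) := lift_boundary clo S.
  have ge5 := no4 _ sl.
  have c4 : #|val @: boundary S| <= 4 by rewrite card_imset //; apply: val_inj.
  have l1 : lift (boundary S) \subset y |: (val @: boundary S).
    apply/subsetP => v /liftP[z zS /inW[->|[_ ->]]]; last exact: setU11.
    by rewrite in_setU1 imset_f ?orbT.
  have mS : m \in boundary S.
    apply/negPn/negP => mS; have : lift (boundary S) \subset val @: boundary S.
      apply/subsetP => v /liftP[z zS /inW[->|[zx _]]]; first exact: imset_f.
      by case/negP: mS; rewrite (_ : m = z) //; apply: val_inj.
    by move/(subset_trans bs)/subset_leq_card => le; have := leq_trans ge5 (leq_trans le c4).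
  have fm : m \in fiber (@restr _ _ phi A W) i by rewrite inE /restr /= px.
  split.
    rewrite leqNgt; apply/negP => i4; have [i2|i2] := ltnP i 2.
      by have /subsetP/(_ m fm) mS' := sS.1 i i2; have /boundaryP[] := mS; rewrite mS'.
    have := sS.2 i; rewrite i2 i4 => /(_ isT)/pred0P/(_ m).
    by rewrite /= fm in_setU mS orbT.
  have c5 : #|y |: (val @: boundary S)| <= 5.
    by rewrite cardsU1 -[5]/(1 + 4); apply: leq_add => //; apply: leq_b1.
  have E : boundary (lift S) = y |: (val @: boundary S).
    by apply/eqP; rewrite eqEcard (subset_trans bs l1) (leq_trans c5).
  exists (lift S); split=> //.
  - by apply/eqP; rewrite eqn_leq ge5 andbT E.
  - by rewrite E in_setU1; apply/orP; right; apply/imsetP; exists m.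
  - by rewrite E setU11.
pose f k : Dg := inord k : 'I_8.
have fE k : k < 8 -> f k = k :> nat by move=> k8; rewrite /f /= inordK.
have phi_f k z : k < 8 -> (z \in fiber phi (f k)) = (phi z == Some (f k)) by rewrite inE.
have single k : k < 4 -> exists c, fiber phi (f k) = [set c].
  move=> k4; have /set0Pn[c cf] := conn0 (cphi (f k)); exists c; apply/eqP/negPn/negP => ne.
  have pc : phi c = Some (f k) by move: cf; rewrite inE => /eqP.
  have [y [py yc cy]] := fiber_conn_edge (cphi (f k)) pc ne.
  have [] := contract_step c y (f k) pc py _ cy; first by rewrite eq_sym.
  by rewrite fE; [rewrite leqNgt k4|apply: leq_trans k4 _].
have [a1 Ea1] := single 0 isT; have [a2 Ea2] := single 1 isT.
have [b1 Eb1] := single 2 isT; have [b2 Eb2] := single 3 isT.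
have ph c k : fiber phi (f k) = [set c] -> phi c = Some (f k).
  by move=> E; have := set11 c; rewrite -E inE => /eqP.
have [pa1 pa2 pb1 pb2] := And4 (ph _ _ Ea1) (ph _ _ Ea2) (ph _ _ Eb1) (ph _ _ Eb2).
have f_inj k l : k < 8 -> l < 8 -> f k = f l -> k = l.
  by move=> k8 l8 E; rewrite -(fE k k8) -(fE l l8) E.
have fadj k l : k < 8 -> l < 8 -> k <> l -> dmat k l -> touch (@adj G) (fiber phi (f k)) (fiber phi (f l)).
  move=> k8 l8 kl dkl; apply: tphi; rewrite /adj /= /mg_adj /msym !fE // dkl andbT.
  by apply/eqP => /(f_inj _ _ k8 l8).
pose W k := fiber phi (f k).
have fam (M : nat -> nat -> bool) : (forall i j, i < 8 -> j < 8 -> i <> j -> M i j -> touch (@adj G) (W i) (W j)) -> @family 8 M G W.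
  move=> h; split=> // [i _|i j x i8 j8]; first exact: cphi.
  by rewrite !inE => /eqP -> /eqP [] /(f_inj _ _ i8 j8).
have Hab a b : a \in [:: a1; a2] -> b \in [:: b1; b2] -> ~~ adj a b.
  move=> ha hb; apply/negP => ab.
  have [p [q [p2 q24 pa qb]]] : exists p q, [/\ p < 2, 2 <= q < 4, a \in W p & b \in W q].
    move: ha hb; rewrite !inE => /orP[]/eqP Ea /orP[]/eqP Eb; rewrite Ea Eb.
    - by exists 0, 2; rewrite /W Ea1 Eb1 !inE.
    - by exists 0, 3; rewrite /W Ea1 Eb2 !inE.
    - by exists 1, 2; rewrite /W Ea2 Eb1 !inE.
    - by exists 1, 3; rewrite /W Ea2 Eb2 !inE.
  apply: noK; pose M i j : bool := dmat i j || (i == p) && (j == q).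
  (* Contracting the edge [ab] leaves a K_7 in which only the other a and the other b may be
     non-adjacent. *)
  pose g := [seq (if i == p then 4 else if i == q then 4 else if i < 2 then 0 else 1) | i <- iota 0 4] ++ [:: 2; 3; 5; 6].
  apply: (@family_K7 8 M G W g).
    apply: fam => i j i8 j8 ij /orP[|/andP[/eqP -> /eqP ->]]; first exact: fadj.
    by apply/touchP; exists a, b.
  rewrite /M /g; clear -p2 q24.
  by case: p p2 => [|[|p]] //; case: q q24 => [|[|[|[|q]]]] //.
have lt8 (x : Dg) : x < 8 by apply: ltn_ord.
pose ix z : nat := if phi z is Some i then (i : nat) else 0.
have ixP z : phi z = Some (f (ix z)) /\ ix z < 8.
  rewrite /ix; case pz: (phi z) => [i|]; last by case: (all_lab z).
  by split; [congr Some; apply: val_inj; rewrite /= fE|apply: lt8].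
pose lam z : 'I_4 := inord (ix z - 4).
have zvE z : zv a1 a2 b1 b2 z = (4 <= ix z).
  have [pz z8] := ixP z.
  have in1 c k : k < 4 -> fiber phi (f k) = [set c] -> (z == c) = (ix z == k).
    move=> k4 Ec; rewrite -in_set1 -Ec inE pz.
    apply/eqP/eqP => [[]|->] //; apply: f_inj => //; exact: leq_trans k4 _.
  rewrite /zv !inE (in1 _ 0) // (in1 _ 1) // (in1 _ 2) // (in1 _ 3) //.
  by move: z8; clear; case: (ix z) => [|[|[|[|m]]]].
have lamE z (i : 'I_4) : 4 <= ix z -> (lam z == i) = (ix z == i + 4).
  have [_ z8] := ixP z; move=> z4; rewrite -val_eqE /= inordK; last by move: z8; clear; lia.
  by move: z4; clear; lia.
have ZE (i : 'I_4) : Z a1 a2 b1 b2 lam i = fiber phi (f (i + 4)).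
  have i8 : i + 4 < 8 by have := ltn_ord i; lia.
  apply/setP => z; rewrite inE zvE inE; have [pz z8] := ixP z; rewrite pz.
  apply/andP/eqP => [[z4]|[]].
    by rewrite lamE // => /eqP ->.
  by move/(f_inj _ _ z8 i8) => E; rewrite lamE E ?leq_addl // addnC leq_addr.
have goodE S : good a1 a2 b1 b2 S <-> splits phi S.
  have i4 (i : Dg) : i < 4 -> [\/ i = f 0, i = f 1, i = f 2 | i = f 3].
    have fi k : k < 8 -> nat_of_ord i = k -> i = f k by move=> k8 E; apply: val_inj; rewrite /= fE.
    by case E: (nat_of_ord i) => [|[|[|[|m]]]] // _; [apply: Or41|apply: Or42|apply: Or43|apply: Or44]; apply: fi.
  split=> [/and4P[h1 h2 h3 h4]|[s1 s2]].
    split=> i hi.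
      have [|E|E|E|E] := i4 i; rewrite ?E ?Ea1 ?Ea2 ?sub1set //; first exact: leq_trans hi _.
        by move: hi; rewrite E fE.
      by move: hi; rewrite E fE.
    have [|E|E|E|E] := i4 i; rewrite ?E ?Eb1 ?Eb2 ?disjoints1 //; first by case/andP: hi.
      by move: hi; rewrite E fE.
    by move: hi; rewrite E fE.
  have hf k : k < 8 -> (f k : nat) = k by apply: fE.
  apply/and4P; split.
  - by have := s1 (f 0); rewrite Ea1 sub1set; apply; rewrite fE.
  - by have := s1 (f 1); rewrite Ea2 sub1set; apply; rewrite fE.
  - by have := s2 (f 2); rewrite Eb1 disjoints1; apply; rewrite fE.
  - by have := s2 (f 3); rewrite Eb2 disjoints1; apply; rewrite fE.
exfalso; apply: (@core_false G a1 a2 b1 b2 lam) => //.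
- have ne c d k l : k < 8 -> l < 8 -> k != l -> phi c = Some (f k) -> phi d = Some (f l) -> c != d.
    move=> k8 l8 kl pc pd; apply: contraNneq kl => E.
    by move: pd; rewrite -E pc => -[] /(f_inj _ _ k8 l8) ->.
  rewrite /= !inE !negb_or (ne _ _ 0 1) // (ne _ _ 0 2) // (ne _ _ 0 3) // (ne _ _ 1 2) //.
  by rewrite (ne _ _ 1 3) // (ne _ _ 2 3).
- have := fadj 0 1; rewrite Ea1 Ea2 => /(_ isT isT (fun e => ltac:(discriminate e)) isT).
  by case/touchP => x [y [/set1P -> /set1P ->]].
- have := fadj 2 3; rewrite Eb1 Eb2 => /(_ isT isT (fun e => ltac:(discriminate e)) isT).
  by case/touchP => x [y [/set1P -> /set1P ->]].
- by move=> i; rewrite ZE; apply: cphi.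
- move=> i j ij; rewrite !ZE; apply: tphi; have [i4 j4] := (ltn_ord i, ltn_ord j).
  rewrite /adj /= /mg_adj /msym /dmat !fE; try by move: i4 j4; clear; lia.
  apply/andP; split; last by move: ij i4 j4; rewrite -val_eqE /=; clear; lia.
  by apply/eqP => /f_inj E; move: ij; rewrite -val_eqE /= => /eqP; move: i4 j4 E; clear; lia.
- move=> c i hc; rewrite ZE; have i4 := ltn_ord i.
  have tz k : k < 4 -> touch (@adj G) (fiber phi (f k)) (fiber phi (f (i + 4))).
    by move=> k4; apply: fadj; rewrite /dmat; move: i4 k4; clear; lia.
  move: hc; rewrite !inE => /or4P[]/eqP ->; [rewrite -Ea1|rewrite -Ea2|rewrite -Eb1|rewrite -Eb2]; exact: tz.
- move=> x y; rewrite !zvE => zx zy lxy xy.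
  have [px x8] := ixP x; have [py y8] := ixP y.
  have E : ix x = ix y.
    have : lam x == lam y by rewrite lxy.
    rewrite lamE // => /eqP ->; rewrite /lam inordK; last by move: y8 zy; clear; lia.
    by rewrite subnK.
  rewrite -E in py; have [|_ [S [sS S5 xS yS]]] := contract_step x y _ px py _ xy.
    by apply: contraTneq xy => ->; rewrite adj_irrefl.
  by exists S; split=> //; rewrite /crit S5 eqxx andbT; apply/goodE.
- by move=> S /goodE; apply: no4.
Qed.

(** * Light components *)

Section Light.
Variable G : sgraph.
Implicit Types (K S T U X : {set G}) (x y z : G).

Definition is_comp X K := [&& conn (@adj G) K, K \subset X &
  [forall y in K, forall z in X, adj y z ==> (z \in K)]].

Lemma is_compP X K : reflect [/\ conn (@adj G) K, K \subset X &
  forall y z, y \in K -> z \in X -> adj y z -> z \in K] (is_comp X K).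
Proof.
apply: (iffP and3P) => -[cK KX cl]; split=> //.
  by move=> y z yK zX yz; move/forall_inP/(_ y yK)/forall_inP/(_ z zX)/implyP: cl; apply.
apply/forall_inP => y yK; apply/forall_inP => z zX; apply/implyP; exact: cl.
Qed.

(** An edge meeting [X] meets a given component or the rest, so [rho] is subadditive and components
    can be split off one at a time. *)
Lemma rho_comps X : (forall K, is_comp X K -> rho K <= 4 * #|K|) -> rho X <= 4 * #|X|.
Proof.
have [n] := ubnP #|X|; elim: n X => // n IH X; rewrite ltnS => Xn H.
have [->|/set0Pn[x xX]] := eqVneq X set0.
  rewrite cards0 muln0 leqn0 cards_eq0; apply/eqP/setP => s.
  by rewrite inE setI0 eqxx andbF in_set0.
have [K [xK KX cK cl]] := component (@asym G) xX.
have hK : rho K <= 4 * #|K| by apply: H; apply/is_compP.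
have cX : #|X| = #|K| + #|X :\: K| by rewrite -(cardsID K X) (setIidPr KX).
have K0 : 0 < #|K| by apply/card_gt0P; exists x.
have hXK : rho (X :\: K) <= 4 * #|X :\: K|.
  apply: IH => [|L /is_compP[cL LX clL]]; first by move: Xn K0; rewrite cX; clear; lia.
  apply: H; apply/is_compP; split=> //; first by apply: subset_trans LX (subsetDl _ _).
  move=> y z yL zX yz; apply: (clL y) => //; rewrite in_setD zX andbT; apply/negP => zK.
  have := subsetP LX y yL; rewrite in_setD => /andP[/negP yK yX]; case: yK.
  by apply: cl zK yX _; rewrite adj_sym.
have sub : rho X <= rho K + rho (X :\: K).
  rewrite /rho; apply: leq_trans (leq_card_setU _ _); apply: subset_leq_card; apply/subsetP => s.
  rewrite !inE => /andP[-> /set0Pn[y]]; rewrite in_setI => /andP[ys yX] /=.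
  have [yK|yK] := boolP (y \in K); apply/orP; [left|right]; apply/set0Pn; exists y.
    by rewrite in_setI ys.
  by rewrite in_setI ys in_setD yK.
by move: sub hK hXK; rewrite cX; clear; lia.
Qed.

Lemma edges_induced U : #|edges (induced U)| + rho (~: U) = #|edges G|.
Proof.
apply/eqP; rewrite -(eqn_pmul2l (isT : 0 < 2)) mulnDr -!darts_edge.
have -> : 2 * rho (~: U) = #|[set p : G * G | adj p.1 p.2 && ([set p.1; p.2] :&: ~: U != set0)]|.
  by rewrite -darts_edges.
pose f (p : induced U * induced U) := (val p.1, val p.2).
have fi : injective f by move=> [a b] [c d] [] /val_inj -> /val_inj ->.
rewrite -(card_imset _ fi) -(cardsID [set p | [set p.1; p.2] :&: ~: U != set0] (darts G)) addnC.
apply/eqP; congr (_ + _); apply: eq_card => -[x y]; first by rewrite !inE.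
have UE : ([set x; y] :&: ~: U == set0) = (x \in U) && (y \in U).
  rewrite setI_eq0 disjoints_subset setCK subUset !sub1set //.
rewrite in_setD !inE /= negbK UE; apply/imsetP/andP => [[[u v]]|[/andP[xU yU] xy]].
  by rewrite inE /= => uv [-> ->]; rewrite !(valP u) (valP v).
by exists (exist _ x xU, exist _ y yU); rewrite ?inE.
Qed.

Definition reduced U := (3 <= #|U|) &&
  [forall K, is_comp (~: U) K ==> (#|boundary K| <= 4) && (rho K <= 4 * #|K|)].

Lemma reducedP U : reflect (3 <= #|U| /\ forall K, is_comp (~: U) K -> #|boundary K| <= 4 /\ rho K <= 4 * #|K|)
  (reduced U).
Proof.
apply: (iffP andP) => -[U3 H]; split=> //.
  by move=> K cK; move/forallP/(_ K)/implyP/(_ cK)/andP: H.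
by apply/forallP => K; apply/implyP => /H/andP.
Qed.

(** As the boundary of [X] lies in [U], a component of the new complement is a component either of
    [X] or of the old complement. *)
Lemma reduce U X : reduced U -> boundary X \subset U -> 3 <= #|U :\: X| ->
  (forall K, is_comp X K -> #|boundary K| <= 4 /\ rho K <= 4 * #|K|) -> reduced (U :\: X).
Proof.
move=> /reducedP[_ HU] bX U3 HX; apply/reducedP; split=> // K /is_compP[cK KU cl].
have [/eqP KX0|KX] := boolP (K :&: X == set0).
  have KnX y : y \in K -> y \notin X.
    by move=> yK; apply/negP => yX; move/setP/(_ y): KX0; rewrite !inE yK yX.
  apply: HU; apply/is_compP; split=> //.
    by apply/subsetP => y yK; have := subsetP KU y yK; rewrite !inE (KnX y yK).
  by move=> y z yK zU; apply: cl => //; move: zU; rewrite !inE => /negbTE ->; rewrite andbF.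
have /set0Pn[x] := KX; rewrite in_setI => /andP[xK xX].
have KsX : K \subset X.
  apply: (conn_sub cK KU xK xX) => y z yX zU yz; apply/negPn/negP => zX.
  have zb : z \in boundary X by apply/boundaryP; split=> //; exists y; rewrite // adj_sym.
  by move: zU; rewrite !inE zX (subsetP bX z zb).
apply: HX; apply/is_compP; split=> // y z yK zX; apply: cl => //.
by rewrite !inE zX.
Qed.
End Light.

Lemma induced_mm (G : sgraph) (U : {set G}) : mm (induced U) G.
Proof.
apply: (@mm_sets (induced U) G (fun u => [set val u])) => [u|u v x|u v uv].
- exact: conn1.
- by rewrite !inE => /eqP -> /eqP/val_inj.
by apply/touchP; exists (val u), (val v); rewrite !inE.
Qed.

Lemma induced_minor_map (G D : sgraph) (U : {set G}) : mm D (induced U) ->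
  exists2 phi : G -> option D, minor_map phi & forall i, fiber phi i \subset U.
Proof.
case=> psi [cpsi tpsi]; pose phi (x : G) := obind psi (insub x : option (induced U)).
have fE i : fiber phi i = val @: fiber psi i.
  apply/setP => x; rewrite inE /phi; apply/idP/imsetP => [|[u]].
    case: insubP => //= u _ ux /eqP ui; exists u => //; by rewrite inE ui.
  by rewrite inE => /eqP ui ->; rewrite valK /= ui.
exists phi; last by move=> i; rewrite fE; apply/subsetP => _ /imsetP[u _ ->]; apply: valP.
split=> [i|i j /tpsi/touchP[u [v [ui vj uv]]]]; first by rewrite fE; apply: conn_val.
by apply/touchP; exists (val u), (val v); rewrite !fE !imset_f.
Qed.

Theorem bilight_mm (G : sgraph) : 3 <= #|G| -> bilight4 G -> 4 * #|G| <= #|edges G| + 7 -> mm K7eq G.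
Proof.
move=> n3 bl eG.
have r1 : reduced [set: G].
  apply/reducedP; split=> [|K /is_compP[cK]]; first by rewrite cardsT.
  by rewrite setCT subset0 => /eqP K0; have := conn0 cK; rewrite K0 eqxx.
case: (@arg_minnP _ [set: G] (@reduced G) (fun U => #|U|) r1) => U rU min.
have [U3 HU] := reducedP _ rU.
have cI : #|induced U| = #|U| by rewrite card_sig; apply: eq_card => x; rewrite inE.
(* Lightness of the components means that passing to [U] costs at most four edges for each lost
   vertex. *)
have eU : 4 * #|induced U| <= #|edges (induced U)| + 8.
  have := edges_induced U; have : rho (~: U) <= 4 * #|~: U| by apply: rho_comps => K /HU[].
  by have := cardsC U; rewrite cI; move: eG; clear; lia.
have [|mK|mD] := extremal _ eU; first by rewrite cI.
  exact: mm_trans mK (induced_mm U).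
have [phi mphi phiU] := induced_minor_map mD.
have [//|[S [s1 s2] S4]] := separation mphi.
have [cphi tphi] := mphi.
pose f k : Dg := inord k : 'I_8.
have fE k : k < 8 -> f k = k :> nat by move=> k8; rewrite /f /= inordK.
have i0S : fiber phi (f 0) \subset S by apply: s1; rewrite fE.
have i2S : [disjoint fiber phi (f 2) & S :|: boundary S] by apply: s2; rewrite fE.
(* A z-branch set touches an a-set inside [S] and a b-set beyond the boundary, so being connected it
   meets the boundary. *)
have hit (i : Dg) : 4 <= i -> exists2 x, x \in boundary S & phi x = Some i.
  move=> i4; have i8 : i < 8 := ltn_ord i.
  have /touchP[x [s [xi /(subsetP i0S) sS xs]]] : touch (@adj G) (fiber phi i) (fiber phi (f 0)).
    apply: tphi; rewrite /adj /= /mg_adj /msym /dmat !fE // -val_eqE /= fE //.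
    by move: i4; clear; lia.
  have /touchP[y [b [yi b2 yb]]] : touch (@adj G) (fiber phi i) (fiber phi (f 2)).
    apply: tphi; rewrite /adj /= /mg_adj /msym /dmat !fE // -val_eqE /= fE //.
    by move: i4; clear; lia.
  have yS : y \notin S.
    apply/negP => yS; move/pred0P/(_ b): i2S; rewrite /= b2 /= in_setU.
    by rewrite (boundary_in yS) // adj_sym.
  have := boundary_in sS xs; have [xS _|_ /= xN] := boolP (x \in S); last first.
    by exists x => //; move: xi; rewrite inE => /eqP.
  have /connP[_ H] := cphi i; have [|||u [w [+ wi + uw]]] := H (fiber phi i :&: S).
  - exact: subsetIl.
  - by apply/set0Pn; exists x; rewrite in_setI xi.
  - by apply/eqP => E; move: yi; rewrite -E in_setI (negbTE yS) andbF.
  rewrite !in_setI wi => /andP[_ uS] /= wS; exists w; last by move: wi; rewrite inE => /eqP.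
  by apply/boundaryP; split=> //; exists u; rewrite // adj_sym.
have NU4 : 4 <= #|boundary S :&: U|.
  have c4 : #|[set (f k.+4) | k : 'I_4]| = 4.
    rewrite card_imset ?card_ord // => k l /(congr1 (@nat_of_ord 8)).
    have [k4 l4] := (ltn_ord k, ltn_ord l).
    by rewrite !inordK // => -[/val_inj].
  have sub : Some @: [set (f k.+4) | k : 'I_4] \subset phi @: (boundary S :&: U).
    apply/subsetP => _ /imsetP[_ /imsetP[k _ ->] ->].
    have k4 := ltn_ord k; have [|x xN px] := hit (f k.+4); first by rewrite fE.
    apply/imsetP; exists x; rewrite // in_setI xN (subsetP (phiU (f k.+4))) //.
    by rewrite inE px.
  rewrite -c4 -(card_imset _ (@Some_inj _)); apply: leq_trans (subset_leq_card sub) _.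
  exact: leq_imset_card.
have NU : boundary S \subset U.
  have E : boundary S :&: U = boundary S.
    by apply/eqP; rewrite eqEcard subsetIl (leq_trans S4).
  by rewrite -E subsetIr.
have N4 : 4 <= #|boundary S| by move: NU4; rewrite (setIidPl NU).
pose T := ~: (S :|: boundary S).
have noST x y : x \in S -> y \in T -> ~~ adj x y.
  move=> xS; rewrite in_setC; apply: contra => xy; rewrite in_setU.
  by apply: (boundary_in xS); rewrite adj_sym.
have bT : boundary T \subset boundary S.
  apply/subsetP => x /boundaryP[xT [y yT xy]]; move: xT; rewrite in_setC negbK in_setU => /orP[xS|//].
  by have := noST x y xS yT; rewrite xy.
have bcomp (X K : {set G}) : is_comp X K -> boundary K \subset boundary X.
  move=> /is_compP[_ KX cl]; apply/subsetP => x /boundaryP[xK [y yK xy]].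
  apply/boundaryP; split; last by exists y => //; apply: (subsetP KX).
  by apply: contra xK => xX; apply: (cl y) => //; rewrite adj_sym.
have b4S K0 : is_comp S K0 -> #|boundary K0| <= 4.
  by move/bcomp/subset_leq_card/leq_trans; apply.
have b4T K0 : is_comp T K0 -> #|boundary K0| <= 4.
  by move/bcomp/subset_leq_card/leq_trans; apply; apply: leq_trans (subset_leq_card bT) S4.
have smaller (X : {set G}) i : fiber phi i \subset X -> ~~ reduced (U :\: X).
  move=> iX; apply/negP => /min; rewrite leqNgt => /negP[].
  apply: proper_card; apply/properP; split; first exact: subsetDl.
  have /set0Pn[x xi] := conn0 (cphi i); exists x; first exact: (subsetP (phiU i)).
  by rewrite in_setD (subsetP iX).
(* The boundary of [S] survives in [U :\: X], which keeps the size above the threshold. *)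
have big (X : {set G}) : [disjoint boundary S & X] -> 3 <= #|U :\: X|.
  move=> d; apply: leq_trans (subset_leq_card (_ : boundary S \subset _)); first exact: ltnW.
  by rewrite subsetD NU.
exfalso.
have [lightS|] := boolP [forall K0, is_comp S K0 ==> (rho K0 <= 4 * #|K0|)].
  have := smaller _ _ i0S; rewrite reduce //.
    by apply: big; rewrite disjoints_subset; apply/subsetP => x /boundaryP[]; rewrite in_setC.
  by move=> K0 cK0; split; [exact: b4S|move/forallP/(_ K0)/implyP: lightS; apply].
case/forallPn => K0; rewrite negb_imply -ltnNge => /andP[cK0 d0].
have i2T : fiber phi (f 2) \subset T by rewrite /T -disjoints_subset.
have := smaller _ _ i2T; rewrite reduce //; first exact: subset_trans bT NU.
  by apply: big; rewrite disjoints_subset setCK subsetUr.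
move=> K1 cK1; split; first exact: b4T.
(* A component that is not light on each side gives a dense bifragment, both boundaries being
   contained in that of [S]. *)
rewrite leqNgt; apply/negP => d1; apply: bl; exists K0, K1.
have [c0 KS _] := is_compP _ _ cK0; have [c1 KT _] := is_compP _ _ cK1.
have noK s t : s \in K0 -> t \in K1 -> ~~ adj s t.
  by move=> /(subsetP KS) sS /(subsetP KT); apply: noST.
split; last by split; rewrite /rho4 -PoszM Num.Theory.subr_gt0 ?ltz_nat.
split; [split|exact: b4S|exact: b4T] => //; [exact: conn0 c0|exact: conn0 c1|].
rewrite disjoints_subset; apply/subsetP => x /(subsetP KS) xS; rewrite in_setC.
by apply/negP => /(subsetP KT); rewrite in_setC in_setU xS.
Qed.

(* Since 3 <= #|G|, the subtraction below is not truncated. *)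
Theorem theorem2p8 (G : sgraph) :
  3 <= #|G| ->
  bilight4 G ->
  4 * #|G| - 7 <= #|edges G| ->
  is_minor K7eq G.
Proof.
move=> n3 bl eG; apply: mm_is_minor (ord0 : K7eq) _; apply: bilight_mm => //.
by move: eG; clear; lia.
Qed.
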